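(* Let $g\ge2$, let $1<a_1<\cdots<a_{g-1}$ be real numbers, let $X$ be the algebraic curve $w^2=z(z^2-1)(z^2-a_1^2)\cdots(z^2-a_{g-1}^2)$, represented as a glued staircase polygon as described in the context, and let $\alpha_1,\dots,\alpha_g,\beta_1,\dots,\beta_g$ be the simple closed curves on $X$ defined there. Then there exists a symplectic basis $\{\alpha_1,\dots,\alpha_g,\gamma_1,\dots,\gamma_g\}$ of $H_1(X,\mathbb{Z})$ such that $$\gamma_j=\sum_{k=j}^g(-1)^{k-j}\beta_k$$ holds in $H_1(X,\mathbb{Z})$ for all $j=1,2,\dots,g$.
   Context: A basis $\{\alpha_1,\dots,\alpha_g,\gamma_1,\dots,\gamma_g\}$ of $H_1(X,\mathbb{Z})$ is symplectic if the intersection numbers satisfy $i(\alpha_j,\alpha_k)=i(\gamma_j,\gamma_k)=0$ and $i(\alpha_j,\gamma_k)=\delta_{j,k}$ for all $j,k$. A curve running to the right crossing a curve running upward once has intersection number $+1$ with it. Polygon. All rectangles are closed with horizontal and vertical sides in $\mathbb{C}$. Let $P_0,\dots,P_{g-1}$ be rectangles, $P_0$ a square, such that: if $g$ is even, then for $0\le i\le\frac{g-2}{2}$, $P_{2i}$ and $P_{2i+1}$ share a full common vertical side with $P_{2i}$ on the left, and for $1\le i\le\frac{g-2}{2}$, $P_{2i-1}$ and $P_{2i}$ share a full common horizontal side with $P_{2i-1}$ below; if $g$ is odd, then for $0\le i\le\frac{g-3}{2}$, $P_{2i}$ and $P_{2i+1}$ share a full common horizontal side with $P_{2i}$ below, and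 for $1\le i\le\frac{g-1}{2}$, $P_{2i-1}$ and $P_{2i}$ share a full common vertical side with $P_{2i-1}$ on the left. Let $r_l$ be the reflection about the line through the upper left and lower right vertices of $P_0$, $Q_i=r_l(P_i)$, and $P=P_0\cup\bigcup_{i=1}^{g-1}(P_i\cup Q_i)$. In the chain $Q_{g-1},\dots,Q_1,P_0,P_1,\dots,P_{g-1}$ consecutive rectangles share a side; rows (resp. columns) are maximal sets of rectangles consecutively adjacent along vertical (resp. horizontal) sides. There are $g$ rows and $g$ columns. Glue by translation, in each row, the left side of the leftmost rectangle to the right side of the rightmost one, and in each column, the bottom side of the lowest rectangle to the top side of the highest one. For each $1<a_1<\cdots<a_{g-1}$ the rectangles can be, and are, chosen so that the resulting compact Riemann surface of genus $g$ is $X$. Curves. $\alpha_1,\dots,\alpha_g$ are the simple closed curves on $X$ formed by the horizontal segments through the centers of the rectangles, one in each row, numbered from bottom to top and oriented from left to right. $\beta_1,\dots,\beta_g$ are the simple closed curves formed by the vertical segments through the centers, one in each column, numbered from left to right and oriented upward. *)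

(* Defs.v *)
From HB Require Import structures.
From Stdlib Require Import Relations.Relation_Operators.
From mathcomp Require Import freeg.
From mathcomp Require Import all_boot all_order all_algebra.
From mathcomp Require Import all_classical all_reals all_analysis.
From mathcomp Require Import complex ring_quotient.

Set Implicit Arguments.
Unset Strict Implicit.
Unset Printing Implicit Defensive.

Import Order.TTheory GRing.Theory Num.Theory.
Import numFieldNormedType.Exports.

Local Open Scope classical_set_scope.
Local Open Scope ring_scope.

Section SingularChains.
Context (R : realType).

Definition std_simplex n : set 'rV[R]_n.+1 :=
  [set t | (forall i, 0 <= t 0 i) /\ \sum_i t 0 i = 1].
Arguments std_simplex : clear implicits.

Definition face_row n (i : 'I_n.+2) (t : 'rV[R]_n.+1) : 'rV[R]_n.+2 :=
  \row_j (if unlift i j is Some k then t 0 k else 0).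

Lemma face_row_simplex n (i : 'I_n.+2) (t : std_simplex n) :
  face_row i (\val t) \in std_simplex n.+1.
Proof.
case: t => t /= /set_mem [t_ge0 t_sum]; apply/mem_set; split.
  by move=> j; rewrite mxE; case: unlift.
rewrite (bigD1 i) //= mxE unlift_none add0r -t_sum.
rewrite (reindex (lift i)) /=; last first.
  exists (fun j => odflt ord0 (unlift i j)) => [k _|j]; first by rewrite liftK.
  by rewrite !inE eq_sym => /unlift_some[k -> ->].
apply: eq_big => [k|k _]; first by rewrite eq_sym neq_lift.
by rewrite mxE liftK.
Qed.

Definition face_map n (i : 'I_n.+2) (t : std_simplex n) : std_simplex n.+1 :=
  exist _ (face_row i (\val t)) (face_row_simplex i t).

Lemma face_map_continuous n (i : 'I_n.+2) : continuous (@face_map n i).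
Proof.
suff cf : continuous ((@set_val _ (std_simplex n.+1)) \o @face_map n i).
  apply/continuousP => _ [B oB <-].
  by have /continuousP/(_ B oB) := cf.
move=> t A /= [V Vnbhs VA].
have key j : \forall s \near t, V ord0 j (face_row i (\val s) ord0 j).
  have := Vnbhs ord0 j; rewrite /= set_valE /= /face_row mxE => Vj.
  suff : nbhs t (fun s : std_simplex n =>
      V ord0 j (if unlift i j is Some k then \val s 0 k else 0)).
    by apply: filterS => s; rewrite mxE.
  case: (unlift i j) Vj => [k|] Vj; last first.
    by apply: (@filterE _ (nbhs t)) => s; exact: nbhs_singleton.
  have ck : {for t, continuous (fun s : std_simplex n => \val s 0 k)}.
    apply: (@continuous_comp _ _ _ (@set_val _ (std_simplex n))
      (fun M : 'rV[R]_n.+1 => M 0 k)).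
      exact: initial_continuous.
    exact: coord_continuous.
  exact: ck.
have VV : nbhs t (fun s : std_simplex n =>
    forall j, V ord0 j (face_row i (\val s) ord0 j)).
  by have := @filter_forall _ _
    (fun j (s : std_simplex n) => V ord0 j (face_row i (\val s) ord0 j)) _
    (nbhs_filter t) key.
suff : nbhs t (fun s : std_simplex n => A (face_row i (\val s))) by [].
move: VV; apply: filterS => s Vs; apply: VA => i0 j.
by rewrite ord1; exact: Vs.
Qed.

Context (X : topologicalType).

Definition singular n := continuousType (std_simplex n) X.

Definition face n (i : 'I_n.+2) (s : singular n.+1) : singular n :=
  mkcts (fun t => @continuous_comp _ _ _ (face_map i) s t
           (@face_map_continuous n i t) (cts_fun (face_map i t))).

Definition chain n := {freeg (singular n)}.

Definition boundary n : chain n.+1 -> chain n :=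
  fglift (fun s : singular n.+1 =>
    \sum_(i < n.+2) (-1) ^+ i *: (<< face i s >> : chain n)).

Fact boundary_is_additive n : additive (@boundary n).
Proof. exact: lift_is_additive. Qed.
HB.instance Definition _ n := GRing.isZmodMorphism.Build (chain n.+1) (chain n)
  (@boundary n) (@boundary_is_additive n).

(* The generator given by a map of the standard simplex; the value for
   discontinuous maps is a dummy. *)
Definition chain_of n (f : std_simplex n -> X) : chain n :=
  if pselect (continuous f) is left cf then << (mkcts cf : singular n) >>
  else 0.

Definition Z1 : {pred chain 1} := fun c => boundary c == 0.

Fact Z1_zmod_closed : zmod_closed Z1.
Proof.
split=> [|c d]; first by apply/eqP; exact: raddf0.
by move=> /eqP c0 /eqP d0; apply/eqP; rewrite -[RHS](subrr 0) -{1}c0 -d0; exact: raddfB.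
Qed.
HB.instance Definition _ := GRing.isZmodClosed.Build (chain 1) Z1 Z1_zmod_closed.

Definition cycle1 := {c : chain 1 | c \in Z1}.
HB.instance Definition _ := [isSub of cycle1 for sval].
HB.instance Definition _ := [Choice of cycle1 by <:].
HB.instance Definition _ := [SubChoice_isSubZmodule of cycle1 by <:].

Definition B1 : {pred cycle1} := fun z => `[< exists c, \val z = boundary c >].

Fact B1_zmod_closed : zmod_closed B1.
Proof.
split=> [|z y]; rewrite !unfold_in.
  by apply/asboolP; exists 0; rewrite !raddf0.
move=> /asboolP[c zc] /asboolP[d yd]; apply/asboolP; exists (c - d).
transitivity (\val z - \val y); first exact: raddfB.
by rewrite [\val z]zc [\val y]yd; symmetry; exact: raddfB.
Qed.
HB.instance Definition _ := GRing.isZmodClosed.Build cycle1 B1 B1_zmod_closed.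

Definition H1 : zmodType := Quotient.quot B1.

(* The class of a 1-cycle (0, as a dummy, for a chain that is not a cycle). *)
Definition hclass (c : chain 1) : H1 :=
  (\pi_(Quotient.quot B1) (insubd (0 : cycle1) c))%qT.

Definition cochain n := singular n -> int.

Definition ceval n (phi : cochain n) : chain n -> int :=
  fglift (phi : singular n -> int^o).

Definition cocycle1 (phi : cochain 1) := forall s, ceval phi (boundary << s >>) = 0.

(* For s = [v0, v1, v2], the front edge [v0, v1] is the face opposite to v2
   and the back edge [v1, v2] the face opposite to v0. *)
Definition cup (phi psi : cochain 1) : cochain 2 :=
  fun s => phi (face ord_max s) * psi (face ord0 s).

Definition cap (mu : chain 2) (phi : cochain 1) : chain 1 :=
  fglift (fun s : singular 2 =>
    phi (face ord_max s) *: (<< face ord0 s >> : chain 1)) mu.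

(* The intersection form of a closed surface with fundamental cycle mu: the cup
   product of the Poincare duals of the two classes, evaluated on mu.
   Sign: on the torus R^2/Z^2 with mu = [00,10,11] - [00,01,11], capping mu
   with dx gives the upward curve and capping it with dy gives minus the
   rightward one, so a curve running to the right has intersection number
   - <dy \cup dx, mu> = 1 with a curve running upward. *)
Definition intersection (mu : chain 2) (a b : H1) : int :=
  xget 0 [set n | exists phi psi : cochain 1,
    [/\ cocycle1 phi, cocycle1 psi,
        hclass (cap mu phi) = a, hclass (cap mu psi) = b &
        n = ceval (cup phi psi) mu]].

End SingularChains.

Arguments std_simplex : clear implicits.

Definition is_basis (M : zmodType) (I : finType) (e : I -> M) :=
  forall h : M, exists! c : {ffun I -> int}, h = \sum_i e i *~ c i.

Definition symplectic_basis (M : zmodType) (i : M -> M -> int) g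
    (alpha gamma : 'I_g -> M) :=
  is_basis (fun s : 'I_g + 'I_g =>
    match s with inl j => alpha j | inr j => gamma j end) /\
  forall j k, [/\ i (alpha j) (alpha k) = 0, i (gamma j) (gamma k) = 0 &
                  i (alpha j) (gamma k) = (j == k)%:R].

Section Curve.
Context (R : realType) (g : nat) (a : 'I_g.-1 -> R).
Local Notation C := (R[i]^o).

Definition affine_curve : set (C * C) :=
  [set p | p.2 ^+ 2 =
    p.1 * (p.1 ^+ 2 - 1) * \prod_i (p.1 ^+ 2 - ((a i)%:C)%C ^+ 2)].

(* a_{i+1} is a i. The polynomial in z is separable of odd degree, so that the
   affine curve is smooth and has exactly one point at infinity. *)
Definition curve : topologicalType := one_point_compactification affine_curve.

Definition infinite_point : curve := None.
Definition zcoord (x : curve) : C := if x is Some p then (\val p).1 else 0.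
Definition wcoord (x : curve) : C := if x is Some p then (\val p).2 else 0.

(* C is identified with R * R. *)
Definition holomorphic_at (rho : R * R -> curve) (p : R * R) :=
  derivable (fun z : C => zcoord (rho (complex.Re z, complex.Im z)))
    (Complex p.1 p.2 : C) 1 /\
  derivable (fun z : C => wcoord (rho (complex.Re z, complex.Im z)))
    (Complex p.1 p.2 : C) 1.

End Curve.

Record rect (R : realType) := Rect { xl : R; xr : R; yb : R; yt : R }.

Section Polygon.
Context (R : realType).
Implicit Types (A B : rect R) (p q : R * R).

Definition nondegenerate A := xl A < xr A /\ yb A < yt A.
Definition square A := xr A - xl A = yt A - yb A.
Definition in_rect A p := (xl A <= p.1 <= xr A) && (yb A <= p.2 <= yt A).

(* A and B share a full side, with A on the left of B (resp. below B). *)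
Definition left_of A B := [&& xr A == xl B, yb A == yb B & yt A == yt B].
Definition below A B := [&& yt A == yb B, xl A == xl B & xr A == xr B].

Definition staircase g (P : nat -> rect R) :=
  [/\ forall i, (i < g)%N -> nondegenerate (P i),
      square (P 0%N) &
      if odd g then
        (forall i, (i <= (g - 3)./2)%N -> below (P i.*2) (P i.*2.+1)) /\
        (forall i, (1 <= i <= (g - 1)./2)%N -> left_of (P i.*2.-1) (P i.*2))
      else
        (forall i, (i <= (g - 2)./2)%N -> left_of (P i.*2) (P i.*2.+1)) /\
        (forall i, (1 <= i <= (g - 2)./2)%N -> below (P i.*2.-1) (P i.*2))].

Context (g : nat) (P : nat -> rect R).

(* As P 0 is a square, the line through its upper left and lower right vertices
   is x + y = xl (P 0) + yt (P 0), and the reflection about it is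
   (x, y) |-> (c - y, c - x) with c the right-hand side. *)
Definition reflect_rect A : rect R :=
  let c := xl (P 0%N) + yt (P 0%N) in
  Rect (c - yt A) (c - yb A) (c - xr A) (c - xl A).

(* The chain Q_{g-1}, ..., Q_1, P_0, P_1, ..., P_{g-1}, numbered from 0. It goes
   from the lower left to the upper right, each rectangle being below or on the
   left of the next one. *)
Definition ncells := (g.-1).*2.+1.
Definition cell k : rect R :=
  if (k < g.-1)%N then reflect_rect (P (g.-1 - k)%N) else P (k - g.-1)%N.

(* Rows are the maximal runs without vertical step along the chain; they are
   numbered from 0, from bottom to top. Similarly for columns, from left to
   right. *)
Definition row_of k := (\sum_(m < k) below (cell m) (cell m.+1))%N.
Definition col_of k := (\sum_(m < k) left_of (cell m) (cell m.+1))%N.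

Definition polygon : set (R * R) :=
  [set p | exists2 k, (k < ncells)%N & in_rect (cell k) p].

(* p is on the left side of the leftmost rectangle of a row, and q is the
   corresponding point of the right side of the rightmost one. *)
Definition glue_horizontal p q := exists k l,
  [/\ (k < ncells)%N, (l < ncells)%N, row_of k = row_of l,
      forall m, (m < ncells)%N -> row_of m = row_of k ->
        xl (cell k) <= xl (cell m) /\ xr (cell m) <= xr (cell l) &
      [/\ in_rect (cell k) p, in_rect (cell l) q, p.1 = xl (cell k),
          q.1 = xr (cell l) & p.2 = q.2]].

Definition glue_vertical p q := exists k l,
  [/\ (k < ncells)%N, (l < ncells)%N, col_of k = col_of l,
      forall m, (m < ncells)%N -> col_of m = col_of k ->
        yb (cell k) <= yb (cell m) /\ yt (cell m) <= yt (cell l) &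
      [/\ in_rect (cell k) p, in_rect (cell l) q, p.2 = yb (cell k),
          q.2 = yt (cell l) & p.1 = q.1]].

Definition glued : R * R -> R * R -> Prop :=
  clos_refl_sym_trans _ (fun p q => glue_horizontal p q \/ glue_vertical p q).

(* rho presents X as the quotient space of the polygon by the gluing. *)
Definition gluing_map (X : topologicalType) (rho : R * R -> X) :=
  [/\ rho @` polygon = setT,
      forall p q, polygon p -> polygon q -> (rho p = rho q <-> glued p q) &
      forall U : set X, open U <-> open (rho @^-1` U : set (subspace polygon))].

(* rho identifies the glued polygon with the Riemann surface of the curve. The
   continuous map induced by rho on the glued polygon being holomorphic off the
   boundary of the polygon and the preimage of the point at infinity, it is
   holomorphic everywhere (Morera, Riemann), hence biholomorphic. *)
Definition curve_model (a : 'I_g.-1 -> R) (rho : R * R -> curve a) :=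
  gluing_map rho /\
  forall p, interior polygon p -> rho p <> infinite_point a ->
    holomorphic_at rho p.

Context (X : topologicalType) (rho : R * R -> X).

Definition affine_simplex n (v : n.+1.-tuple (R * R)) (t : std_simplex R n) :
    R * R :=
  (\sum_i \val t 0 i * (tnth v i).1, \sum_i \val t 0 i * (tnth v i).2).

Definition polygon_simplex n (v : n.+1.-tuple (R * R)) : chain R X n :=
  chain_of (rho \o affine_simplex v).

Definition xc A := (xl A + xr A) / 2.
Definition yc A := (yb A + yt A) / 2.

(* alpha j is the sum of the horizontal segments through the centers of the
   rectangles of the row j, oriented from left to right. *)
Definition alpha (j : 'I_g) : H1 R X :=
  hclass (\sum_(k < ncells | row_of k == j)
    polygon_simplex
      [tuple (xl (cell k), yc (cell k)); (xr (cell k), yc (cell k))]).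

Definition beta (j : 'I_g) : H1 R X :=
  hclass (\sum_(k < ncells | col_of k == j)
    polygon_simplex
      [tuple (xc (cell k), yb (cell k)); (xc (cell k), yt (cell k))]).

(* Each rectangle is cut along its diagonal from lower left to upper right, and
   the two triangles are counted with the orientation of C. *)
Definition fundamental_cycle : chain R X 2 :=
  \sum_(k < ncells)
    (polygon_simplex [tuple (xl (cell k), yb (cell k)); (xr (cell k), yb (cell k));
                            (xr (cell k), yt (cell k))] -
     polygon_simplex [tuple (xl (cell k), yb (cell k)); (xl (cell k), yt (cell k));
                            (xr (cell k), yt (cell k))]).

End Polygon.

(* Main.v *)
Require Import Defs.
From HB Require Import structures.
From Stdlib Require Import Relations.Relation_Operators.
From mathcomp Require Import freeg.
From mathcomp Require Import all_boot all_order all_algebra.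
From mathcomp Require Import all_classical all_reals all_analysis.
From mathcomp Require Import ring_quotient ring lra zify.

Set Implicit Arguments.
Unset Strict Implicit.
Unset Printing Implicit Defensive.

Import Order.TTheory GRing.Theory Num.Theory.
Import numFieldNormedType.Exports.
Local Open Scope classical_set_scope.
Local Open Scope ring_scope.

(** The polygon is cut by a grid [x_0 < ... < x_g], [y_0 < ... < y_g]: the cell
    [k] of the chain is [x_j, x_{j+1}] * [y_i, y_{i+1}] with [j = k./2] and
    [i = uphalf k], so that its steps go alternately up and right, the row [i]
    consists of the cells [2i-1], [2i] and the column [j] of the cells [2j],
    [2j+1]. All corners of cells are glued to a single point. Every side of a
    cell is therefore a loop: write [h_k] and [v_k] for the bottom and left sides
    of the cell [k]. The top side of [k] is [h_(above k)] and its right side is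
    [v_(right_of k)], where [above] exchanges [2j] and [2j+1], and [right_of]
    exchanges [2i-1] and [2i].

    In homology, the boundary of the cell [k] gives
    [h_k - h_(above k) = v_k - v_(right_of k)]. The right-hand side is 0 for
    [k = 0], and the difference changes sign under [above] and under [right_of],
    which together connect all cells; so both sides vanish for all [k]
    ([edges_across]). Hence [h_k] only depends on [j = k./2] and [v_k] only on
    [i = uphalf k]. Sliding a central curve to the sides of its row or column,
    [alpha_i = h_(2i-2) + h_(2i)] and [beta_j = v_(2j) + v_(2j+2)] (terms out of
    range being 0), and the alternating sum [gamma_j] of the [beta_k] telescopes
    to the single edge [v_(2j)] ([class_gamma]).

    The classes of the edges generate the first homology group
    ([edges_generate]). Modulo boundaries and edges, the segment from a corner of
    a cell to a point of the cell depends only on the image of the point in the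
    surface ([radial_class]); this gives a function [q] on the surface, and it is
    enough that every path from [a] to [b] is equivalent to [q b - q a]. This can
    be checked on short paths. A short path stays in an open set that contracts,
    inside the cells and along straight segments, onto one point: each coordinate
    is contracted either to the nearest grid value, or to a point of the open
    grid interval that contains it ([rounding_exists], [homotopic_path]).

    The edges are independent because there are enough integral cocycles.
    A function on the polygon that agrees modulo 1 at glued points defines
    a map to the circle, and the variation of its lifts along paths is a cocycle
    ([circle_cocycle]); ramps in one coordinate, constant outside one column or
    one row, give the cocycles that count crossings with the [beta_j] and the
    [alpha_i]. Their cap products with the fundamental cycle are the [beta_j] and,
    up to sign, the [alpha_i], so they are Poincare duals ([cls_cap_gamma],
    [cls_cap_alpha]).

    The intersection form is then read off: if [phi], [psi] are dual to [a], [b],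
    then [(phi cup psi)(mu) = psi(mu cap phi) = psi(a)]. The result does not
    depend on the choice of the dual cocycles, because the cup product of
    1-cocycles is anticommutative on cycles ([intersectionE]). The matrix of the
    values of these cocycles on the [alpha_i] and [gamma_j] is the identity up to
    signs, which gives both the intersection numbers and the uniqueness of
    coordinates. *)

(** * Singular chains carried by affine simplices *)

Section FreeGroup.
Context (K : choiceType).

(** Closure under differences is the form in which subgroups come below. *)
Lemma freeg_subgroup_ind (P : {freeg K} -> Prop) :
  P 0 -> (forall c d, P c -> P d -> P (c - d)) -> (forall s, P << s >>) ->
  forall c, P c.
Proof.
move=> P0 PB Pg c.
have PN d : P d -> P (- d) by move=> Pd; rewrite -sub0r; exact: PB.
have PD d e : P d -> P e -> P (d + e).
  by move=> Pd Pe; rewrite -[e]opprK; apply: PB => //; exact: PN.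
rewrite -(freeg_sumE c); elim/big_ind: _ => // s _.
rewrite -[coeff s c]intz -freegU_mulz; case: (coeff s c) => n.
  by elim: n => [|n IHn]; rewrite ?mulr0z // -pmulrn mulrS; exact: PD.
rewrite NegzE mulrNz; apply: PN; rewrite -pmulrn.
by elim: n => [|n IHn]; rewrite ?mulr1n // mulrS; exact: PD.
Qed.

End FreeGroup.

Section Homology.
Context (R : realType) (X : topologicalType).
Implicit Types (A : rect R) (f : R * R -> X) (p q r : R * R).

HB.instance Definition _ (M : lmodType int) (K : choiceType) (f : K -> M) :=
  GRing.isZmodMorphism.Build {freeg K} M (fglift f) (lift_is_additive f).

Lemma fglift1 (M : lmodType int) (K : choiceType) (f : K -> M) k :
  fglift f << k >> = f k.
Proof. by rewrite liftU scale1r. Qed.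

(** The point is that the value does not depend on the proof of continuity
    that is used. *)
Lemma chain_ofE n (f : std_simplex R n -> X) (cf : continuous f) :
  chain_of f = << (mkcts cf : singular R X n) >>.
Proof.
rewrite /chain_of; case: pselect => // cf'.
by congr (<< _ >>); apply/continuousEP.
Qed.

Lemma singularE n (s : singular R X n) : << s >> = chain_of s.
Proof.
by rewrite (chain_ofE (@cts_fun _ _ s)); congr (<< _ >>); exact/continuousEP.
Qed.

Lemma boundary_chain_of n (f : std_simplex R n.+1 -> X) : continuous f ->
  boundary (chain_of f) =
  \sum_(i < n.+2) (-1) ^+ i *: chain_of (f \o @face_map R n i).
Proof.
move=> cf; rewrite (chain_ofE cf) /boundary fglift1.
by apply: eq_bigr => i _; rewrite singularE.
Qed.

Lemma affine_in_rect A n (v : n.+1.-tuple (R * R)) (t : std_simplex R n) :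
  (forall i, in_rect A (tnth v i)) -> in_rect A (affine_simplex v t).
Proof.
case: t => t /= tS Av; have /set_mem[t0 t1] := tS.
rewrite /in_rect /affine_simplex /=.
have mean (u : R) : \sum_i t 0 i * u = u by rewrite -mulr_suml t1 mul1r.
rewrite -(mean (xl A)) -(mean (xr A)) -(mean (yb A)) -(mean (yt A)).
by do 2![apply/andP; split]; apply: ler_sum => i _;
  rewrite ler_wpM2l //; have /andP[/andP[? ?] /andP[? ?]] := Av i.
Qed.

Lemma barycentric_continuous n (i : 'I_n.+1) :
  continuous (fun t : std_simplex R n => \val t 0 i).
Proof.
move=> t; apply: (@continuous_comp _ _ _ (@set_val _ (std_simplex R n))
      (fun M : 'rV[R]_n.+1 => M 0 i)).
  exact: initial_continuous.
exact: coord_continuous.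
Qed.

Lemma sum_continuous (T : topologicalType) n (F : 'I_n -> T -> R) :
  (forall i, continuous (F i)) -> continuous (fun x => \sum_i F i x).
Proof.
by move=> cF; apply: continuous_big => //; exact: add_continuous.
Qed.

Lemma affine_continuous n (v : n.+1.-tuple (R * R)) :
  continuous (@affine_simplex R n v).
Proof.
have sum_cont (h : 'I_n.+1 -> R) :
    continuous (fun t : std_simplex R n => \sum_i \val t 0 i * h i).
  have cF i : continuous (fun t : std_simplex R n => \val t 0 i * h i).
    move=> t; apply: (@cvgMl _ _ (nbhs t) _ (fun t : std_simplex R n => \val t 0 i)).
    exact: (@barycentric_continuous n i t).
  exact: sum_continuous cF.
move=> t; exact: (cvg_pair (sum_cont (fun i => (tnth v i).1) t)
                          (sum_cont (fun i => (tnth v i).2) t)).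
Qed.

Lemma polygon_simplex_continuous A f n (v : n.+1.-tuple (R * R)) :
  {within [set p | in_rect A p], continuous f} ->
  (forall i, in_rect A (tnth v i)) ->
  continuous (f \o affine_simplex v).
Proof.
move=> /subspace_continuousP cf Av t.
have := cf _ (@affine_in_rect A n v t Av); apply: cvg_trans.
move=> U /=; rewrite /within /= => fU.
apply: (@filterS _ (nbhs t) _ _ _ _ (@affine_continuous n v t _ fU)) => s /=.
by apply; exact: affine_in_rect.
Qed.

Definition omit_vertex n (v : n.+2.-tuple (R * R)) (i : 'I_n.+2) :=
  [tuple tnth v (lift i j) | j < n.+1].

Lemma affine_face n (v : n.+2.-tuple (R * R)) (i : 'I_n.+2) :
  affine_simplex v \o @face_map R n i = affine_simplex (omit_vertex v i).
Proof.
have sumE (t : std_simplex R n) (h : 'I_n.+2 -> R) :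
    \sum_j (face_row i (\val t)) 0 j * h j = \sum_j \val t 0 j * h (lift i j).
  rewrite (bigD1 i) //= mxE unlift_none mul0r add0r.
  rewrite (reindex (lift i)) /=; last first.
    exists (fun j => odflt ord0 (unlift i j)) => [k _|j]; first by rewrite liftK.
    by rewrite !inE eq_sym => /unlift_some[k -> ->].
  apply: eq_big => [k|k _]; first by rewrite eq_sym neq_lift.
  by rewrite mxE liftK.
apply/funext => t; rewrite /affine_simplex /=.
by congr (_, _); rewrite sumE; apply: eq_bigr => j _; rewrite tnth_mktuple.
Qed.

Lemma boundary_polygon_simplex A f n (v : n.+2.-tuple (R * R)) :
  {within [set p | in_rect A p], continuous f} ->
  (forall i, in_rect A (tnth v i)) ->
  boundary (polygon_simplex f v) =
  \sum_(i < n.+2) (-1) ^+ i *: polygon_simplex f (omit_vertex v i).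
Proof.
move=> cf Av; rewrite boundary_chain_of; last exact: polygon_simplex_continuous cf Av.
by apply: eq_bigr => i _; rewrite -compA affine_face.
Qed.

(** Every homology between chains of the surface is assembled from this one:
    applied to a map [f] on a rectangle, it covers the cells of the polygon,
    concatenation of paths (degenerate triangles) and homotopies (triangulated
    squares). *)
Lemma boundary_triangle A f p q r :
  {within [set p | in_rect A p], continuous f} ->
  in_rect A p -> in_rect A q -> in_rect A r ->
  boundary (polygon_simplex f [tuple p; q; r]) =
  polygon_simplex f [tuple q; r] - polygon_simplex f [tuple p; r] +
  polygon_simplex f [tuple p; q].
Proof.
move=> cf Ap Aq Ar; rewrite (boundary_polygon_simplex cf); last first.
  by case=> [[|[|[|//]]] ?].
rewrite !big_ord_recl big_ord0 addr0 /= /bump /= expr0 expr1 expr2 mulN1r opprK.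
rewrite !scaleN1r !scale1r addrA.
by congr (_ - _ + _); congr (polygon_simplex f _);
  apply: eq_from_tnth => -[[|[|//]] ?]; rewrite tnth_mktuple.
Qed.

Lemma boundary_segment A f p q :
  {within [set p | in_rect A p], continuous f} ->
  in_rect A p -> in_rect A q ->
  boundary (polygon_simplex f [tuple p; q]) =
  polygon_simplex f [tuple q] - polygon_simplex f [tuple p].
Proof.
move=> cf Ap Aq; rewrite (boundary_polygon_simplex cf); last first.
  by case=> [[|[|//]] ?].
rewrite !big_ord_recl big_ord0 addr0 /= /bump /= expr0 expr1.
rewrite !scaleN1r !scale1r.
by congr (_ - _); congr (polygon_simplex f _);
  apply: eq_from_tnth => -[[|//] ?]; rewrite tnth_mktuple.
Qed.

End Homology.

(** * One-chains modulo boundaries *)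

Section ChainClasses.
Context (R : realType) (X : topologicalType).

Definition boundaries : {pred chain R X 1} := fun c => `[< exists b, c = boundary b >].

Fact boundaries_zmod_closed : zmod_closed boundaries.
Proof.
split=> [|c d]; rewrite !unfold_in.
  by apply/asboolP; exists 0; rewrite raddf0.
move=> /asboolP[b ->] /asboolP[b' ->]; apply/asboolP; exists (b - b').
by rewrite raddfB.
Qed.
HB.instance Definition _ :=
  GRing.isZmodClosed.Build (chain R X 1) boundaries boundaries_zmod_closed.

(** The homology group embeds in this group of all chains modulo boundaries,
    in which paths with distinct endpoints have classes too and can be
    concatenated. *)
Definition chain_class := Quotient.quot boundaries.
HB.instance Definition _ := GRing.Zmodule.on chain_class.

Definition cls (c : chain R X 1) : chain_class := (\pi_(chain_class) c)%qT.

Fact cls_is_zmod_morphism : zmod_morphism cls.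
Proof. by move=> c d; rewrite /cls !piE. Qed.
HB.instance Definition _ := GRing.isZmodMorphism.Build (chain R X 1) chain_class
  cls cls_is_zmod_morphism.

Lemma cls_eqP c d : cls c = cls d <-> exists b, c - d = boundary b.
Proof.
split=> [/eqP|cd].
  by rewrite -Quotient.idealrBE => /asboolP.
by apply/eqP; rewrite -Quotient.idealrBE; apply/asboolP.
Qed.

Lemma cls_boundary b : cls (boundary b) = 0.
Proof.
by rewrite -[RHS](raddf0 cls); apply/cls_eqP; exists b; rewrite subr0.
Qed.

Lemma cls_surj (w : chain_class) : exists c, cls c = w.
Proof. by exists (repr w); rewrite /cls reprK. Qed.

Definition class_of_H1 (h : H1 R X) : chain_class := cls (\val (repr h)).

Lemma class_of_pi (z : cycle1 R X) :
  class_of_H1 (\pi_(Quotient.quot (@B1 R X)) z)%qT = cls (\val z).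
Proof.
apply/cls_eqP.
have /eqP := reprK ((\pi_(Quotient.quot (@B1 R X)) z)%qT).
by rewrite -Quotient.idealrBE => /asboolP[b bE]; exists b; rewrite -bE.
Qed.

Fact class_of_H1_is_zmod_morphism : zmod_morphism class_of_H1.
Proof.
move=> h k.
have -> : h - k = (\pi_(Quotient.quot (@B1 R X)) (repr h - repr k))%qT.
  by rewrite -[in LHS](reprK h) -[in LHS](reprK k) -raddfB.
by rewrite class_of_pi -raddfB.
Qed.
HB.instance Definition _ := GRing.isZmodMorphism.Build (H1 R X) chain_class
  class_of_H1 class_of_H1_is_zmod_morphism.

Lemma class_of_H1_inj : injective class_of_H1.
Proof.
apply: raddf_inj => h h0.
have -> : 0 = (\pi_(Quotient.quot (@B1 R X)) 0)%qT by rewrite raddf0.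
rewrite -[h]reprK; apply/eqP; rewrite -Quotient.idealrBE subr0; apply/asboolP.
have /cls_eqP[b bE] : cls (\val (repr h)) = cls 0 by rewrite raddf0.
by exists b; rewrite -bE subr0.
Qed.

Lemma class_of_hclass c : c \in @Z1 R X -> class_of_H1 (hclass c) = cls c.
Proof. by move=> Zc; rewrite /hclass class_of_pi insubdK. Qed.

Lemma H1_cycle (h : H1 R X) : exists2 c, c \in @Z1 R X & hclass c = h.
Proof.
exists (\val (repr h)); first exact: valP.
by rewrite /hclass valKd reprK.
Qed.

End ChainClasses.

(** * Segments modulo boundaries *)

Section Segments.
Context (R : realType) (X : topologicalType).
Implicit Types (A : rect R) (f : R * R -> X) (p q r d : R * R).

Definition seg f p q : chain_class R X := cls (polygon_simplex f [tuple p; q]).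

Lemma segD A f p q r :
  {within [set p | in_rect A p], continuous f} ->
  in_rect A p -> in_rect A q -> in_rect A r ->
  seg f p q + seg f q r = seg f p r.
Proof.
move=> cf Ap Aq Ar; have := cls_boundary (polygon_simplex f [tuple p; q; r]).
rewrite (boundary_triangle cf) // raddfD raddfB /= => /eqP.
by rewrite addrAC subr_eq0 addrC => /eqP.
Qed.

Lemma segxx A f p :
  {within [set p | in_rect A p], continuous f} -> in_rect A p -> seg f p p = 0.
Proof. by move=> cf Ap; apply: (addrI (seg f p p)); rewrite (segD cf) ?addr0. Qed.

Lemma polygon_simplex_translate A f f' d n (v w : n.+1.-tuple (R * R)) :
  (forall i, in_rect A (tnth v i)) ->
  (forall z, in_rect A z -> f' (z.1 + d.1, z.2 + d.2) = f z) ->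
  (forall i, tnth w i = ((tnth v i).1 + d.1, (tnth v i).2 + d.2)) ->
  polygon_simplex f' w = polygon_simplex f v.
Proof.
move=> Av ff' wv; rewrite /polygon_simplex; congr chain_of.
apply/funext => t /=; rewrite -ff'; last exact: affine_in_rect.
have /set_mem[_ t1] := valP t; congr f'; rewrite /affine_simplex /=.
by congr (_, _); rewrite -[X in _ = _ + X]mul1r -t1 mulr_suml -big_split /=;
  apply: eq_bigr => i _; rewrite wv mulrDr.
Qed.

(** This is how the gluing enters homology: a segment on a side of the polygon
    and its translate on the opposite side are the same singular simplex. *)
Lemma seg_translate A f f' d p q :
  in_rect A p -> in_rect A q ->
  (forall z, in_rect A z -> f' (z.1 + d.1, z.2 + d.2) = f z) ->
  seg f' (p.1 + d.1, p.2 + d.2) (q.1 + d.1, q.2 + d.2) = seg f p q.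
Proof.
move=> Ap Aq ff'; rewrite /seg; congr cls.
by apply: (polygon_simplex_translate _ ff') => -[[|[|//]] ?].
Qed.

Lemma eq_seg A f f' p q :
  in_rect A p -> in_rect A q -> (forall z, in_rect A z -> f' z = f z) ->
  seg f' p q = seg f p q.
Proof.
move=> Ap Aq ff'; have := @seg_translate A f f' 0 p q Ap Aq.
rewrite !addr0; case: p q {Ap Aq} => [p1 p2] [q1 q2]; apply=> z Az.
by rewrite !addr0 -ff' //; case: (z).
Qed.

Lemma seg_const A f p q : in_rect A p -> in_rect A q ->
  (forall z, in_rect A z -> f z = f p) -> seg f p q = 0.
Proof.
move=> Ap Aq fp; rewrite (@eq_seg A (cst (f p)) f) //.
have cc : {within [set z | in_rect A z], continuous (cst (f p))}.
  by apply: continuous_subspaceT => z; exact: cvg_cst.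
apply: (addrI (seg (cst (f p)) p q)); rewrite addr0 -[RHS](segD cc Ap Aq Aq).
by congr (_ + _).
Qed.

End Segments.

(** * Singular edges as paths *)

Section Paths.
Context (R : realType) (X : topologicalType).

Lemma to_simplex_continuous (T : topologicalType) n (e : T -> std_simplex R n) :
  (forall i, continuous (fun x => \val (e x) 0 i)) -> continuous e.
Proof.
move=> ce.
suff cf : continuous ((@set_val _ (std_simplex R n)) \o e).
  apply/continuousP => _ [B oB <-].
  by have /continuousP/(_ B oB) := cf.
move=> t A /= [V Vnbhs VA].
have VV : nbhs t (fun s => forall j, V ord0 j (\val (e s) ord0 j)).
  apply: (@filter_forall _ _ (fun j s => V ord0 j (\val (e s) ord0 j)) _
    (nbhs_filter t)) => j.
  exact: (ce j t _ (Vnbhs ord0 j)).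
apply: (@filterS _ (nbhs t) _ _ _ _ VV) => s Vs; apply: VA => i0 j.
by rewrite ord1; exact: Vs.
Qed.

(** The retraction of the line to the unit interval makes paths and homotopies
    total functions. *)
Definition clamp01 (x : R) : R := Num.max 0 (Num.min 1 x).

Lemma clamp01_ge0 x : 0 <= clamp01 x.
Proof. by rewrite le_max lexx. Qed.
Lemma clamp01_le1 x : clamp01 x <= 1.
Proof. by rewrite ge_max ler01 ge_min lexx. Qed.
Lemma clamp01_id x : 0 <= x <= 1 -> clamp01 x = x.
Proof. by move=> /andP[x0 x1]; rewrite /clamp01 (min_idPr x1) (max_idPr x0). Qed.
Lemma clamp01_0 x : x <= 0 -> clamp01 x = 0.
Proof. by move=> x0; rewrite /clamp01 (min_idPr _) ?(max_idPl _) // (le_trans x0). Qed.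
Lemma clamp01_1 x : 1 <= x -> clamp01 x = 1.
Proof. by move=> x1; rewrite /clamp01 (min_idPl x1) (max_idPr ler01). Qed.
Lemma clamp01_continuous : continuous clamp01.
Proof.
have cmin : continuous ((cst 1 : R -> R^o) \min (id : R -> R^o)).
  by move=> x; apply: continuous_min; [exact: cvg_cst|exact: cvg_id].
have cmax : continuous ((cst 0 : R -> R^o) \max ((cst 1 : R -> R^o) \min id)).
  by move=> x; apply: continuous_max; [exact: cvg_cst|exact: cmin].
exact: cmax.
Qed.

Definition edge_row (x : R) : 'rV[R]_2 :=
  \row_i if i == 0 then 1 - clamp01 x else clamp01 x.

Lemma edge_row_simplex x : edge_row x \in std_simplex R 1.
Proof.
apply/mem_set; split=> [i|]; last first.
  by rewrite !big_ord_recl big_ord0 !mxE /= addr0 subrK.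
by rewrite mxE; case: ifP => _; rewrite ?subr_ge0 ?clamp01_ge0 ?clamp01_le1.
Qed.

Definition edge_point (x : R) : std_simplex R 1 :=
  exist _ (edge_row x) (edge_row_simplex x).

Lemma edge_point_continuous : continuous edge_point.
Proof.
apply: to_simplex_continuous => -[[|[|//]] ?] x /=.
  rewrite /edge_row; under eq_fun do rewrite mxE /=.
  by apply: cvgB; [exact: cvg_cst|exact: clamp01_continuous].
rewrite /edge_row; under eq_fun do rewrite mxE /=.
exact: clamp01_continuous.
Qed.

(** Every singular edge is a path parametrized by a segment of the plane,
    hence accessible to [segD]. *)
Lemma singular1_segment (s : singular R X 1) :
  << s >> = polygon_simplex (fun p => s (edge_point p.1)) [tuple (0, 0); (1, 0)].
Proof.
rewrite singularE /polygon_simplex; congr chain_of; apply/funext => t /=.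
suff -> : edge_point (affine_simplex [tuple (0, 0); (1, 0)] t).1 = t by [].
apply/val_inj/rowP => i; rewrite /affine_simplex /=.
have /set_mem[t0] := valP t; rewrite big_ord_recl big_ord1 => t1.
rewrite !big_ord_recl big_ord0 /= !(mulr0, mulr1, add0r, addr0) mxE clamp01_id.
  have -> : 1 - \val t 0 (lift ord0 ord0) = \val t 0 0 by rewrite -t1 addrK.
  by case: ifPn => [/eqP->|] //; case: i => [[|[|//]] ?] // _; congr (\val t _ _); exact: val_inj.
by rewrite t0 -t1 ler_wpDl.
Qed.

End Paths.

(** * Cup products, cap products and the intersection form *)

Section Cochains.
Context (R : realType) (X : topologicalType).
Implicit Types (phi psi : cochain R X 1) (mu : chain R X 2).

HB.instance Definition _ n (phi : cochain R X n) :=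
  GRing.isZmodMorphism.Build (chain R X n) int (ceval phi)
    (lift_is_additive (phi : singular R X n -> int^o)).

Lemma ceval1 n (phi : cochain R X n) s : ceval phi << s >> = phi s.
Proof. by rewrite /ceval (@fglift1 int^o). Qed.

(** The simplicial identities for the three vertices of a triangle. *)
Lemma face_face (s : singular R X 2) :
  [/\ face ord0 (face (lift ord0 ord0) s) = face ord0 (face ord0 s),
      face ord0 (face ord_max s) = face ord_max (face ord0 s) &
      face ord_max (face ord_max s) = face ord_max (face (lift ord0 ord0) s)].
Proof.
have face2E (i : 'I_2) (j : 'I_3) (t : 'rV[R]_1) :
    face_row j (face_row i t) =
    \row_k if k == lift j (lift i ord0) then t 0 0 else 0.
  apply/rowP => k; rewrite !mxE; case: unliftP => [l ->|->]; last first.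
    by rewrite (negPf (neq_lift _ _)).
  rewrite mxE (inj_eq lift_inj); case: unliftP => [m ->|->].
    by rewrite (inj_eq lift_inj) !ord1.
  by rewrite (negPf (neq_lift _ _)).
have eq_ff (i i' : 'I_2) (j j' : 'I_3) :
    lift j (lift i ord0) = lift j' (lift i' ord0) ->
    face i (face j s) = face i' (face j' s).
  move=> ff; apply/continuousEP => t /=; rewrite /mkcts /=.
  suff -> : face_map j (face_map i t) = face_map j' (face_map i' t) by [].
  by apply/val_inj; rewrite /= !face2E ff.
by split; apply: eq_ff; exact: val_inj.
Qed.

Lemma boundary1 (s : singular R X 1) :
  boundary << s >> = << face ord0 s >> - << face ord_max s >>.
Proof.
rewrite /boundary fglift1 !big_ord_recl big_ord0 addr0 expr0 expr1 scale1r scaleN1r.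
by congr (_ - << face _ _ >>); exact: val_inj.
Qed.

Lemma boundary2 (s : singular R X 2) :
  boundary << s >> =
  << face ord0 s >> - << face (lift ord0 ord0) s >> + << face ord_max s >>.
Proof.
rewrite /boundary fglift1 !big_ord_recl big_ord0 addr0 /bump /= expr0 expr1 expr2.
rewrite mulN1r opprK !scale1r scaleN1r addrA.
by congr (_ - _ + << face _ _ >>); exact: val_inj.
Qed.

Lemma cocycleP phi (s : singular R X 2) : cocycle1 phi ->
  phi (face (lift ord0 ord0) s) = phi (face ord_max s) + phi (face ord0 s).
Proof.
move=> /(_ s); rewrite boundary2 raddfD raddfB /= !ceval1 => /eqP.
by rewrite addrAC subr_eq0 addrC => /eqP.
Qed.

Lemma ceval_boundary phi b : cocycle1 phi -> ceval phi (boundary b) = 0.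
Proof.
move=> phiZ; elim/freeg_subgroup_ind: b => [|b c b0 c0|s]; last exact: phiZ.
  by rewrite !raddf0.
by rewrite !raddfB /= b0 c0 subr0.
Qed.

(** The cap product of an edge and a 1-cocycle: its value on the edge, put at
    the endpoint of the edge. *)
Definition cap_end phi : chain R X 1 -> chain R X 0 :=
  fglift (fun e : singular R X 1 => phi e *: (<< face ord0 e >> : chain R X 0)).

HB.instance Definition _ phi :=
  GRing.isZmodMorphism.Build (chain R X 1) (chain R X 0) (cap_end phi)
    (lift_is_additive _).

Lemma cap_end1 phi e : cap_end phi << e >> = phi e *: << face ord0 e >>.
Proof. exact: fglift1. Qed.

Lemma capB phi c d : cap (c - d) phi = cap c phi - cap d phi.
Proof. exact: lift_is_additive. Qed.

Lemma cap0 phi : cap 0 phi = 0 :> chain R X 1.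
Proof. by rewrite -[X in cap X _](subrr 0) capB subrr. Qed.

Lemma cap1 phi (s : singular R X 2) :
  cap << s >> phi = phi (face ord_max s) *: << face ord0 s >>.
Proof. exact: fglift1. Qed.

Lemma boundaryZ n (k : int) (c : chain R X n.+1) : boundary (k *: c) = k *: boundary c.
Proof. by rewrite -[k]intz !scaler_int raddfMz. Qed.

Lemma cevalZ n (phi : cochain R X n) (k : int) c : ceval phi (k *: c) = k * ceval phi c.
Proof. by rewrite -[k]intz !scaler_int raddfMz /= -mulrzl. Qed.

(** The boundary formula of the cap product, up to a term in the coboundary of
    [phi], which is 0. It makes the cap product of a cycle and a cocycle a
    cycle. *)
Lemma boundary_cap phi mu : cocycle1 phi ->
  boundary (cap mu phi) = - cap_end phi (boundary mu).
Proof.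
move=> phiZ; elim/freeg_subgroup_ind: mu => [|b c b0 c0|s].
- by rewrite cap0 !raddf0.
- by rewrite capB !raddfB /= b0 c0.
rewrite cap1 boundaryZ boundary1 boundary2 (raddfD (cap_end phi)).
rewrite (raddfB (cap_end phi)) /= !cap_end1.
have [-> -> _] := face_face s.
rewrite (cocycleP s phiZ) scalerDl scalerBr opprD opprB.
by rewrite addrK.
Qed.

Lemma ceval_cup phi psi mu : ceval (cup phi psi) mu = ceval psi (cap mu phi).
Proof.
elim/freeg_subgroup_ind: mu => [|b c b0 c0|s].
- by rewrite cap0 !raddf0.
- by rewrite capB !raddfB /= b0 c0.
by rewrite cap1 cevalZ !ceval1.
Qed.

(** The pointwise product [phi * psi] of 1-cocycles is their cup-1 product:
    writing the value of each cocycle on the long edge of a triangle as the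
    sum of the values on the two other edges, its coboundary is [- (phi cup
    psi + psi cup phi)]. *)
Lemma cup_anticomm phi psi mu : cocycle1 phi -> cocycle1 psi ->
  boundary mu = 0 -> ceval (cup phi psi) mu = - ceval (cup psi phi) mu.
Proof.
move=> phiZ psiZ mu0; apply/eqP; rewrite -addr_eq0; apply/eqP.
pose cup1 : cochain R X 1 := fun e => phi e * psi e.
suff <- : - ceval cup1 (boundary mu) =
    ceval (cup phi psi) mu + ceval (cup psi phi) mu by rewrite mu0 raddf0 oppr0.
elim/freeg_subgroup_ind: mu {mu0} => [|b c b0 c0|s].
- by rewrite !raddf0 addr0.
- by rewrite !raddfB /= b0 c0 opprD addrACA.
rewrite boundary2 raddfD raddfB /= !ceval1 /cup1 /cup.
rewrite (cocycleP s phiZ) (cocycleP s psiZ).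
by ring.
Qed.

(** The choice of the representative is harmless for cocycles, by [eval_cls]. *)
Definition eval_class phi (w : chain_class R X) : int := ceval phi (repr w).

Lemma eval_cls phi c : cocycle1 phi -> eval_class phi (cls c) = ceval phi c.
Proof.
move=> phiZ; apply/eqP; rewrite -subr_eq0 -raddfB /=.
have /cls_eqP[b ->] : cls (repr (cls c)) = cls c by rewrite /cls reprK.
by rewrite ceval_boundary.
Qed.

(** For any other dual cocycles [phi'] of [a] and [psi'] of [b], the value
    [(phi' cup psi')(mu) = psi'(a) = (phi cup psi')(mu) = - phi(mu cap psi') =
    - phi(b)] is determined by [phi] alone, so that the set in the definition
    of the intersection number is a singleton. *)
Lemma intersectionE mu (a b : H1 R X) phi psi :
  boundary mu = 0 -> cocycle1 phi -> cocycle1 psi ->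
  cls (cap mu phi) = class_of_H1 a -> cls (cap mu psi) = class_of_H1 b ->
  intersection mu a b = eval_class psi (class_of_H1 a).
Proof.
move=> mu0 phiZ psiZ capa capb.
have capZ chi : cocycle1 chi -> cap mu chi \in @Z1 R X.
  by move=> chiZ; rewrite unfold_in boundary_cap // mu0 raddf0 oppr0.
have hcapE chi h : cocycle1 chi ->
    hclass (cap mu chi) = h <-> cls (cap mu chi) = class_of_H1 h.
  move=> chiZ; rewrite -(class_of_hclass (capZ _ chiZ)).
  by split=> [->//|/class_of_H1_inj].
rewrite /intersection; apply: xget_unique => [|n [phi' [psi' [phi'Z psi'Z]]]].
  exists phi, psi; split=> //; [exact/hcapE|exact/hcapE|].
  by rewrite ceval_cup -capa eval_cls.
move=> /hcapE-/(_ phi'Z) capa' /hcapE-/(_ psi'Z) capb' ->.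
rewrite ceval_cup -eval_cls // capa' -capa !eval_cls // -!ceval_cup.
rewrite cup_anticomm // ceval_cup -eval_cls // capb' -capb eval_cls //.
by rewrite -ceval_cup -cup_anticomm.
Qed.

End Cochains.

Section Triangles.
Context (R : realType) (X : topologicalType).

Lemma boundary_boundary (b : chain R X 2) : boundary (boundary b) = 0.
Proof.
elim/freeg_subgroup_ind: b => [|b c b0 c0|s]; first by rewrite !raddf0.
  by rewrite !raddfB /= b0 c0 subr0.
rewrite boundary2 raddfD raddfB /= !boundary1; have [-> -> ->] := face_face s.
set a := << _ >>; set b := << _ >>; set c := << _ >>.
by rewrite opprB [a - b + _]addrC subrKA subrKA subrr.
Qed.

(** Cycles can thus be recognized on homologous chains. *)
Lemma cls_boundary_eq (c d : chain R X 1) : cls c = cls d -> boundary c = boundary d.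
Proof.
move=> /cls_eqP[b cd]; have := congr1 (@boundary R X 0) cd.
by rewrite raddfB boundary_boundary => /eqP; rewrite subr_eq0 => /eqP.
Qed.

Lemma cls_scale (k : int) (c : chain R X 1) : cls (k *: c) = cls c *~ k.
Proof. by rewrite -[k in LHS]intz scaler_int raddfMz. Qed.

Lemma cap_triangle A (f : R * R -> X) p q r (phi : cochain R X 1) :
  {within [set p | in_rect A p], continuous f} ->
  in_rect A p -> in_rect A q -> in_rect A r ->
  cap (polygon_simplex f [tuple p; q; r]) phi =
  ceval phi (polygon_simplex f [tuple p; q]) *: polygon_simplex f [tuple q; r].
Proof.
move=> cf Ap Aq Ar.
have Av i : in_rect A (tnth [tuple p; q; r] i) by case: i => [[|[|[|//]]] ?].
have cs := polygon_simplex_continuous cf Av.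
have faceE i : << face i (mkcts cs : singular R X 2) >> =
    polygon_simplex f (omit_vertex [tuple p; q; r] i).
  by rewrite singularE /polygon_simplex -affine_face.
rewrite {1}/polygon_simplex (chain_ofE cs) cap1 -ceval1 !faceE.
by congr (ceval phi (polygon_simplex f _) *: polygon_simplex f _);
  apply: eq_from_tnth => -[[|[|//]] ?]; rewrite tnth_mktuple.
Qed.

Lemma point_simplex_eq (f : R * R -> X) p q : f p = f q ->
  polygon_simplex f [tuple p] = polygon_simplex f [tuple q].
Proof.
move=> fpq; rewrite /polygon_simplex; congr chain_of; apply/funext => t /=.
have aff z : affine_simplex [tuple z] t = z.
  have /set_mem[_] := valP t; rewrite big_ord1 => t1.
  by rewrite /affine_simplex !big_ord1 /= t1 !mul1r -surjective_pairing.
by rewrite !aff.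
Qed.

End Triangles.

(** * The cocycle of a circle-valued function *)

Section CircleValued.
Context (R : realType).

(** Continuity of the map to the circle [R/Z] that [u] represents: [u] varies
    little up to integers. *)
Definition circle_continuous (T : topologicalType) (u : T -> R) := forall x e, 0 < e ->
  \forall y \near x, exists2 d : R, d - (u y - u x) \is a Num.int & `|d| < e.

Lemma circle_continuous_comp (S T : topologicalType) (u : T -> R) (f : S -> T) :
  circle_continuous u -> continuous f -> circle_continuous (u \o f).
Proof. by move=> cu cf x e e0; exact: (cf x _ (cu (f x) e e0)). Qed.

(** The representative of [d] modulo 1 that is nearest to 0. *)
Definition centered (d : R) : R := d - (Num.floor (d + 2^-1))%:~R.

Lemma centered_int d : centered d - d \is a Num.int.
Proof. by rewrite /centered addrAC subrr add0r rpredN intr_int. Qed.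

Lemma centered_eq d e : d - e \is a Num.int -> `|e| < 2^-1 -> centered d = e.
Proof.
move=> /intrP[m mE]; rewrite ltr_norml => /andP[e1 e2].
have dE : d = m%:~R + e by rewrite -mE subrK.
rewrite /centered (@floor_def _ _ m) ?dE; first by rewrite addrC addKr.
by rewrite intrD; apply/andP; split; lra.
Qed.

(** Differences that stay away from 1/2 modulo 1 have a continuous
    representative. *)
Lemma continuous_centered (S T : topologicalType) (u : T -> R) (f g : S -> T) :
  circle_continuous u -> continuous f -> continuous g ->
  (forall x, exists2 d : R, d - (u (f x) - u (g x)) \is a Num.int & `|d| < 4^-1) ->
  continuous (fun x => centered (u (f x) - u (g x))).
Proof.
move=> cu cf cg fg x; apply/cvgrPdist_lt => e e0.
have [d dZ d4] := fg x.
(* With errors below 1/8 at both points, the difference stays below 1/4 + 1/8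
   + 1/8, the range in which [centered] is continuous. *)
have e'0 : 0 < Num.min (e / 2) 8^-1 by rewrite lt_min !divr_gt0 ?invr_gt0 //; lra.
have ufx := @circle_continuous_comp _ _ _ _ cu cf x _ e'0.
have ugx := @circle_continuous_comp _ _ _ _ cu cg x _ e'0.
apply: filterS2 ufx ugx => y [a aZ ae] [b bZ be] /=.
move: ae be; rewrite !lt_min !ltr_norml => /andP[/andP[? ?] /andP[? ?]].
move=> /andP[/andP[? ?] /andP[? ?]]; move: d4; rewrite ltr_norml => /andP[? ?].
have /= aZ' := aZ; have /= bZ' := bZ.
have -> : centered (u (f x) - u (g x)) = d.
  by apply: centered_eq; [rewrite -opprB rpredN|rewrite ltr_norml; lra].
have -> : centered (u (f y) - u (g y)) = d + a - b.
  apply: centered_eq; last by rewrite ltr_norml; lra.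
  have -> : u (f y) - u (g y) - (d + a - b) =
    - (d - (u (f x) - u (g x))) - (a - (u (f y) - u (f x))) +
    (b - (u (g y) - u (g x))) by ring.
  by rewrite rpredD // rpredB // rpredN.
by apply/andP; split; lra.
Qed.

Lemma compact_set_type (T : topologicalType) (K : set T) :
  compact K -> compact [set: K].
Proof.
move=> cK F FF _.
have [] := cK (set_val @ F) _ _.
  by apply: (@filterS _ F _ setT) filterT => x _ /=; exact: set_mem (valP x).
move=> p [Kp clp]; exists (exist _ p (mem_set Kp)); split => // A B FA.
case=> O [[V oV VO] Op OB].
have /= := clp (set_val @` A) V _ _; case.
- by apply: (@filterS _ F _ A) FA => x Ax /=; exists x.
- by apply: open_nbhs_nbhs; split=> //; rewrite -VO in Op.
move=> q [[x Ax xq] Vq]; exists x; split=> //; apply: OB.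
by rewrite -VO /= xq.
Qed.

Lemma std_simplex_compact n : compact [set: std_simplex R n].
Proof.
apply: compact_set_type.
pose I01 := [set x : R | 0 <= x <= 1].
have cI : compact I01.
  have -> : I01 = `[0, 1]%classic by apply/seteqP; split=> x; rewrite /= in_itv.
  exact: segment_compact.
have -> : std_simplex R n =
    [set v : 'rV[R]_n.+1 | forall i, I01 (v ord0 i)] `&`
    (fun v : 'rV[R]_n.+1 => \sum_i v 0 i) @^-1` [set 1].
  apply/seteqP; split=> v /= [v0 v1]; split=> // i; last by case/andP: (v0 i).
  rewrite /I01 /= v0 -v1 (bigD1 i) //= lerDl sumr_ge0 // => j _; exact: v0.
apply: compact_closedI; first exact: (@rV_compact _ _ (fun=> I01)).
apply: preimage_closed; last exact: closed_eq.
move=> w _; apply: (@sum_continuous R _ _ (fun i (v : 'rV[R]_n.+1) => v 0 i)).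
by move=> i v; exact: coord_continuous.
Qed.

Definition contract_row n (t : std_simplex R n) (l : R) : 'rV[R]_n.+1 :=
  \row_i ((1 - clamp01 l) * (i == 0)%:R + clamp01 l * \val t 0 i).

Lemma contract_row_simplex n (t : std_simplex R n) l :
  contract_row t l \in std_simplex R n.
Proof.
have /set_mem[t0 t1] := valP t; apply/mem_set; split=> [i|].
  rewrite mxE addr_ge0 // mulr_ge0 ?subr_ge0 ?clamp01_ge0 ?clamp01_le1 //.
under eq_bigr do rewrite mxE; rewrite big_split /= -!mulr_sumr t1 mulr1.
by rewrite (bigD1 0) //= big1 ?addr0 ?mulr1 ?subrK // => i /negPf->.
Qed.

(** The straight-line contraction of the simplex to its vertex 0. *)
Definition contract n (z : std_simplex R n * R) : std_simplex R n :=
  exist _ (contract_row z.1 z.2) (contract_row_simplex z.1 z.2).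

Lemma contract_continuous n : continuous (@contract n).
Proof.
apply: to_simplex_continuous => i z /=; rewrite /contract_row.
under eq_fun do rewrite mxE.
have c2 : (fun z : std_simplex R n * R => clamp01 z.2) @ z --> clamp01 z.2.
  apply: (continuous_comp (f := snd) (g := @clamp01 R)); first exact: cvg_snd.
  exact: clamp01_continuous.
have c1 : (fun z : std_simplex R n * R => \val z.1 0 i) @ z --> \val z.1 0 i.
  apply: (continuous_comp (f := fst) (g := fun t : std_simplex R n => \val t 0 i)).
    exact: cvg_fst.
  exact: (@barycentric_continuous R n i z.1).
apply: cvgD; last exact: cvgM.
by apply: cvgM; [apply: cvgB => //; exact: cvg_cst|exact: cvg_cst].
Qed.

Lemma contract1 n (t : std_simplex R n) : contract (t, 1) = t.
Proof.
apply/val_inj/rowP => i; rewrite mxE clamp01_id ?lexx ?ler01 //.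
by rewrite subrr mul0r add0r mul1r.
Qed.

Lemma contract0 n (t t' : std_simplex R n) : contract (t, 0) = contract (t', 0).
Proof.
apply/val_inj/rowP => i; rewrite !mxE clamp01_id ?lexx ?ler01 //.
by rewrite !mul0r.
Qed.

(** A lift is built along the rays from the vertex 0. By compactness, all rays
    can be cut into the same number [N] of pieces on which [v] varies by less
    than 1/4 modulo 1; the sum of the centered variations over the pieces is
    continuous in the endpoint of the ray. *)
Lemma simplex_lift n (v : std_simplex R n -> R) : circle_continuous v ->
  exists2 L : std_simplex R n -> R, continuous L &
    forall t, L t - v t \is a Num.int.
Proof.
move=> cv.
have cI : compact ([set: std_simplex R n] `*` `[(0 : R), 1]%classic).
  by apply: compact_setX; [exact: std_simplex_compact|exact: segment_compact].
pose step N (z : std_simplex R n * R) := exists2 d : R,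
  d - (v (contract (z.1, z.2 + N.+1%:R^-1)) - v (contract z)) \is a Num.int &
  `|d| < 4^-1.
have [N _ NP] : \forall N \near \oo, [set: std_simplex R n] `*` `[(0 : R), 1] `<=` step N.
  move/compact_near_coveringP : cI => /(_ _ \oo step _); apply=> z _.
  have e8 : 0 < 8^-1 :> R by rewrite invr_gt0.
  have [[P Q] /= [Pz /nbhs_ballP[r /= r0 rQ]] PQ] :=
    @circle_continuous_comp _ _ _ _ cv (@contract_continuous n) z _ e8.
  have r2 : 0 < r / 2 by rewrite divr_gt0.
  exists (P `*` ball z.2 (r / 2), [set N | N.+1%:R^-1 < r / 2]) => /=.
    split; last exact: (near_infty_natSinv_lt (PosNum r2)).
    by exists (P, ball z.2 (r / 2)) => //=; split=> //=; exact: (@nbhsx_ballx _ _ z.2 _ r2).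
  move=> [[t l] N] /= [[Pt lz] Nr].
  have N0 : 0 < N.+1%:R^-1 :> R by rewrite invr_gt0.
  move: N0 Nr; rewrite /step /=; set h := N.+1%:R^-1 => N0 Nr.
  move: lz; rewrite /ball /= ltr_norml => /andP[lz1 lz2].
  have [a aZ] : exists2 d : R,
      d - (v (contract (t, l)) - v (contract z)) \is a Num.int & `|d| < 8^-1.
    by apply: PQ; split=> //; apply: rQ; rewrite /ball /= ltr_norml; lra.
  rewrite ltr_norml => /andP[a1 a2].
  have [b bZ] : exists2 d : R,
      d - (v (contract (t, l + h)) - v (contract z)) \is a Num.int &
      `|d| < 8^-1.
    by apply: PQ; split=> //; apply: rQ; rewrite /ball /= ltr_norml; lra.
  rewrite ltr_norml => /andP[b1 b2].
  exists (b - a); last by rewrite ltr_norml; lra.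
  rewrite /= (_ : b - a - _ =
    b - (v (contract (t, l + h)) - v (contract z)) -
    (a - (v (contract (t, l)) - v (contract z)))); last by ring.
  exact: rpredB.
pose pt (t : std_simplex R n) (i : nat) := contract (t, i%:R / N.+1%:R).
have pt_cont i : continuous (pt ^~ i).
  have cf : continuous (fun t : std_simplex R n => (t, i%:R / N.+1%:R : R)).
    by move=> t; exact: (cvg_pair (@cvg_id _ (nbhs t)) (@cvg_cst _ _ _ (nbhs t) _)).
  move=> t; exact: (continuous_comp (cf t) (@contract_continuous n (t, _))).
pose L (t : std_simplex R n) := \sum_(i < N.+1) centered (v (pt t i.+1) - v (pt t i)).
have NP' (i : 'I_N.+1) t : exists2 d : R,
    d - (v (pt t i.+1) - v (pt t i)) \is a Num.int & `|d| < 4^-1.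
  have := NP N (leqnn N) (t, i%:R / N.+1%:R); rewrite /step /pt /=.
  rewrite -[i.+1%:R]natr1 mulrDl mul1r; apply; split=> //=; rewrite in_itv /= divr_ge0 //=.
  by rewrite ler_pdivrMr // mul1r ler_nat ltnW.
have [t0|T0] := pselect (exists t0 : std_simplex R n, True); last first.
  by exists (cst 0) => t; case: T0; exists t.
case: t0 => t0 _.
exists (fun t => v (pt t0 0%N) + L t).
  have cL : continuous L.
    apply: (@sum_continuous R _ _ (fun (i : 'I_N.+1) (t : std_simplex R n) =>
      centered (v (pt t (nat_of_ord i).+1) - v (pt t i)))) => i.
    exact: continuous_centered.
  by move=> t; exact: (cvgD (@cvg_cst _ _ _ (nbhs t) _) (cL t)).
move=> t; rewrite (_ : pt t0 0%N = pt t 0%N); last first.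
  by rewrite /pt mul0r; exact: contract0.
have -> : v t = v (pt t N.+1) by rewrite /pt divff ?contract1 // pnatr_eq0.
have -> : v (pt t N.+1) = v (pt t 0%N) + \sum_(i < N.+1) (v (pt t i.+1) - v (pt t i)).
  rewrite -(big_mkord xpredT (fun i => v (pt t i.+1) - v (pt t i))).
  by rewrite telescope_sumr // addrC subrK.
rewrite opprD addrACA subrr add0r -sumrB.
by apply: rpred_sum => i _; exact: centered_int.
Qed.

(** Otherwise a half-integer would be an intermediate value. *)
Lemma int_valued_constant (f : R -> R) : continuous f ->
  (forall x, f x \is a Num.int) -> forall x y, f x = f y.
Proof.
move=> cf fZ.
have mono x y : x <= y -> f x = f y.
  move=> xy.
  have [m fx] := intrP (fZ x); have [k fy] := intrP (fZ y).
  have [mk|mk] := eqVneq m k; first by rewrite fx fy mk.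
  have [||c _ fc] := @IVT R f x y ((Num.min m k)%:~R + 2^-1) xy.
  - exact: continuous_subspaceT.
  - rewrite fx fy; have [mk'|mk'|mk'] := ltgtP m k; last by rewrite mk' eqxx in mk.
      have mk1 : (m + 1)%:~R <= k%:~R :> R by rewrite ler_int; lia.
      move: mk1; rewrite intrD => mk1.
      have mk2 : m%:~R <= k%:~R :> R by rewrite ler_int ltW.
      rewrite (min_l mk2) (max_r mk2).
      by apply/andP; split; lra.
    have mk1 : (k + 1)%:~R <= m%:~R :> R by rewrite ler_int; lia.
    move: mk1; rewrite intrD => mk1.
    have mk2 : k%:~R <= m%:~R :> R by rewrite ler_int ltW.
    rewrite (min_r mk2) (max_l mk2).
    by apply/andP; split; lra.
  (* A half-integer that is an integer. *)
  have [q fcq] := intrP (fZ c).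
  have : (2 * (q - Num.min m k))%:~R = 1%:~R :> R.
    by rewrite intrM intrB -fcq fc; field.
  by move/intr_inj; lia.
move=> x y; have [xy|/ltW yx] := leP x y; first exact: mono.
by symmetry; exact: mono.
Qed.

Lemma face_edge_point (i i' : 'I_3) (b b' : bool) :
  lift i (if b then ord_max else ord0) = lift i' (if b' then ord_max else ord0) ->
  face_map i (edge_point b%:R) = face_map i' (edge_point b'%:R) :> std_simplex R 2.
Proof.
have faceE (j : 'I_3) (c : bool) : face_row j (edge_row (c%:R : R)) =
    \row_k (k == lift j (if c then ord_max else ord0))%:R.
  apply/rowP => k; rewrite !mxE; case: unliftP => [l ->|->]; last first.
    by rewrite (negPf (neq_lift _ _)).
  rewrite mxE (inj_eq lift_inj) clamp01_id; last first.
    by case: (c); rewrite /= ?lexx ?ler01.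
  by case: l => [[|[|//]] ?]; case: c; rewrite ?subr0 ?subrr.
by move=> e; apply/val_inj; rewrite /= !faceE e.
Qed.

Context (X : topologicalType).

(** The variation of a lift along a path differs from the variation of [u]
    between the endpoints by an integer, which is the value of the cocycle. It
    is independent of the lift because two lifts differ by a constant integer.
    A lift on a triangle restricts to lifts on its sides, so that the
    variations along the boundary add up to 0. *)
Lemma circle_cocycle (u : X -> R) : circle_continuous u ->
  exists phi : cochain R X 1, cocycle1 phi /\
  forall (s : singular R X 1) (L : std_simplex R 1 -> R),
    continuous L -> (forall t, L t - u (s t) \is a Num.int) ->
    (phi s)%:~R = L (edge_point 1) - L (edge_point 0) -
                  (u (s (edge_point 1)) - u (s (edge_point 0))) :> R.
Proof.
move=> cu.
have lift1 (s : singular R X 1) := simplex_lift (circle_continuous_comp cu (@cts_fun _ _ s)).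
pose lft s := sval (cid2 (lift1 s)).
have lftc s : continuous (lft s) by rewrite /lft; case: cid2.
have lftZ s t : lft s t - u (s t) \is a Num.int by rewrite /lft; case: cid2.
pose phi : cochain R X 1 := fun s => Num.floor
  (lft s (edge_point 1) - lft s (edge_point 0) -
   (u (s (edge_point 1)) - u (s (edge_point 0)))).
have phiP (s : singular R X 1) (L : std_simplex R 1 -> R) :
    continuous L -> (forall t, L t - u (s t) \is a Num.int) ->
    (phi s)%:~R = L (edge_point 1) - L (edge_point 0) -
                  (u (s (edge_point 1)) - u (s (edge_point 0))) :> R.
  move=> cL LZ; rewrite /phi floorK; last first.
    rewrite (_ : _ - _ = (lft s (edge_point 1) - u (s (edge_point 1))) -
      (lft s (edge_point 0) - u (s (edge_point 0)))); last by ring.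
    by apply: rpredB; exact: lftZ.
  congr (_ - _).
  have cD : continuous ((lft s \- L) \o @edge_point R).
    have cB : continuous (lft s \- L).
      by move=> t; exact: (cvgB (@lftc s t) (cL t)).
    move=> x; exact: (continuous_comp (@edge_point_continuous R x) (cB _)).
  have DZ x : ((lft s \- L) \o @edge_point R) x \is a Num.int.
    rewrite /= (_ : _ - _ = (lft s (edge_point x) - u (s (edge_point x))) -
      (L (edge_point x) - u (s (edge_point x)))); last by ring.
    by apply: rpredB; [exact: lftZ|exact: LZ].
  have := int_valued_constant cD DZ 1 0; rewrite /= => d10; lra.
exists phi; split=> // s; rewrite boundary2 raddfD raddfB /= !ceval1.
have [L cL LZ] := simplex_lift (circle_continuous_comp cu (@cts_fun _ _ s)).
have faceE (i : 'I_3) : (phi (face i s))%:~R =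
    L (face_map i (edge_point 1)) - L (face_map i (edge_point 0)) -
    (u (s (face_map i (edge_point 1))) - u (s (face_map i (edge_point 0)))) :> R.
  rewrite (phiP _ (L \o @face_map R 1 i)) // => [t|t]; last exact: LZ.
  exact: (continuous_comp (@face_map_continuous R 1 i t) (cL _)).
apply: (@intr_inj R); rewrite raddfD raddfB /= !faceE.
have -> : face_map ord0 (edge_point 1) = face_map (lift ord0 ord0) (edge_point 1) :> std_simplex R 2.
  by apply: (@face_edge_point _ _ true true); exact: val_inj.
have -> : face_map ord0 (edge_point 0) = face_map ord_max (edge_point 1) :> std_simplex R 2.
  by apply: (@face_edge_point _ _ false true); exact: val_inj.
have -> : face_map (lift ord0 ord0) (edge_point 0) = face_map ord_max (edge_point 0) :> std_simplex R 2.
  by apply: (@face_edge_point _ _ false false); exact: val_inj.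
by rewrite mulr0z; ring.
Qed.

End CircleValued.

(** * The grid of a staircase *)

Section Grid.
Context (R : realType) (x y : nat -> R).

(** The chain goes up from the even cells and right from the odd ones. *)
Definition gcell (k : nat) : rect R :=
  Rect (x k./2) (x k./2.+1) (y (uphalf k)) (y (uphalf k).+1).

End Grid.

Section StaircaseGrid.
Context (R : realType) (g : nat) (P : nat -> rect R).
Context (g2 : (2 <= g)%N) (stP : staircase g P).

(** The two cases of the definition of a staircase, in one parity rule. *)
Lemma staircase_step i : (i.+1 < g)%N ->
  if odd i == odd g then left_of (P i) (P i.+1) else below (P i) (P i.+1).
Proof.
case: stP => _ _; case: ifP => godd [H1 H2] ig.
- case: ifP => iodd.
    have := H2 i.+1./2; rewrite (_ : i.+1./2.*2 = i.+1) //=; last by lia.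
    by apply; lia.
  have := H1 i./2; rewrite (_ : i./2.*2 = i) //=; last by lia.
  by apply; lia.
- case: ifP => iodd.
    have := H1 i./2; rewrite (_ : i./2.*2 = i) //=; last by lia.
    by apply; lia.
  have := H2 i.+1./2; rewrite (_ : i.+1./2.*2 = i.+1) //=; last by lia.
  by apply; lia.
Qed.

(** The reflection exchanges horizontal and vertical steps and reverses the
    chain. *)
Lemma reflect_left_of A B : left_of A B -> below (reflect_rect P B) (reflect_rect P A).
Proof.
by move=> /and3P[/eqP h1 /eqP h2 /eqP h3]; rewrite /below /= h1 h2 h3 !eqxx.
Qed.

Lemma reflect_below A B : below A B -> left_of (reflect_rect P B) (reflect_rect P A).
Proof.
by move=> /and3P[/eqP h1 /eqP h2 /eqP h3]; rewrite /left_of /= h1 h2 h3 !eqxx.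
Qed.

(** For [k = g.-1] the central square is its own reflection; so the first half
    of the chain, centre included, has a uniform description. *)
Lemma cell_reflect k : (k < g)%N -> cell g P k = reflect_rect P (P (g.-1 - k)%N).
Proof.
move=> kg; rewrite /cell; case: ltnP => // gk.
have -> : k = g.-1 by lia.
rewrite subnn /reflect_rect; case: stP => _ sq _; move: sq; rewrite /square.
by case: (P 0%N) => a b c d /= sq; congr Rect; lra.
Qed.

Lemma cell_step k : (k.+1 < ncells g)%N ->
  if odd k then left_of (cell g P k) (cell g P k.+1)
  else below (cell g P k) (cell g P k.+1).
Proof.
rewrite /ncells => kn; have [kg|gk] := ltnP k g.-1.
  rewrite !cell_reflect; try by lia.
  have [i iE] : exists i, i = (g.-1 - k.+1)%N by eexists.
  have := @staircase_step i; rewrite -iE (_ : (g.-1 - k = i.+1)%N); last by lia.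
  have -> : (odd i == odd g) = ~~ odd k by lia.
  by case: odd => /= H; [apply: reflect_below|apply: reflect_left_of];
    apply: H; lia.
rewrite /cell !ltnNge gk leqW //= subSn //.
have := @staircase_step (k - g.-1); have -> : (odd (k - g.-1) == odd g) = odd k by lia.
by apply; lia.
Qed.

Lemma cell_nondegenerate k : (k < ncells g)%N -> Defs.nondegenerate (cell g P k).
Proof.
rewrite /ncells => kn; case: stP => nd _ _; rewrite /cell; case: ltnP => kg.
  have [|h1 h2] := nd (g.-1 - k)%N; first by lia.
  by split; rewrite /= ltrD2l ltrN2.
by apply: nd; lia.
Qed.

(** Beyond the index [g] the sequence is continued by unit steps, so that it
    increases everywhere. *)
Definition grid_x j := if (j < g)%N then xl (cell g P j.*2)
  else xr (cell g P g.-1.*2) + (j - g)%:R.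
Definition grid_y i := if (i < g)%N then yb (cell g P i.*2.-1)
  else yt (cell g P g.-1.*2) + (i - g)%:R.

Lemma cell_grid k : (k < ncells g)%N -> cell g P k = gcell grid_x grid_y k.
Proof.
have below_step i : (i.+1 < g)%N -> below (cell g P i.*2) (cell g P i.*2.+1).
  by move=> ig; have := @cell_step i.*2; rewrite odd_double /ncells; apply; lia.
have left_step i : (i.+1 < g)%N -> left_of (cell g P i.*2.+1) (cell g P i.*2.+2).
  by move=> ig; have := @cell_step i.*2.+1; rewrite /= odd_double /ncells; apply; lia.
have even i : (i < g)%N -> cell g P i.*2 = gcell grid_x grid_y i.*2.
  move=> ig; rewrite /gcell doubleK (_ : uphalf i.*2 = i); last by lia.
  rewrite /grid_x /grid_y ig; have [ig1|gi1] := ltnP i.+1 g; last first.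
    have -> : i.+1 = g by lia.
    rewrite subnn !addr0 (_ : g.-1 = i); last by lia.
    have -> : yb (cell g P i.*2.-1) = yb (cell g P i.*2).
      case: i ig gi1 => // i ig _; have /and3P[_ /eqP + _] := left_step i ig.
      by rewrite doubleS.
    by case: cell.
  have /and3P[/eqP h1 /eqP h2 /eqP h3] := below_step i ig1.
  have /and3P[/eqP h4 /eqP h5 /eqP h6] := left_step i ig1.
  rewrite doubleS /= -h1 -h4 -h3.
  have -> : yb (cell g P i.*2.-1) = yb (cell g P i.*2).
    case: i ig {ig1 h1 h2 h3 h4 h5 h6} => // i ig; have /and3P[_ /eqP + _] := left_step i ig.
    by rewrite doubleS.
  by case: cell.
move=> kn; have [kE|kE] : k = k./2.*2 \/ k = k./2.*2.+1 by lia.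
  by rewrite kE even // -[g]prednK; move: kn; rewrite /ncells; lia.
have kg : (k./2.+1 < g)%N by move: kn; rewrite /ncells; lia.
have /and3P[/eqP h1 /eqP h2 /eqP h3] := below_step _ kg.
have /and3P[/eqP h4 /eqP h5 /eqP h6] := left_step _ kg.
rewrite kE; move: h1 h2 h3 h4 h5 h6; rewrite -doubleS !even //; last by lia.
rewrite /gcell !doubleK (_ : (k./2.*2.+1)./2 = k./2); last by lia.
rewrite (_ : uphalf k./2.*2 = k./2); last by lia.
rewrite (_ : uphalf k./2.+1.*2 = k./2.+1); last by lia.
rewrite (_ : uphalf k./2.*2.+1 = k./2.+1) /=; last by lia.
by move=> h1 h2 h3 h4 h5 h6; move: h1 h2 h3 h4 h5 h6; case: cell => a b c d /= <- <- <- _ _ <-.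
Qed.

Lemma grid_x_lt j : grid_x j < grid_x j.+1.
Proof.
have [jg|gj] := ltnP j g.
  have jn : (j.*2 < ncells g)%N by rewrite /ncells; lia.
  by have [] := cell_nondegenerate jn; rewrite cell_grid //= doubleK.
rewrite /grid_x !ltnNge gj leqW //= ltrD2l ltr_nat; lia.
Qed.

Lemma grid_y_lt j : grid_y j < grid_y j.+1.
Proof.
have [jg|gj] := ltnP j g.
  have jn : (j.*2 < ncells g)%N by rewrite /ncells; lia.
  have [_] := cell_nondegenerate jn; rewrite cell_grid //=.
  by rewrite (_ : uphalf j.*2 = j); last by lia.
rewrite /grid_y !ltnNge gj leqW //= ltrD2l ltr_nat; lia.
Qed.

End StaircaseGrid.

(** * The gluing in terms of the grid *)

Section GridGluing.
Context (R : realType) (g : nat) (x y : nat -> R) (X : topologicalType).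
Context (rho : R * R -> X).

Definition region : set (R * R) :=
  [set p | exists2 k, (k < ncells g)%N & in_rect (gcell x y k) p].

(** Compatibility with the two gluings. The row [i] starts at [x i.-1], which
    is [x 0] for [i = 0], and the column [j] ends at [y j.+2] except for the
    last one, which has a single cell. *)
Definition glue_invariant T (f : R * R -> T) :=
  (forall i t, (i < g)%N -> y i <= t <= y i.+1 -> f (x i.-1, t) = f (x i.+1, t)) /\
  (forall j s, (j < g)%N -> x j <= s <= x j.+1 ->
     f (s, y j) = f (s, y (minn j.+2 g))).

(** The third clause replaces the equivalence relation generated by the
    gluings by the universal property for which it is used. *)
Definition grid_quotient :=
  [/\ rho @` region = setT, glue_invariant rho,
      forall T (f : R * R -> T), glue_invariant f ->
        forall p q, region p -> region q -> rho p = rho q -> f p = f q &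
      forall U : set X, open U <-> open (rho @^-1` U : set (subspace region))].

End GridGluing.

Section PolygonGrid.
Context (R : realType) (g : nat) (P : nat -> rect R).
Context (g2 : (2 <= g)%N) (stP : staircase g P).
Let x := grid_x g P.
Let y := grid_y g P.

Lemma increasing_lt (u : nat -> R) : (forall j, u j < u j.+1) ->
  {mono u : i j / (i <= j)%N >-> i <= j}.
Proof.
by move=> ulti i j; rewrite -leEnat (Order.NatMonotonyTheory.incnP ulti).
Qed.

Let xle : {mono x : i j / (i <= j)%N >-> i <= j}.
Proof. exact/increasing_lt/grid_x_lt. Qed.
Let yle : {mono y : i j / (i <= j)%N >-> i <= j}.
Proof. exact/increasing_lt/grid_y_lt. Qed.

Lemma below_cells k : (k.+1 < ncells g)%N ->
  below (cell g P k) (cell g P k.+1) = ~~ odd k.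
Proof.
move=> kn; have := cell_step g2 stP kn; case: odd => //= /and3P[_ /eqP bb _].
apply/negbTE/negP => /and3P[/eqP tb _ _].
by have [_] := cell_nondegenerate g2 stP (ltnW kn); rewrite bb tb ltxx.
Qed.

Lemma left_of_cells k : (k.+1 < ncells g)%N ->
  left_of (cell g P k) (cell g P k.+1) = odd k.
Proof.
move=> kn; have := cell_step g2 stP kn; case: odd => //= /and3P[_ /eqP ll _].
apply/negbTE/negP => /and3P[/eqP rl _ _].
by have [+ _] := cell_nondegenerate g2 stP (ltnW kn); rewrite ll rl ltxx.
Qed.

Lemma row_ofE k : (k < ncells g)%N -> row_of g P k = uphalf k.
Proof.
elim: k => [|k IHk] kn; first by rewrite /row_of big_ord0.
rewrite /row_of big_ord_recr /= -/(row_of g P k) IHk ?(ltnW kn) // below_cells //.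
by lia.
Qed.

Lemma col_ofE k : (k < ncells g)%N -> col_of g P k = k./2.
Proof.
elim: k => [|k IHk] kn; first by rewrite /col_of big_ord0.
rewrite /col_of big_ord_recr /= -/(col_of g P k) IHk ?(ltnW kn) // left_of_cells //.
by lia.
Qed.

Lemma polygon_region : polygon g P = region g x y.
Proof.
by apply/seteqP; split=> p [k kn pk]; exists k => //; move: pk; rewrite cell_grid.
Qed.

Lemma glue_horizontalP p q : glue_horizontal g P p q <->
  exists i t, [/\ (i < g)%N, y i <= t <= y i.+1, p = (x i.-1, t) & q = (x i.+1, t)].
Proof.
split=> [[k [l [kn ln]]]|[i [t [ig yt -> ->]]]].
  rewrite !row_ofE // => kl ext [+ + p1 q1 p2].
  rewrite /in_rect !cell_grid // -/x -/y /= => /andP[_ py] _.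
  move: p1 q1; rewrite !cell_grid //= -/x -/y => p1 q1.
  have kg : (uphalf k < g)%N by move: kn; rewrite /ncells; lia.
  have m1n : ((uphalf k).*2.-1 < ncells g)%N by rewrite /ncells; lia.
  have m2n : ((uphalf k).*2 < ncells g)%N by rewrite /ncells; lia.
  have [|+ _] := ext _ m1n; first by rewrite row_ofE //; lia.
  have [|_ +] := ext _ m2n; first by rewrite row_ofE //; lia.
  rewrite !cell_grid //= -/x ?xle.
  move=> e1 e2; exists (uphalf k), p.2; split=> //.
    rewrite [p in LHS]surjective_pairing p1; congr (x _, _); lia.
  rewrite [q in LHS]surjective_pairing q1 p2; congr (x _, _); lia.
exists i.*2.-1, i.*2; have n1 : (i.*2.-1 < ncells g)%N by rewrite /ncells; lia.
have n2 : (i.*2 < ncells g)%N by rewrite /ncells; lia.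
split=> //; first by rewrite !row_ofE //; lia.
- move=> m mn; rewrite !row_ofE // => mi.
  by rewrite !cell_grid //= !xle; lia.
rewrite /in_rect !cell_grid //= -/x -/y.
have e1 : i.*2.-1./2 = i.-1 by lia.
have e2 : uphalf i.*2.-1 = i by lia.
have e3 : uphalf i.*2 = i by lia.
by rewrite doubleK e1 e2 e3 yt !lexx !xle !leqnSn.
Qed.

Lemma glue_verticalP p q : glue_vertical g P p q <->
  exists j s, [/\ (j < g)%N, x j <= s <= x j.+1, p = (s, y j) & q = (s, y (minn j.+2 g))].
Proof.
split=> [[k [l [kn ln]]]|[j [s [jg xs -> ->]]]].
  rewrite !col_ofE // => kl ext [+ + p1 q1 p2].
  rewrite /in_rect !cell_grid // -/x -/y /= => /andP[px _] _.
  move: p1 q1; rewrite !cell_grid //= -/x -/y => p1 q1.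
  have kg : (k./2 < g)%N by move: kn; rewrite /ncells; lia.
  have m1n : (k./2.*2 < ncells g)%N by rewrite /ncells; lia.
  have m2n : (minn k./2.*2.+1 g.-1.*2 < ncells g)%N by rewrite /ncells; lia.
  have [|+ _] := ext _ m1n; first by rewrite col_ofE //; lia.
  have [|_ +] := ext _ m2n; first by rewrite col_ofE //; lia.
  rewrite !cell_grid //= -/y ?yle.
  move=> e1 e2; exists k./2, p.1; split=> //.
    rewrite [p in LHS]surjective_pairing p1; congr (_, y _); lia.
  rewrite [q in LHS]surjective_pairing q1 p2; congr (_, y _).
  by move: kn ln; rewrite /ncells; lia.
exists j.*2, (minn j.*2.+1 g.-1.*2).
have n1 : (j.*2 < ncells g)%N by rewrite /ncells; lia.
have n2 : (minn j.*2.+1 g.-1.*2 < ncells g)%N by rewrite /ncells; lia.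
split=> //; first by rewrite !col_ofE //; lia.
- move=> m mn; rewrite !col_ofE // => mi.
  by rewrite !cell_grid //= !yle; move: mn; rewrite /ncells; lia.
rewrite /in_rect !cell_grid //= -/x -/y.
have e1 : (minn j.*2.+1 g.-1.*2)./2 = j by lia.
have e2 : (uphalf (minn j.*2.+1 g.-1.*2)).+1 = minn j.+2 g by lia.
have e3 : uphalf j.*2 = j by lia.
by rewrite doubleK e1 e2 e3 xs !lexx !yle !leqnSn /=; split=> //; lia.
Qed.

Lemma gluing_grid_quotient (X : topologicalType) (rho : R * R -> X) :
  gluing_map g P rho -> grid_quotient g x y rho.
Proof.
rewrite /gluing_map polygon_region => -[surj ident quo].
have inH i t : (i < g)%N -> y i <= t <= y i.+1 ->
    region g x y (x i.-1, t) /\ region g x y (x i.+1, t).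
  move=> ig yt; have e1 : i.*2.-1./2 = i.-1 by lia.
  have e2 : uphalf i.*2.-1 = i by lia.
  have e3 : uphalf i.*2 = i by lia.
  split; [exists i.*2.-1|exists i.*2]; rewrite /in_rect /gcell /ncells /=;
    rewrite ?doubleK ?e1 ?e2 ?e3 ?yt ?lexx ?xle ?leqnSn //; lia.
have inV j s : (j < g)%N -> x j <= s <= x j.+1 ->
    region g x y (s, y j) /\ region g x y (s, y (minn j.+2 g)).
  move=> jg xs.
  have e1 : (minn j.*2.+1 g.-1.*2)./2 = j by lia.
  have e2 : (uphalf (minn j.*2.+1 g.-1.*2)).+1 = minn j.+2 g by lia.
  have e3 : uphalf j.*2 = j by lia.
  split; [exists j.*2|exists (minn j.*2.+1 g.-1.*2)];
    rewrite /in_rect /gcell /ncells /=;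
    rewrite ?doubleK ?e1 ?e2 ?e3 ?xs ?lexx ?yle ?leqnSn ?andbT /=; lia.
split=> //.
- split=> [i t ig yt|j s jg xs].
    have [h1 h2] := inH i t ig yt; apply/ident => //; apply: rst_step; left.
    by apply/glue_horizontalP; exists i, t.
  have [h1 h2] := inV j s jg xs; apply/ident => //; apply: rst_step; right.
  by apply/glue_verticalP; exists j, s.
move=> T f [fH fV] p q rp rq /(ident _ _ rp rq); elim=> {p q rp rq} [p q [] | | | ].
- by move=> /glue_horizontalP[i [t [ig yt -> ->]]]; exact: fH.
- by move=> /glue_verticalP[j [s [jg xs -> ->]]]; exact: fV.
- by [].
- by move=> p q _ ->.
- by move=> p q r _ -> _ ->.
Qed.

End PolygonGrid.

(** * The topology of the glued surface *)

Variant cell_parity_spec g k : Prop :=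
| EvenCell j of (j < g)%N /\ k./2 = j /\ uphalf k = j
| OddCell j of (j.+1 < g)%N /\ k./2 = j /\ uphalf k = j.+1.

Lemma cell_parity g k : (1 < g)%N -> (k < ncells g)%N -> cell_parity_spec g k.
Proof.
rewrite /ncells => g2 kn; have [kodd|keven] := boolP (odd k).
  by apply: (@OddCell _ _ k./2); lia.
by apply: (@EvenCell _ _ k./2); lia.
Qed.

Section QuotientTopology.
Context (R : realType) (g : nat) (x y : nat -> R) (X : topologicalType).
Context (rho : R * R -> X).
Context (g2 : (2 <= g)%N).
Context (xle : {mono x : i j / (i <= j)%N >-> i <= j}).
Context (yle : {mono y : i j / (i <= j)%N >-> i <= j}).
Context (quo : grid_quotient g x y rho).

(** Alternating vertical and horizontal gluings lead from each corner to the
    one with both indices increased by 2; the first row and the last column,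
    which consist of one cell, link the families obtained in this way. *)
Lemma grid_corner k (p : R * R) : (k < ncells g)%N ->
  p.1 \in [:: x k./2; x k./2.+1] -> p.2 \in [:: y (uphalf k); y (uphalf k).+1] ->
  rho p = rho (x 0%N, y 0%N).
Proof.
have [_ [glH glV] _ _] := quo.
have yl b c t : (b <= c)%N -> (c <= t)%N -> y b <= y c <= y t by move=> *; rewrite !yle; lia.
have xl b c t : (b <= c)%N -> (c <= t)%N -> x b <= x c <= x t by move=> *; rewrite !xle; lia.
have B b : (b.+2 <= g)%N -> rho (x b, y b) = rho (x b, y b.+2).
  by move=> bg; rewrite (glV b) ?xl //; [congr (rho (_, y _)); lia|lia].
have B' b : (b.+2 <= g)%N -> rho (x b, y b.+2) = rho (x b.+2, y b.+2).
  by move=> bg; apply: (glH b.+1) => //; rewrite yl.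
have C b : (b.+1 < g)%N -> rho (x b, y b.+1) = rho (x b.+2, y b.+1).
  by move=> bg; apply: (glH b.+1) => //; rewrite yl.
have C' b : (b.+2 <= g)%N -> rho (x b.+1, y b) = rho (x b.+1, y b.+2).
  by move=> bg; rewrite (glV b) ?xl //; [congr (rho (_, y _)); lia|lia].
have A b : (b <= g)%N -> rho (x b, y b) = rho (x (odd b : nat), y (odd b : nat)).
  elim/ltn_ind: b => -[|[|b]] IHb bg //=.
  by rewrite -B' // -B // IHb ?negbK //; lia.
have D0 : rho (x 1%N, y 0%N) = rho (x 0%N, y 0%N).
  by rewrite -(glH 0%N) ?yl //; lia.
have C1 : rho (x 0%N, y 1%N) = rho (x 1%N, y 1%N).
  by rewrite (glH 0%N) ?yl //; lia.
have D b : (b < g)%N -> rho (x b.+1, y b) = rho (x (odd b : nat), y (odd b : nat)) /\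
    rho (x b, y b.+1) = rho (x (~~ odd b : nat), y (~~ odd b : nat)).
  elim/ltn_ind: b => -[|b] IHb bg //=.
  have [_ Cb] := IHb b (leqnn _) (ltnW bg).
  by rewrite -C' // -C // Cb negbK; have [-> _] := IHb b (leqnn _) (ltnW bg).
(* The last column links the two parities. *)
have A01 : rho (x 1%N, y 1%N) = rho (x 0%N, y 0%N).
  have gg : (g.-1 < g)%N by lia.
  have [_ Dg] := D _ gg; have := A _ (ltnW gg).
  rewrite (glV g.-1) ?xl // (_ : minn g.-1.+2 g = g.-1.+1) ?Dg; last by lia.
  by case: odd.
have A0 (b : bool) : rho (x b, y b) = rho (x 0%N, y 0%N) by case: b.
move=> /(cell_parity g2)[j|j] [jg [-> ->]]; rewrite !inE [in rho p](surjective_pairing p).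
- have [D1 D2] := D _ jg.
  move=> /orP[]/eqP-> /orP[]/eqP->.
  + by rewrite (A j (ltnW jg)) A0.
  + by rewrite D2 A0.
  + by rewrite D1 A0.
  + by rewrite (A j.+1 jg) A0.
- have [_ D2] := D _ (ltnW jg); have [_ D3] := D _ jg.
  move=> /orP[]/eqP-> /orP[]/eqP->.
  + by rewrite D2 A0.
  + by rewrite -(B j jg) (A j (ltnW (ltnW jg))) A0.
  + by rewrite (A j.+1 (ltnW jg)) A0.
  + by rewrite D3 A0.
Qed.

Lemma open_quotient (U : set X) (V : set (R * R)) : open V ->
  (forall p, region g x y p -> U (rho p) <-> V p) -> open U.
Proof.
have [_ _ _ top] := quo.
move=> oV UV; apply/top; rewrite -open_subspaceIT.
have -> : rho @^-1` U `&` region g x y = V `&` region g x y.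
  by apply/seteqP; split=> p [/= h rp]; split=> //; apply/(UV p rp).
by rewrite open_subspaceIT; exact: open_subspaceW.
Qed.

Lemma region_surjective (a : X) : exists2 p, region g x y p & rho p = a.
Proof.
have [surj _ _ _] := quo; have [p rp <-] : (rho @` region g x y) a by rewrite surj.
by exists p.
Qed.

(** Functions on the surface are obtained from invariant functions on the
    plane. *)
Lemma descend_continuous (f : R * R -> R) : continuous f -> glue_invariant g x y f ->
  exists2 f' : X -> R, continuous f' & forall p, region g x y p -> f' (rho p) = f p.
Proof.
move=> cf fglue; have [_ _ inv _] := quo.
pose sec a := sval (cid2 (region_surjective a)).
have secr a : region g x y (sec a) by rewrite /sec; case: cid2.
have secK a : rho (sec a) = a by rewrite /sec; case: cid2.
have fE p : region g x y p -> f (sec (rho p)) = f p.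
  by move=> rp; apply: inv => //; exact: secK.
exists (f \o sec); last exact: fE.
apply/continuousP => V oV; apply: (@open_quotient _ (f @^-1` V)).
  by have /continuousP/(_ V oV) := cf.
by move=> p rp /=; rewrite fE.
Qed.

(** A function supported inside one column is not affected by the horizontal
    gluings, and only by the vertical gluing of this column. *)
Lemma glue_invariant_column (phi psi : R -> R) j : (j < g)%N ->
  (forall s, ~~ (x j < s < x j.+1) -> phi s = 0) ->
  psi (y j) = psi (y (minn j.+2 g)) ->
  glue_invariant g x y (fun z => phi z.1 * psi z.2).
Proof.
move=> jg phi0 psiE.
have phix i : phi (x i) = 0.
  by apply: phi0; rewrite !ltNge !xle; lia.
split=> [i t _ _|i s ig /andP[si si1]] /=; first by rewrite !phix !mul0r.
have [->|ij] := eqVneq i j; first by rewrite psiE.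
rewrite phi0 ?mul0r //; apply/negP => /andP[js sj].
have := le_lt_trans si sj; have := lt_le_trans js si1.
by rewrite !ltNge !xle; move: ij => /eqP; lia.
Qed.

Lemma glue_invariant_row (phi psi : R -> R) i : (i < g)%N ->
  (forall t, ~~ (y i < t < y i.+1) -> phi t = 0) ->
  psi (x i.-1) = psi (x i.+1) ->
  glue_invariant g x y (fun z => phi z.2 * psi z.1).
Proof.
move=> ig phi0 psiE.
have phiy j : phi (y j) = 0.
  by apply: phi0; rewrite !ltNge !yle; lia.
split=> [j t jg /andP[tj tj1]|j s _ _] /=; last by rewrite !phiy !mul0r.
have [->|ij] := eqVneq j i; first by rewrite psiE.
rewrite phi0 ?mul0r //; apply/negP => /andP[js sj].
have := le_lt_trans tj sj; have := lt_le_trans js tj1.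
by rewrite !ltNge !yle; move: ij => /eqP; lia.
Qed.

Definition bump (a b s : R) := Num.max 0 ((s - a) * (b - s)).

Lemma bump_continuous a b : continuous (bump a b).
Proof.
have c2 : continuous (fun s => (s - a) * (b - s) : R).
  move=> s; apply: cvgM; apply: cvgB; (exact: cvg_cst) || exact: cvg_id.
have cm : continuous ((cst 0 : R -> R^o) \max (fun s => (s - a) * (b - s) : R^o)).
  by move=> s; apply: continuous_max; [exact: cvg_cst|exact: c2].
exact: cm.
Qed.

Lemma bump_out a b s : a < b -> ~~ (a < s < b) -> bump a b s = 0.
Proof.
move=> ab; rewrite negb_and -!leNgt => sab; rewrite /bump; apply/max_idPl.
by case/orP: sab => h; [apply: mulr_le0_ge0|apply: mulr_ge0_le0]; lra.
Qed.

Lemma bump_in a b s : a < s < b -> bump a b s != 0.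
Proof.
move=> /andP[as_ sb]; have h : 0 < (s - a) * (b - s) by rewrite mulr_gt0 ?subr_gt0.
by rewrite /bump (max_idPr (ltW h)) gt_eqF.
Qed.

Lemma quad_continuous (a b : R) : continuous (fun t => (t - a) * (t - b) : R).
Proof.
by move=> s; apply: cvgM; apply: cvgB; (exact: cvg_cst) || exact: cvg_id.
Qed.

(** The coordinate across the strip is recovered from [bump] and its product
    with this coordinate. The coordinate [d] along the strip is recovered
    likewise from functions of [d] that take the same value at the two glued
    ends [A] and [B], namely the multiples of [(d - A) (d - B)]; they only
    confuse [A] and [B]. *)
Lemma strip_separated (c d : R * R -> R) (u v A B : R) p q :
  continuous c -> continuous d -> (forall z z', c z = c z' -> d z = d z' -> z = z') ->
  (forall f : R * R -> R, continuous f -> glue_invariant g x y f -> f p = f q) ->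
  (forall phi psi : R -> R, (forall s, ~~ (u < s < v) -> phi s = 0) ->
     psi A = psi B -> glue_invariant g x y (fun z => phi (c z) * psi (d z))) ->
  (forall z z', u <= c z <= v -> c z = c z' -> d z = A -> d z' = B -> rho z = rho z') ->
  u < c p < v -> rho p = rho q.
Proof.
move=> cc cd cdI ag inv gl cp; have uv : u < v by case/andP: cp; exact: lt_trans.
have test (phi psi : R -> R) : continuous phi -> continuous psi ->
    (forall s, ~~ (u < s < v) -> phi s = 0) -> psi A = psi B ->
    phi (c p) * psi (d p) = phi (c q) * psi (d q).
  move=> cphi cpsi phi0 psiE; apply: (ag (fun z => phi (c z) * psi (d z))).
    move=> z; apply: cvgM; first exact: (continuous_comp (cc z) (cphi _)).
    exact: (continuous_comp (cd z) (cpsi _)).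
  exact: inv.
pose phi := bump u v.
have cphi : continuous phi by exact: bump_continuous.
have phi0 s : ~~ (u < s < v) -> phi s = 0 by exact: bump_out.
have cone : continuous (cst 1 : R -> R) by move=> s; exact: cvg_cst.
have phip : phi (c p) != 0 by exact: bump_in.
have e1 : phi (c p) = phi (c q).
  by have := test _ _ cphi cone phi0 erefl; rewrite /= !mulr1.
have e2 : c p = c q.
  apply: (mulfI phip); rewrite [in RHS]e1.
  have := test (fun s => phi s * s) _ _ cone; rewrite /= !mulr1; apply=> //.
    by move=> s; apply: cvgM; [exact: cphi|exact: cvg_id].
  by move=> s /phi0->; rewrite mul0r.
have quad : (d p - A) * (d p - B) = (d q - A) * (d q - B).
  apply: (mulfI phip); rewrite [in RHS]e1.
  apply: (test phi (fun t => (t - A) * (t - B))) => //; first exact: quad_continuous.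
  by rewrite !subrr mul0r mulr0.
have cube : (d p - A) * (d p - B) * d p = (d q - A) * (d q - B) * d q.
  apply: (mulfI phip); rewrite [in RHS]e1.
  apply: (test phi (fun t => (t - A) * (t - B) * t)) => //; last first.
    by rewrite !subrr mul0r mulr0 !mul0r.
  by move=> t; apply: cvgM; [exact: quad_continuous|exact: cvg_id].
have [p0|p0] := eqVneq ((d p - A) * (d p - B)) 0; last first.
  by congr rho; apply: cdI => //; apply: (mulfI p0); rewrite cube quad.
have cp' : u <= c p <= v by case/andP: cp => /ltW-> /ltW->.
have cq' : u <= c q <= v by rewrite -e2.
have q0 : (d q - A) * (d q - B) = 0 by rewrite -quad.
move/eqP: p0; rewrite mulf_eq0 !subr_eq0; move/eqP: q0; rewrite mulf_eq0 !subr_eq0.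
have same z z' : c z = c z' -> d z = d z' -> rho z = rho z'.
  by move=> h1 h2; rewrite (cdI z z').
move=> /orP[]/eqP dq /orP[]/eqP dp.
- by apply: same; rewrite ?dp.
- by symmetry; apply: gl.
- by apply: gl.
- by apply: same; rewrite ?dp.
Qed.

(** Points whose abscissa or ordinate is strictly inside a grid interval are
    separated by [strip_separated]; the others are corners, and all corners
    are the same point. *)
Lemma grid_quotient_separated (a b : X) :
  (forall f : X -> R, continuous f -> f a = f b) -> a = b.
Proof.
have [p rp <-] := region_surjective a; have [q rq <-] := region_surjective b => sep.
have agree (f : R * R -> R) : continuous f -> glue_invariant g x y f -> f p = f q.
  by move=> cf fg; have [f' cf' f'E] := descend_continuous cf fg; rewrite -!f'E ?sep.
have [_ [glH glV] _ _] := quo.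
have sepX p' q' j : (forall f : R * R -> R, continuous f -> glue_invariant g x y f -> f p' = f q') ->
    (j < g)%N -> x j < p'.1 < x j.+1 -> rho p' = rho q'.
  move=> ag jg; apply: (@strip_separated fst snd _ _ (y j) (y (minn j.+2 g))) => //.
  - by move=> z; exact: cvg_fst.
  - by move=> z; exact: cvg_snd.
  - by case=> [z1 z2] [z1' z2'] /= -> ->.
  - by move=> phi psi; exact: glue_invariant_column.
  - by move=> [z1 z2] [z1' z2'] /= z1j <- -> ->; exact: glV.
have sepY p' q' i : (forall f : R * R -> R, continuous f -> glue_invariant g x y f -> f p' = f q') ->
    (i < g)%N -> y i < p'.2 < y i.+1 -> rho p' = rho q'.
  move=> ag ig; apply: (@strip_separated snd fst _ _ (x i.-1) (x i.+1)) => //.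
  - by move=> z; exact: cvg_snd.
  - by move=> z; exact: cvg_fst.
  - by case=> [z1 z2] [z1' z2'] /= -> ->.
  - by move=> phi psi; exact: glue_invariant_row.
  - by move=> [z1 z2] [z1' z2'] /= z1j <- -> ->; exact: glH.
have sep1 p' q' : (forall f : R * R -> R, continuous f -> glue_invariant g x y f -> f p' = f q') ->
    region g x y p' -> rho p' = rho q' \/ rho p' = rho (x 0%N, y 0%N).
  move=> ag [k kn]; rewrite /in_rect /= => /andP[/andP[h1 h2] /andP[h3 h4]].
  have kg : (k./2 < g)%N by move: kn; rewrite /ncells; lia.
  have ukg : (uphalf k < g)%N by move: kn; rewrite /ncells; lia.
  have [kx|kx] := boolP (x k./2 < p'.1 < x k./2.+1); first by left; exact: sepX kx.
  have [ky|ky] := boolP (y (uphalf k) < p'.2 < y (uphalf k).+1).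
    by left; exact: sepY ky.
  right; apply: (grid_corner kn); rewrite !inE.
    by move: kx; rewrite !lt_neqAle h1 h2 !andbT negb_and !negbK eq_sym.
  by move: ky; rewrite !lt_neqAle h3 h4 !andbT negb_and !negbK eq_sym.
have [//|p0] := sep1 p q agree rp.
have [|<-|q0] := sep1 q p _ rq; [by move=> f cf fg; rewrite agree|by []|by rewrite p0].
Qed.

Lemma grid_quotient_hausdorff : hausdorff_space X.
Proof.
move=> a b ab; apply: grid_quotient_separated => f cf.
apply: (@Rhausdorff R) => A B fA fB.
have [c [Ac Bc]] := ab _ _ (cf a A fA) (cf b B fB).
by exists (f c).
Qed.
End QuotientTopology.

(** * Circle-valued functions on the glued surface *)

Section CircleFunctions.
Context (R : realType) (g : nat) (x y : nat -> R) (X : topologicalType).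
Context (rho : R * R -> X).
Context (quo : grid_quotient g x y rho).

Lemma rho_continuous : {within region g x y, continuous rho}.
Proof.
have [_ _ _ top] := quo.
by apply/continuousP => U /top.
Qed.

(** Rectangles of the polygon are the domains on which [segD] applies. *)
Lemma rho_continuous_rect A : (forall z, in_rect A z -> region g x y z) ->
  {within [set z | in_rect A z], continuous rho}.
Proof. by move=> Ar; apply: (continuous_subspaceW _ rho_continuous). Qed.

(** Two reals agree modulo 1 exactly when their fractional parts are equal; so
    invariance modulo 1 is an instance of [glue_invariant]. *)
Definition fractional (t : R) := t - (Num.floor t)%:~R.

Lemma frac_int s t : fractional s = fractional t -> s - t \is a Num.int.
Proof.
move=> st; have -> : s - t = (Num.floor s)%:~R - (Num.floor t)%:~R.
  by move: st; rewrite /fractional => st; lra.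
by rewrite rpredB // intr_int.
Qed.

Lemma int_frac s t : s - t \is a Num.int -> fractional s = fractional t.
Proof.
move=> /intrP[m mE]; have -> : s = t + m%:~R by rewrite -mE addrC subrK.
by rewrite /fractional floorDrz ?intr_int // intrKfloor intrD; ring.
Qed.

Lemma descend_circle (f : R * R -> R) : continuous f ->
  glue_invariant g x y (fractional \o f) ->
  exists2 u : X -> R, circle_continuous u &
    forall p, region g x y p -> u (rho p) - f p \is a Num.int.
Proof.
move=> cf fglue; have [_ _ inv _] := quo.
pose sec a := sval (cid2 (region_surjective quo a)).
have secr a : region g x y (sec a) by rewrite /sec; case: cid2.
have secK a : rho (sec a) = a by rewrite /sec; case: cid2.
have fE p : region g x y p -> f (sec (rho p)) - f p \is a Num.int.
  by move=> rp; apply: frac_int; apply: (inv _ (fractional \o f)) => //; exact: secK.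
exists (f \o sec) => // a e e0.
pose V := [set z | exists2 d : R, d - (f z - f (sec a)) \is a Num.int & `|d| < e].
apply: open_nbhs_nbhs; split; last first.
  by exists 0; rewrite ?normr0 // subrr subr0 rpred0.
apply: (open_quotient quo (V := V)).
  rewrite openE => z [d dZ de].
  have ed : 0 < e - `|d| by rewrite subr_gt0.
  have /cvgrPdist_lt/(_ _ ed) := cf z; apply: filterS => z' zz'.
  exists (d + (f z' - f z)).
    by have -> : d + (f z' - f z) - (f z' - f (sec a)) = d - (f z - f (sec a)) by ring.
  by rewrite (le_lt_trans (ler_normD _ _)) // -ltrBrDl distrC.
move=> p rp; have := fE p rp; split=> -[d dZ de]; exists d => //; rewrite /= in dZ *.
  have -> : d - (f p - f (sec a)) =
    (d - (f (sec (rho p)) - f (sec a))) + (f (sec (rho p)) - f p) by ring.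
  by rewrite rpredD ?fE.
have -> : d - (f (sec (rho p)) - f (sec a)) =
  (d - (f p - f (sec a))) - (f (sec (rho p)) - f p) by ring.
by rewrite rpredB ?fE.
Qed.

Lemma affine_edge_point (p q : R * R) :
  affine_simplex [tuple p; q] (edge_point 0) = p /\
  affine_simplex [tuple p; q] (edge_point 1) = q.
Proof.
have c0 : clamp01 (0 : R) = 0 by rewrite clamp01_id ?lexx ?ler01.
have c1 : clamp01 (1 : R) = 1 by rewrite clamp01_id ?lexx ?ler01.
rewrite /affine_simplex !big_ord_recl !big_ord0 /= !mxE /= c0 c1.
by split; rewrite !(subr0, subrr, mul0r, mul1r, addr0, add0r) -surjective_pairing.
Qed.

(** A segment of the polygon comes with a lift, namely [f] itself, so that the
    value of the cocycle is explicit; the correction [w] cancels on loops. *)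
Lemma circle_function_cocycle (f : R * R -> R) : continuous f ->
  glue_invariant g x y (fractional \o f) ->
  exists phi : cochain R X 1, exists w : X -> R, cocycle1 phi /\
    forall A p q, (forall z, in_rect A z -> region g x y z) ->
      in_rect A p -> in_rect A q ->
      (ceval phi (polygon_simplex rho [tuple p; q]))%:~R =
        f q - f p - (w (rho q) - w (rho p)) :> R.
Proof.
move=> cf fglue; have [u cu uf] := descend_circle cf fglue.
have [phi [phiZ phiE]] := circle_cocycle cu.
exists phi, u; split=> // A p q Ar Ap Aq.
have Av i : in_rect A (tnth [tuple p; q] i) by case: i => [[|[|//]] ?].
have crho := polygon_simplex_continuous (rho_continuous_rect Ar) Av.
rewrite /polygon_simplex (chain_ofE crho) ceval1.
rewrite (phiE _ (f \o affine_simplex [tuple p; q])).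
- have [e0 e1] := affine_edge_point p q; pose e := affine_simplex [tuple p; q].
  transitivity (f (e (edge_point 1)) - f (e (edge_point 0)) -
    (u (rho (e (edge_point 1))) - u (rho (e (edge_point 0))))); first by [].
  by rewrite /e e0 e1.
- move=> t; exact: (@continuous_comp _ _ _ (affine_simplex _) f t (@affine_continuous R 1 _ t) (cf _)).
move=> t; rewrite /mkcts /= -opprB rpredN; apply: uf; apply: Ar.
exact: affine_in_rect.
Qed.

End CircleFunctions.

Section GridFunctions.
Context (R : realType) (u : nat -> R).
Context (ule : {mono u : i j / (i <= j)%N >-> i <= j}).

(** Modulo 1 this is a map of degree one on the circle spanned by the interval
    [j], constant elsewhere. *)
Definition ramp j (s : R) : R := clamp01 ((s - u j) / (u j.+1 - u j)).

Lemma ramp_continuous j : continuous (ramp j).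
Proof.
have c1 : continuous (fun s : R => (s - u j) / (u j.+1 - u j)).
  by move=> s; apply: cvgMl; apply: cvgB; [exact: cvg_id|exact: cvg_cst].
by move=> s; exact: (continuous_comp (c1 s) (@clamp01_continuous R _)).
Qed.

Lemma ramp_grid j i : ramp j (u i) = (j < i)%:R.
Proof.
have d0 : 0 < u j.+1 - u j by rewrite subr_gt0 ltNge ule; lia.
rewrite /ramp; have [ji|ij] := ltnP j i.
  by rewrite clamp01_1 // ler_pdivlMr // mul1r lerB // ule.
by rewrite clamp01_0 // ler_pdivrMr // mul0r subr_le0 ule.
Qed.

(** The signs are those of the class [gamma_k], so that this function
    represents its dual. *)
Definition alternating_ramp g k (s : R) : R :=
  \sum_(l < g | (k <= l)%N) (-1) ^+ (l - k) * ramp l s.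

Lemma alternating_ramp_continuous g k : continuous (alternating_ramp g k).
Proof.
pose F (l : 'I_g) (s : R) := if (k <= l)%N then (-1) ^+ (l - k) * ramp l s else 0.
have -> : alternating_ramp g k = fun s => \sum_l F l s.
  by apply/funext => s; exact: big_mkcond.
apply: sum_continuous => l s; rewrite /F; case: (k <= l)%N; last exact: cvg_cst.
by apply: cvgMr; exact: ramp_continuous.
Qed.

Lemma alternating_ramp_int g k i : alternating_ramp g k (u i) \is a Num.int.
Proof.
apply: rpred_sum => l _; rewrite ramp_grid; apply: rpredM; last exact: natr_int.
by rewrite rpredX // rpredN rpred1.
Qed.

Lemma alternating_ramp_step g k j : (j < g)%N ->
  alternating_ramp g k (u j.+1) - alternating_ramp g k (u j) =
  if (k <= j)%N then (-1) ^+ (j - k) else 0.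
Proof.
move=> jg; rewrite /alternating_ramp -sumrB.
rewrite (eq_bigr (fun l : 'I_g => if l == j :> nat then (-1) ^+ (j - k) else 0)).
  rewrite -big_mkcondr /=; case: ifP => kj.
    by rewrite (big_pred1 (Ordinal jg)) // => l; rewrite /= -(inj_eq val_inj) andbC /=; case: eqP => //= ->.
  by rewrite big_pred0 // => l; rewrite andbC; case: eqP => //= ->.
move=> l _; rewrite !ramp_grid -mulrBr; case: (ltngtP l j) => lj.
- by rewrite ltnS (ltnW lj) subrr mulr0.
- by rewrite ltnS leqNgt lj subrr mulr0.
- by rewrite lj ltnSn subr0 mulr1.
Qed.

End GridFunctions.

(** * The sides of the cells *)

Section CellSums.
Context (g : nat) (V : zmodType) (F : nat -> V).
Context (g2 : (1 < g)%N).
Local Notation n := (ncells g).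

(** The row [0] has only one cell. *)
Lemma sum_row j : (j < g)%N ->
  \sum_(k < n | uphalf k == j) F k = (if (0 < j)%N then F j.*2.-1 else 0) + F j.*2.
Proof.
move=> jg; have n2 : (j.*2 < n)%N by rewrite /ncells; lia.
have n1 : (j.*2.-1 < n)%N by rewrite /ncells; lia.
rewrite (bigD1 (Ordinal n2)) /=; last by apply/eqP; lia.
rewrite addrC; congr (_ + _); case: ifP => j0.
  rewrite (big_pred1 (Ordinal n1)) // => k; rewrite /= -!(inj_eq val_inj) /=.
  by apply/andP/eqP => [[/eqP h1 /eqP h2]|->]; [|split; apply/eqP]; lia.
rewrite big_pred0 // => k; rewrite /= -!(inj_eq val_inj) /=.
by apply/negP => /andP[/eqP h1 /eqP h2]; lia.
Qed.

(** The last column has only one cell. *)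
Lemma sum_col j : (j < g)%N ->
  \sum_(k < n | k./2 == j) F k = F j.*2 + (if (j.+1 < g)%N then F j.*2.+1 else 0).
Proof.
move=> jg; have n2 : (j.*2 < n)%N by rewrite /ncells; lia.
rewrite (bigD1 (Ordinal n2)) /=; last by apply/eqP; lia.
congr (_ + _); case: ifP => jg1.
  have n1 : (j.*2.+1 < n)%N by rewrite /ncells; lia.
  rewrite (big_pred1 (Ordinal n1)) // => k; rewrite /= -!(inj_eq val_inj) /=.
  by apply/andP/eqP => [[/eqP h1 /eqP h2]|->]; [|split; apply/eqP]; lia.
rewrite big_pred0 // => k; rewrite /= -!(inj_eq val_inj) /=.
apply/negP => /andP[/eqP h1 /eqP h2].
by have : (k < g.-1.*2.+1)%N := ltn_ord k; lia.
Qed.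

(** The cell that is met above [k] in its column after gluing; the last column
    has a single cell. *)
Definition above k : nat := if odd k then k.-1 else if (k.+1 < n)%N then k.+1 else k.
(** The cell that is met to the right of [k] in its row after gluing; the row
    [0] has a single cell, and [0.-1 = 0]. *)
Definition right_of k : nat := if odd k then k.+1 else k.-1.

Lemma above_lt k : (k < n)%N -> (above k < n)%N.
Proof. by rewrite /above /ncells; case: ifP => ?; [|case: ifP => ?]; lia. Qed.

Lemma right_of_lt k : (k < n)%N -> (right_of k < n)%N.
Proof. by rewrite /right_of /ncells; case: ifP => ?; lia. Qed.

Lemma aboveK k : (k < n)%N -> above (above k) = k.
Proof.
move=> kn; rewrite /above; have [kodd|keven] := boolP (odd k).
  have -> : odd k.-1 = false by lia.
  by rewrite ifT; lia.
have [kn1|kn1] := boolP (k.+1 < n)%N; first by rewrite /= keven.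
by rewrite (negPf keven) (negPf kn1).
Qed.

Lemma right_ofK k : (k < n)%N -> right_of (right_of k) = k.
Proof.
move=> kn; rewrite /right_of; have [kodd|keven] := boolP (odd k).
  by rewrite /= kodd.
by case: ifP => h; lia.
Qed.

Lemma sum_involution (s : nat -> nat) : (forall k, (k < n)%N -> (s k < n)%N) ->
  (forall k, (k < n)%N -> s (s k) = k) -> \sum_(k < n) F (s k) = \sum_(k < n) F k.
Proof.
move=> sn sK; pose so (k : 'I_n) := Ordinal (sn _ (ltn_ord k)).
rewrite [RHS](reindex_inj (h := so)) // => k l /(congr1 val) /= kl.
by apply: val_inj; rewrite /= -(sK _ (ltn_ord k)) kl sK.
Qed.

End CellSums.

Section Edges.
Context (R : realType) (g : nat) (x y : nat -> R) (X : topologicalType).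
Context (rho : R * R -> X).
Context (g2 : (1 < g)%N).
Context (xle : {mono x : i j / (i <= j)%N >-> i <= j}).
Context (yle : {mono y : i j / (i <= j)%N >-> i <= j}).
Context (quo : grid_quotient g x y rho).
Local Notation n := (ncells g).
Local Notation S2 p q := (polygon_simplex rho [tuple p; q]).

Definition row_rect i : rect R := Rect (x i.-1) (x i.+1) (y i) (y i.+1).
Definition col_rect j : rect R := Rect (x j) (x j.+1) (y j) (y (minn j.+2 g)).

Lemma cell_region k : (k < n)%N -> forall z, in_rect (gcell x y k) z -> region g x y z.
Proof. by move=> kn z kz; exists k. Qed.

Lemma row_region i : (i < g)%N -> forall z, in_rect (row_rect i) z -> region g x y z.
Proof.
move=> ig z; rewrite /in_rect /= => /andP[/andP[z1 z2] zy].
have e1 : i.*2.-1./2 = i.-1 by lia.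
have e2 : uphalf i.*2.-1 = i by lia.
have e3 : uphalf i.*2 = i by lia.
have [zi|iz] := leP z.1 (x i).
  exists i.*2.-1; first by rewrite /ncells; lia.
  rewrite /in_rect /= e1 e2 z1 zy andbT /=; apply: le_trans zi _.
  by rewrite xle; lia.
exists i.*2; first by rewrite /ncells; lia.
by rewrite /in_rect /= doubleK e3 z2 zy (ltW iz).
Qed.

Lemma col_region j : (j < g)%N -> forall z, in_rect (col_rect j) z -> region g x y z.
Proof.
move=> jg z; rewrite /in_rect /= => /andP[zx /andP[z1 z2]].
have e1 : (minn j.*2.+1 g.-1.*2)./2 = j by lia.
have e2 : (uphalf (minn j.*2.+1 g.-1.*2)).+1 = minn j.+2 g by lia.
have e3 : uphalf j.*2 = j by lia.
have [zj|jz] := leP z.2 (y j.+1).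
  exists j.*2; first by rewrite /ncells; lia.
  by rewrite /in_rect /= doubleK e3 zx z1 zj.
exists (minn j.*2.+1 g.-1.*2); first by rewrite /ncells; lia.
rewrite /in_rect /= e1 e2 zx z2 andbT /=; apply: le_trans (ltW jz).
by rewrite yle; lia.
Qed.

Lemma glue_side i s t : (i < g)%N -> y i <= s <= y i.+1 -> y i <= t <= y i.+1 ->
  S2 (x i.+1, s) (x i.+1, t) = S2 (x i.-1, s) (x i.-1, t).
Proof.
have [_ [glH _] _ _] := quo => ig hs ht.
apply: (@polygon_simplex_translate _ _ (Rect (x i.-1) (x i.-1) (y i) (y i.+1)) _ _
  (x i.+1 - x i.-1, 0)).
- by case=> [[|[|//]] ?]; rewrite /in_rect /= lexx ?hs ?ht.
- case=> [z1 z2]; rewrite /in_rect /= -eq_le => /andP[/eqP <- hz].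
  by rewrite addr0 addrC subrK; symmetry; exact: glH.
by case=> [[|[|//]] ?]; rewrite /= addr0 addrC subrK.
Qed.

Lemma glue_base j s t : (j < g)%N -> x j <= s <= x j.+1 -> x j <= t <= x j.+1 ->
  S2 (s, y (minn j.+2 g)) (t, y (minn j.+2 g)) = S2 (s, y j) (t, y j).
Proof.
have [_ [_ glV] _ _] := quo => jg hs ht.
apply: (@polygon_simplex_translate _ _ (Rect (x j) (x j.+1) (y j) (y j)) _ _
  (0, y (minn j.+2 g) - y j)).
- by case=> [[|[|//]] ?]; rewrite /in_rect /= lexx ?hs ?ht.
- case=> [z1 z2]; rewrite /in_rect /= -eq_le => /andP[hz /eqP <-].
  by rewrite addr0 addrC subrK; symmetry; exact: glV.
by case=> [[|[|//]] ?]; rewrite /= addr0 addrC subrK.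
Qed.

Definition hedge k := S2 (x k./2, y (uphalf k)) (x k./2.+1, y (uphalf k)).
Definition vedge k := S2 (x k./2, y (uphalf k)) (x k./2, y (uphalf k).+1).

Lemma top_edge k : (k < n)%N ->
  S2 (x k./2, y (uphalf k).+1) (x k./2.+1, y (uphalf k).+1) = hedge (above g k).
Proof.
rewrite /ncells => kn; rewrite /above /ncells.
have base j : (j < g)%N -> S2 (x j, y (minn j.+2 g)) (x j.+1, y (minn j.+2 g)) =
    S2 (x j, y j) (x j.+1, y j).
  by move=> jg; rewrite glue_base // !xle; lia.
have [kodd|keven] := ifP.
  rewrite /hedge (_ : k.-1./2 = k./2); last by lia.
  rewrite (_ : uphalf k.-1 = k./2); last by lia.
  by rewrite -base; [rewrite (_ : (uphalf k).+1 = minn k./2.+2 g) //|]; lia.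
case: ifP => kn1.
  rewrite /hedge (_ : k.+1./2 = k./2); last by lia.
  by rewrite (_ : uphalf k.+1 = (uphalf k).+1) //; lia.
rewrite /hedge (_ : uphalf k = k./2); last by lia.
have kg : (k./2 < g)%N by lia.
have e : minn k./2.+2 g = k./2.+1 by lia.
by have := base _ kg; rewrite e => ->.
Qed.

Lemma right_edge k : (k < n)%N ->
  S2 (x k./2.+1, y (uphalf k)) (x k./2.+1, y (uphalf k).+1) = vedge (right_of k).
Proof.
rewrite /ncells => kn; rewrite /right_of; have [kodd|keven] := ifP.
  rewrite /vedge (_ : k.+1./2 = k./2.+1); last by lia.
  by rewrite (_ : uphalf k.+1 = uphalf k) //; lia.
rewrite /vedge (_ : k.-1./2 = k./2.-1); last by lia.
rewrite (_ : uphalf k.-1 = k./2); last by lia.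
rewrite (_ : uphalf k = k./2); last by lia.
by rewrite glue_side // ?lexx ?yle ?leqnSn //; lia.
Qed.

Lemma cell_rect_continuous k : (k < n)%N ->
  {within [set z | in_rect (gcell x y k) z], continuous rho}.
Proof. by move=> kn; apply: (rho_continuous_rect quo); exact: cell_region. Qed.

(** The two paths around the cell from its lower left to its upper right
    corner. *)
Lemma cell_relation k : (k < n)%N ->
  cls (hedge k) + cls (vedge (right_of k)) = cls (vedge k) + cls (hedge (above g k)).
Proof.
move=> kn; rewrite -right_edge // -top_edge //.
have ck := cell_rect_continuous kn.
have [xx yy] : x k./2 <= x k./2.+1 /\ y (uphalf k) <= y (uphalf k).+1.
  by rewrite xle yle !leqnSn.
have corner a b : a \in [:: x k./2; x k./2.+1] -> b \in [:: y (uphalf k); y (uphalf k).+1] ->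
    in_rect (gcell x y k) (a, b).
  by rewrite !inE /in_rect /= => /orP[]/eqP-> /orP[]/eqP->; rewrite ?lexx ?xx ?yy.
transitivity (seg rho (x k./2, y (uphalf k)) (x k./2.+1, y (uphalf k).+1)).
  by apply: (segD ck); apply: corner; rewrite !inE eqxx ?orbT.
by symmetry; apply: (segD ck); apply: corner; rewrite !inE eqxx ?orbT.
Qed.

(** The difference [h_k - h_(above k)] equals [v_k - v_(right_of k)] by
    [cell_relation]. It is 0 for [k = 0] because [right_of 0 = 0], and passing
    from [k] to [k.+1], which is either [above k] or [right_of k], changes its
    sign. *)
Lemma edges_across k : (k < n)%N ->
  cls (hedge (above g k)) = cls (hedge k) /\ cls (vedge (right_of k)) = cls (vedge k).
Proof.
move=> kn; have rel m : (m < n)%N -> cls (hedge m) - cls (hedge (above g m)) =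
    cls (vedge m) - cls (vedge (right_of m)).
  by move=> /cell_relation e; apply/eqP; rewrite subr_eq addrAC -e addrK.
suff E0 : cls (hedge k) - cls (hedge (above g k)) = 0.
  have := E0; rewrite rel // => /eqP; rewrite subr_eq0 => /eqP <-.
  by move/eqP: E0; rewrite subr_eq0 => /eqP <-.
elim: k kn => [|k IHk] kn; first by rewrite rel // subrr.
have := IHk (ltnW kn); case: (boolP (odd k)) => kodd.
  rewrite !rel ?(ltnW kn) // (_ : right_of k = k.+1); last by rewrite /right_of kodd.
  rewrite (_ : right_of k.+1 = k); last by rewrite /right_of /= kodd.
  by rewrite -opprB => /eqP; rewrite oppr_eq0 => /eqP.
rewrite (_ : above g k = k.+1); last by rewrite /above (negPf kodd) kn.
rewrite (_ : above g k.+1 = k); last by rewrite /above /= kodd.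
by rewrite -opprB => /eqP; rewrite oppr_eq0 => /eqP.
Qed.

End Edges.

(** * Central curves and fundamental cycle in terms of the sides *)

Section Loops.
Context (R : realType) (g : nat) (x y : nat -> R) (X : topologicalType).
Context (rho : R * R -> X).
Context (g2 : (1 < g)%N).
Context (xle : {mono x : i j / (i <= j)%N >-> i <= j}).
Context (yle : {mono y : i j / (i <= j)%N >-> i <= j}).
Context (quo : grid_quotient g x y rho).
Local Notation n := (ncells g).
Local Notation S2 p q := (polygon_simplex rho [tuple p; q]).
Local Notation hedge := (hedge x y rho).
Local Notation vedge := (vedge x y rho).

Definition row_chain i t := \sum_(k < n | uphalf k == i) S2 (x k./2, t) (x k./2.+1, t).
Definition col_chain j s := \sum_(k < n | k./2 == j) S2 (s, y (uphalf k)) (s, y (uphalf k).+1).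

Lemma row_chain_total i t : (i < g)%N -> y i <= t <= y i.+1 ->
  cls (row_chain i t) = seg rho (x i.-1, t) (x i.+1, t).
Proof.
move=> ig ht; rewrite raddf_sum /=.
rewrite (sum_row (fun k => cls (S2 (x k./2, t) (x k./2.+1, t)))) // doubleK.
have cr := rho_continuous_rect quo (row_region g2 xle ig).
case: ifP => i0; last by rewrite add0r (_ : i.-1 = i) //; lia.
rewrite (_ : i.*2.-1./2 = i.-1); last by lia.
rewrite prednK //; apply: (segD cr); rewrite /in_rect /= ht !xle; lia.
Qed.

Lemma col_chain_total j s : (j < g)%N -> x j <= s <= x j.+1 ->
  cls (col_chain j s) = seg rho (s, y j) (s, y (minn j.+2 g)).
Proof.
move=> jg hs; rewrite raddf_sum /=.
rewrite (sum_col (fun k => cls (S2 (s, y (uphalf k)) (s, y (uphalf k).+1)))) //.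
have cr := rho_continuous_rect quo (col_region g2 yle jg).
rewrite (_ : uphalf j.*2 = j); last by lia.
case: ifP => j0; last by rewrite addr0 (_ : minn j.+2 g = j.+1) //; lia.
rewrite (_ : uphalf j.*2.+1 = j.+1); last by lia.
rewrite (_ : minn j.+2 g = j.+2); last by lia.
apply: (segD cr); rewrite /in_rect /= hs (_ : minn j.+2 g = j.+2) ?yle; lia.
Qed.

Lemma row_chain_cycle i t : (i < g)%N -> y i <= t <= y i.+1 -> boundary (row_chain i t) = 0.
Proof.
move=> ig ht; rewrite (cls_boundary_eq (row_chain_total ig ht)).
have cr := rho_continuous_rect quo (row_region g2 xle ig).
rewrite (boundary_segment cr); first last.
- by rewrite /in_rect /= ht !xle; lia.
- by rewrite /in_rect /= ht !xle; lia.
have [_ [glH _] _ _] := quo.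
by rewrite (point_simplex_eq (glH i t ig ht)) subrr.
Qed.

Lemma col_chain_cycle j s : (j < g)%N -> x j <= s <= x j.+1 -> boundary (col_chain j s) = 0.
Proof.
move=> jg hs; rewrite (cls_boundary_eq (col_chain_total jg hs)).
have cr := rho_continuous_rect quo (col_region g2 yle jg).
rewrite (boundary_segment cr); first last.
- by rewrite /in_rect /= hs !yle; lia.
- by rewrite /in_rect /= hs !yle; lia.
have [_ [_ glV] _ _] := quo.
by rewrite (point_simplex_eq (glV j s jg hs)) subrr.
Qed.

(** The two vertical sides of the rectangle between the heights [y i] and [t]
    are glued, hence cancel. *)
Lemma row_chain_shift i t : (i < g)%N -> y i <= t <= y i.+1 ->
  cls (row_chain i t) = \sum_(k < n | uphalf k == i) cls (hedge k).
Proof.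
move=> ig ht; have h0 : y i <= y i <= y i.+1 by rewrite lexx yle leqnSn.
transitivity (cls (row_chain i (y i))); last first.
  by rewrite raddf_sum; apply: eq_bigr => k /eqP <-.
rewrite !row_chain_total //.
have cr := rho_continuous_rect quo (row_region g2 xle ig).
have sides : seg rho (x i.+1, y i) (x i.+1, t) = seg rho (x i.-1, y i) (x i.-1, t).
  by rewrite /seg (glue_side quo).
(* Compare the two paths around the rectangle between the two heights. *)
apply: (addrI (seg rho (x i.-1, y i) (x i.-1, t))); rewrite (segD cr); first last.
- by rewrite /in_rect /= ht !xle; lia.
- by rewrite /in_rect /= ht !xle; lia.
- by rewrite /in_rect /= h0 !xle; lia.
rewrite addrC -sides (segD cr) //.
- by rewrite /in_rect /= h0 !xle; lia.
- by rewrite /in_rect /= h0 !xle; lia.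
- by rewrite /in_rect /= ht !xle; lia.
Qed.

Lemma col_chain_shift j s : (j < g)%N -> x j <= s <= x j.+1 ->
  cls (col_chain j s) = \sum_(k < n | k./2 == j) cls (vedge k).
Proof.
move=> jg hs; have h0 : x j <= x j <= x j.+1 by rewrite lexx xle leqnSn.
transitivity (cls (col_chain j (x j))); last first.
  by rewrite raddf_sum; apply: eq_bigr => k /eqP <-.
rewrite !col_chain_total //.
have cr := rho_continuous_rect quo (col_region g2 yle jg).
have sides : seg rho (x j, y (minn j.+2 g)) (s, y (minn j.+2 g)) =
    seg rho (x j, y j) (s, y j).
  by rewrite /seg (glue_base quo).
apply: (addrI (seg rho (x j, y j) (s, y j))); rewrite (segD cr); first last.
- by rewrite /in_rect /= hs !yle; lia.
- by rewrite /in_rect /= hs !yle; lia.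
- by rewrite /in_rect /= h0 !yle; lia.
rewrite addrC -sides (segD cr) //.
- by rewrite /in_rect /= h0 !yle; lia.
- by rewrite /in_rect /= h0 !yle; lia.
- by rewrite /in_rect /= hs !yle; lia.
Qed.

Definition grid_cycle : chain R X 2 := \sum_(k < n)
  (polygon_simplex rho [tuple (x k./2, y (uphalf k)); (x k./2.+1, y (uphalf k));
                              (x k./2.+1, y (uphalf k).+1)] -
   polygon_simplex rho [tuple (x k./2, y (uphalf k)); (x k./2, y (uphalf k).+1);
                              (x k./2.+1, y (uphalf k).+1)]).

Lemma cell_corner k a b : a \in [:: x k./2; x k./2.+1] ->
  b \in [:: y (uphalf k); y (uphalf k).+1] -> in_rect (gcell x y k) (a, b).
Proof.
by rewrite !inE /in_rect /= => /orP[]/eqP-> /orP[]/eqP->; rewrite ?lexx ?xle ?yle ?leqnSn.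
Qed.

(** The diagonals cancel in each cell, and each side occurs once as a bottom
    or left side and once as a top or right side. *)
Lemma grid_cycle_boundary : boundary grid_cycle = 0.
Proof.
rewrite /grid_cycle raddf_sum /=.
rewrite (eq_bigr (fun k : 'I_n => (vedge (right_of k) - vedge k) -
  (hedge (above g k) - hedge k))); last first.
  move=> k _; have kn := ltn_ord k; have ck := cell_rect_continuous quo kn.
  rewrite raddfB /= !(boundary_triangle ck); try by apply: cell_corner; rewrite !inE eqxx ?orbT.
  rewrite (top_edge g2 xle quo kn) (right_edge g2 yle quo kn) -/(hedge k) -/(vedge k).
  set e := vedge k; set b := hedge k; set c := hedge _; set a := vedge _.
  set d := polygon_simplex _ _.
  rewrite [a - d + b]addrAC opprD opprB addrA subrKA.
  by rewrite opprB [RHS]addrACA [- e - c]addrC addrA.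
rewrite sumrB !sumrB.
rewrite (sum_involution vedge (right_of_lt g2) (right_ofK g2)).
by rewrite (sum_involution hedge (above_lt g2) (aboveK g2)) !subrr.
Qed.

(** On a triangle the cap product evaluates the cocycle on the first edge and
    keeps the second one; the second edges are right and top sides, which are
    replaced by the left and bottom sides of the same cell thanks to
    [edges_across]. *)
Lemma cap_grid_cycle (phi : cochain R X 1) :
  cls (cap grid_cycle phi) =
  \sum_(k < n) (cls (vedge k) *~ ceval phi (hedge k) -
                cls (hedge k) *~ ceval phi (vedge k)).
Proof.
have capS (F : 'I_n -> chain R X 2) : cap (\sum_k F k) phi = \sum_k cap (F k) phi.
  apply: (big_morph (fun c => cap c phi)) => [c d|]; last exact: cap0.
  by rewrite -[d]opprK capB -[in RHS](sub0r (- d)) capB cap0 sub0r.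
rewrite /grid_cycle capS raddf_sum; apply: eq_bigr => k _ /=.
have kn := ltn_ord k; have ck := cell_rect_continuous quo kn.
rewrite capB raddfB /= !(cap_triangle _ ck); try by apply: cell_corner; rewrite !inE eqxx ?orbT.
rewrite !cls_scale (top_edge g2 xle quo kn) (right_edge g2 yle quo kn).
have [-> ->] := edges_across g2 xle yle quo kn.
by [].
Qed.

End Loops.

(** * Paths cut into short paths *)

Section RealInduction.
Context (R : realType).

(** A subdivision argument: the supremum of the [c] for which [D a c] holds is
    reached and equals [b]. *)
Lemma interval_subdivision (D : R -> R -> Prop) :
  (forall a b c, a <= b -> b <= c -> D a b -> D b c -> D a c) ->
  (forall s, exists2 e, 0 < e & forall a b, s - e < a -> a <= b -> b < s + e -> D a b) ->
  forall a b, a <= b -> D a b.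
Proof.
move=> Dadd Dloc a b ab; pose E := [set c | a <= c <= b /\ D a c].
have Daa : D a a by have [e e0] := Dloc a; apply; lra.
have Ea : E a by split=> //; rewrite lexx.
have hE : has_sup E by split; [exists a|exists b => c [/andP[]]].
pose s := sup E; have [e e0 De] := Dloc s.
have [c [/andP[ac cb] Dac] sc] := sup_adherent e0 hE.
have cs : c <= s by apply: ub_le_sup; [exact: hE.2|split=> //; rewrite ac].
have sb : s <= b by apply: ge_sup; [exists a|move=> d [/andP[]]].
have step m : c <= m -> m < s + e -> D a m.
  by move=> cm ms; apply: (Dadd a c m) => //; apply: De.
(* The supremum cannot be less than [b], as [s + e / 2] would still do. *)
have [bs|sb'] := ltP b (s + e); first by apply: step.
have Em : E (s + e / 2).
  split; last by apply: step; lra.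
  by apply/andP; split; lra.
have : s + e / 2 <= s by apply: ub_le_sup; [exact: hE.2|].
by lra.
Qed.

End RealInduction.

(** * Contractions of the coordinates *)

Section Rounding.
Context (R : realType) (g : nat) (u : nat -> R).
Context (ule : {mono u : i j / (i <= j)%N >-> i <= j}).

(** A locally constant map [T], on an open set [N], that moves points inside
    their grid intervals. For compatibility with the gluings, [N] contains all
    grid values or none, and [T] fixes them. *)
Definition rounding (N : set R) (T : R -> R) := [/\
  forall s, N s -> \forall s' \near s, N s' /\ T s' = T s,
  forall s j, (j < g)%N -> N s -> u j <= s <= u j.+1 -> u j <= T s <= u j.+1 &
  forall j, (j <= g)%N -> N (u j) -> forall i, (i <= g)%N -> N (u i) /\ T (u i) = u i].

(** Near a value strictly inside a grid interval, contract this interval to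
    that value. *)
Lemma rounding_interval j s : (j < g)%N -> u j < s < u j.+1 ->
  rounding [set s' | u j < s' < u j.+1] (cst s).
Proof.
move=> jg sj; split=> [s' /= /andP[h1 h2]|s' i ig /= /andP[h1 h2] /andP[h3 h4]|i ig /= /andP[h1 h2]].
- near=> z; split=> //; apply/andP; split; near: z.
    exact: lt_nbhsr.
  exact: lt_nbhsl.
- have : u j < u i.+1 by exact: lt_le_trans h1 h4.
  have : u i < u j.+1 by exact: le_lt_trans h3 h2.
  rewrite !ltNge !ule => h5 h6; have <- : j = i by lia.
  by case/andP: sj => /ltW-> /ltW->.
by move: h1 h2; rewrite !ltNge !ule; lia.
Unshelve. all: by end_near.
Qed.

Definition midpoint j := (u j + u j.+1) / 2.

Lemma midpoint_itv j : u j < midpoint j < u j.+1.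
Proof.
have : u j < u j.+1 by rewrite ltNge ule; lia.
by rewrite /midpoint => h; apply/andP; split; lra.
Qed.

Lemma grid_midpoint i j : u i != midpoint j.
Proof.
have /andP[m1 m2] := midpoint_itv j; have [ij|ji] := leqP i j.
  by rewrite lt_eqF // (le_lt_trans _ m1) // ule.
by rewrite gt_eqF // (lt_le_trans m2) // ule.
Qed.

(** Counting the midpoints on the left of [s] gives the index of the nearest
    grid value, and makes local constancy visible. *)
Definition nearest (s : R) := u (\sum_(i < g) (midpoint i < s)%R)%N.

Lemma nearestE s j : (j < g)%N -> u j <= s <= u j.+1 ->
  nearest s = u (j + (midpoint j < s)%R).
Proof.
move=> jg /andP[h1 h2]; rewrite /nearest; congr u.
set b := midpoint j < s.
rewrite (eq_bigr (fun i : 'I_g => nat_of_bool (i < j + b)%N)); last first.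
  move=> i _; congr nat_of_bool; have /andP[m1 m2] := midpoint_itv i.
  have [ij|ji|ij] := ltngtP i j.
  - rewrite (lt_le_trans m2) ?ltn_addr //; apply: le_trans h1.
    by rewrite ule.
  - have -> : (i < j + b)%N = false by rewrite /b; case: (midpoint j < s); lia.
    apply/negbTE; rewrite -leNgt; apply: le_trans h2 (le_trans _ (ltW m1)).
    by rewrite ule.
  - by rewrite ij -/b; case: (b); lia.
have jb : (j + b <= g)%N by case: (b); lia.
elim: g jb => [|m IHm] jb; first by rewrite big_ord0; lia.
rewrite big_ord_recr /=; have [jm|mj] := leqP (j + b) m.
  by rewrite IHm //; lia.
rewrite (eq_bigr (fun=> 1%N)) ?sum1_card ?card_ord; first by lia.
by move=> i _; have := ltn_ord i; lia.
Qed.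

(** Near a grid value, contract to the nearest grid value. The set contains
    neighbourhoods of all grid values at once, as corners are glued together. *)
Lemma rounding_grid : rounding [set s | forall j, (j < g)%N -> s != midpoint j] nearest.
Proof.
have step j s : s != midpoint j -> \forall s' \near s,
    (s' != midpoint j) && ((midpoint j < s') == (midpoint j < s)).
  move=> sj; have [ms|sm] := ltP (midpoint j) s.
    near=> z; have zm : midpoint j < z by near: z; exact: lt_nbhsr.
    by rewrite gt_eqF // zm.
  have sm' : s < midpoint j by rewrite lt_neqAle sj.
  near=> z; have zm : z < midpoint j by near: z; exact: lt_nbhsl.
  by rewrite lt_eqF //= ltNge (ltW zm).
have nearest_fix i : (i <= g)%N -> nearest (u i) = u i.
  case: (ltngtP i g) => // [ig _|-> _].
    rewrite (@nearestE _ i) ?lexx ?ule ?leqnSn //.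
    by have /andP[/ltW] := midpoint_itv i; rewrite leNgt => /negPf->; rewrite addn0.
  have [g0|g0] := posnP g.
    by rewrite /nearest big1 ?g0 // => l; have := ltn_ord l; lia.
  rewrite (@nearestE _ g.-1) ?prednK ?lexx ?ule ?leq_pred ?andbT //.
  have /andP[_] := midpoint_itv g.-1; rewrite prednK // => ->.
  by rewrite addn1 prednK.
split=> [s Ns|s j jg Ns sj|j _ _ i ig].
- have : \forall s' \near s, forall i : 'I_g,
      (s' != midpoint i) && ((midpoint i < s') == (midpoint i < s)).
    apply: (@filter_forall _ _ (fun (l : 'I_g) s' => (s' != midpoint l) &&
      ((midpoint l < s') == (midpoint l < s))) _ (nbhs_filter s)) => l.
    by apply: step; exact: Ns.
  apply: filterS => s' Hs'; split=> [j jg|].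
    by have /andP[] := Hs' (Ordinal jg).
  rewrite /nearest; congr u; apply: eq_bigr => i _.
  by have /andP[_ /eqP->] := Hs' i.
- rewrite (nearestE jg sj); case: (_ < _); rewrite ?addn0 ?addn1 ?lexx ?ule ?leqnSn //.
- by split=> [k _|]; [exact: grid_midpoint|exact: nearest_fix].
Unshelve. all: by end_near.
Qed.

Lemma rounding_exists s j : (j < g)%N -> u j <= s <= u j.+1 ->
  exists N T, rounding N T /\ N s.
Proof.
move=> jg /andP[h1 h2]; have [sj|sj] := boolP (u j < s < u j.+1).
  by exists [set s' | u j < s' < u j.+1], (cst s); split=> //; exact: rounding_interval.
exists [set s | forall j, (j < g)%N -> s != midpoint j], nearest.
split; first exact: rounding_grid.
move=> i _; move: sj; rewrite !lt_neqAle h1 h2 !andbT negb_and !negbK.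
by case/orP=> /eqP; [move=> <-|move=> ->]; exact: grid_midpoint.
Qed.

End Rounding.

(** * Segments from the corners of the cells *)

Section RadialClass.
Context (R : realType) (g : nat) (x y : nat -> R) (X : topologicalType).
Context (rho : R * R -> X).
Context (g2 : (1 < g)%N).
Context (xle : {mono x : i j / (i <= j)%N >-> i <= j}).
Context (yle : {mono y : i j / (i <= j)%N >-> i <= j}).
Context (quo : grid_quotient g x y rho).
Local Notation n := (ncells g).
Local Notation cell := (gcell x y).
Context (V : chain_class R X -> Prop).
Context (V0 : V 0).
Context (VB : forall v w, V v -> V w -> V (v - w)).
Context (Vh : forall k, (k < n)%N -> V (cls (hedge x y rho k))).
Context (Vv : forall k, (k < n)%N -> V (cls (vedge x y rho k))).

Let VN v : V v -> V (- v). Proof. by move=> Vv'; rewrite -sub0r; exact: VB. Qed.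
Let VD v w : V v -> V w -> V (v + w).
Proof. by move=> Vv' Vw; rewrite -[w]opprK; apply: VB => //; exact: VN. Qed.

Definition corner k (w : R * R) :=
  (w.1 \in [:: x k./2; x k./2.+1]) && (w.2 \in [:: y (uphalf k); y (uphalf k).+1]).
Definition llcorner k : R * R := (x k./2, y (uphalf k)).

Lemma corner_in k w : corner k w -> in_rect (cell k) w.
Proof. by case: w => a b /andP[wa wb]; exact: cell_corner. Qed.

Lemma llcorner_corner k : corner k (llcorner k).
Proof. by rewrite /corner /= !inE !eqxx. Qed.

(** By [segD], the difference is the segment between the two corners, which is
    a sum of sides of the cell. *)
Lemma corner_seg k w p : (k < n)%N -> corner k w -> in_rect (cell k) p ->
  V (seg rho (llcorner k) p - seg rho w p).
Proof.
move=> kn kw kp; have ck := cell_rect_continuous quo kn.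
have ll := corner_in (llcorner_corner k); have wi := corner_in kw.
rewrite -(segD ck ll wi kp) addrK.
have right : V (seg rho (x k./2.+1, y (uphalf k)) (x k./2.+1, y (uphalf k).+1)).
  by rewrite /seg (right_edge g2 yle quo kn); apply: Vv; exact: right_of_lt.
case: w kw {wi} => a b; rewrite /corner /= !inE => /andP[/orP[]/eqP-> /orP[]/eqP->].
- by rewrite (segxx ck).
- exact: (Vv kn).
- exact: (Vh kn).
rewrite -(segD ck (q := (x k./2.+1, y (uphalf k)))) //.
- by apply: VD => //; exact: (Vh kn).
- by apply: cell_corner => //; rewrite !inE eqxx ?orbT.
- by apply: cell_corner => //; rewrite !inE eqxx ?orbT.
Qed.

(** Such cells are one or two steps apart in the chain, so that the lower left
    corner of the later one is an end of the common side, or the upper right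
    corner of the earlier one. *)
Lemma shared_corner k l p : (k < l)%N -> in_rect (cell k) p -> in_rect (cell l) p ->
  corner k (llcorner l).
Proof.
rewrite /in_rect /corner /= => kl /andP[/andP[_ h2] /andP[_ h4]] /andP[/andP[h5 _] /andP[h7 _]].
have := le_trans h5 h2; have := le_trans h7 h4; rewrite xle yle !inE => e1 e2.
have [-> | ->] : l./2 = k./2 \/ l./2 = k./2.+1 by lia.
  have [-> | ->] : uphalf l = uphalf k \/ uphalf l = (uphalf k).+1 by lia.
    by rewrite !eqxx.
  by rewrite !eqxx orbT.
have [-> | ->] : uphalf l = uphalf k \/ uphalf l = (uphalf k).+1 by lia.
  by rewrite !eqxx orbT.
by rewrite !eqxx !orbT.
Qed.

Lemma two_cells k l p : (k < n)%N -> (l < n)%N -> in_rect (cell k) p ->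
  in_rect (cell l) p -> V (seg rho (llcorner k) p - seg rho (llcorner l) p).
Proof.
move=> kn ln kp lp; have [kl|lk|<-] := ltngtP k l; last by rewrite subrr.
  exact/corner_seg/kp/(shared_corner kl kp).
by rewrite -opprB; apply/VN/corner_seg/lp => //; exact: shared_corner lk lp kp.
Qed.

(** The class, modulo [V], of the segments from corners to [p]; as a
    predicate, it can be compared across the gluings. *)
Definition radial p (w : chain_class R X) :=
  exists k, [/\ (k < n)%N, in_rect (cell k) p & V (seg rho (llcorner k) p - w)].

Lemma radialP k c p w : (k < n)%N -> in_rect (cell k) p -> corner k c ->
  radial p w <-> V (seg rho c p - w).
Proof.
move=> kn kp kc; have h := corner_seg kn kc kp.
split=> [[l [ln lp Vl]]|Vc].
  have -> : seg rho c p - w = (seg rho (llcorner k) p - seg rho (llcorner l) p) -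
     (seg rho (llcorner k) p - seg rho c p) + (seg rho (llcorner l) p - w).
    by rewrite opprB [_ - _ + (seg rho c p - _)]addrC subrKA subrKA.
  by apply: VD => //; apply: VB => //; exact: two_cells.
exists k; split=> //; rewrite -[seg rho (llcorner k) p](subrK (seg rho c p)).
by rewrite -addrA; exact: VD.
Qed.

(** On glued sides, start from the corners that are on these sides: the two
    segments are the same singular simplex. *)
Lemma radial_invariant : glue_invariant g x y radial.
Proof.
split=> [i t ig ht|j s jg hs]; apply/funext => w; apply/propext.
  have kn : (i.*2.-1 < n)%N by rewrite /ncells; lia.
  have ln : (i.*2 < n)%N by rewrite /ncells; lia.
  have e1 : i.*2.-1./2 = i.-1 by lia.
  have e2 : uphalf i.*2.-1 = i by lia.
  have e3 : uphalf i.*2 = i by lia.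
  rewrite (@radialP i.*2.-1 (x i.-1, y i)) //; first last.
  - by rewrite /corner e1 e2 !inE !eqxx.
  - by rewrite /in_rect /= e1 e2 ht lexx xle leqnSn.
  rewrite (@radialP i.*2 (x i.+1, y i)) //; first last.
  - by rewrite /corner doubleK e3 !inE !eqxx ?orbT.
  - by rewrite /in_rect /= doubleK e3 ht lexx xle leqnSn.
  by rewrite /seg (glue_side quo) ?lexx ?yle ?leqnSn.
have kn : (j.*2 < n)%N by rewrite /ncells; lia.
have ln : (minn j.*2.+1 g.-1.*2 < n)%N by rewrite /ncells; lia.
have e1 : (minn j.*2.+1 g.-1.*2)./2 = j by lia.
have e2 : (uphalf (minn j.*2.+1 g.-1.*2)).+1 = minn j.+2 g by lia.
have e3 : uphalf j.*2 = j by lia.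
rewrite (@radialP j.*2 (x j, y j)) //; first last.
- by rewrite /corner doubleK e3 !inE !eqxx.
- by rewrite /in_rect /= doubleK e3 hs lexx yle leqnSn.
rewrite (@radialP (minn j.*2.+1 g.-1.*2) (x j, y (minn j.+2 g))) //; first last.
- by rewrite /corner e1 e2 !inE !eqxx ?orbT.
- by rewrite /in_rect /= e1 e2 hs lexx yle -e2 leqnSn.
by rewrite /seg (glue_base quo) ?lexx ?xle ?leqnSn.
Qed.

Lemma radial_class : exists q : X -> chain_class R X,
  forall k p, (k < n)%N -> in_rect (cell k) p ->
    V (seg rho (llcorner k) p - q (rho p)).
Proof.
have [surj _ inv _] := quo.
have representative a : exists kp : nat * (R * R), [/\ (kp.1 < n)%N, in_rect (cell kp.1) kp.2 & rho kp.2 = a].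
  by have [p [k kn kp] pa] := region_surjective quo a; exists (k, p).
pose kp a := sval (cid (representative a)).
have kpP a : [/\ ((kp a).1 < n)%N, in_rect (cell (kp a).1) (kp a).2 & rho (kp a).2 = a].
  by rewrite /kp; case: cid.
exists (fun a => seg rho (llcorner (kp a).1) (kp a).2) => k p kn pk.
have [ln lp rhol] := kpP (rho p).
apply/(radialP _ kn pk (llcorner_corner k)).
rewrite (inv _ radial radial_invariant p (kp (rho p)).2) //; [|by exists k|by exists (kp (rho p)).1].
by exists (kp (rho p)).1; split=> //; rewrite subrr.
Qed.

End RadialClass.

(** * Local contractions of the glued surface *)

Section Shrinking.
Context (R : realType) (g : nat) (x y : nat -> R) (X : topologicalType).
Context (rho : R * R -> X).
Context (g2 : (1 < g)%N).
Context (xle : {mono x : i j / (i <= j)%N >-> i <= j}).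
Context (yle : {mono y : i j / (i <= j)%N >-> i <= j}).
Context (quo : grid_quotient g x y rho).
Local Notation n := (ncells g).
Local Notation cell := (gcell x y).
Context (N1 N2 : set R) (T1 T2 : R -> R).
Context (r1 : rounding g x N1 T1).
Context (r2 : rounding g y N2 T2).

Definition allowed (p : R * R) := N1 p.1 /\ N2 p.2.
Definition target (p : R * R) := (T1 p.1, T2 p.2).
Definition move_from (c p : R * R) (l : R) : R * R :=
  (c.1 + clamp01 l * (p.1 - c.1), c.2 + clamp01 l * (p.2 - c.2)).
Definition shrink p l := move_from (target p) p l.

Lemma between_convex (a b s t l : R) : a <= s <= b -> a <= t <= b ->
  a <= s + clamp01 l * (t - s) <= b.
Proof.
move=> /andP[h1 h2] /andP[h3 h4]; have l0 := clamp01_ge0 l; have l1 := clamp01_le1 l.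
have -> : s + clamp01 l * (t - s) = (1 - clamp01 l) * s + clamp01 l * t by ring.
by apply/andP; split; nra.
Qed.

Lemma move_from_rect A c p l : in_rect A c -> in_rect A p -> in_rect A (move_from c p l).
Proof. by move=> /andP[c1 c2] /andP[p1 p2]; rewrite /in_rect /= !between_convex. Qed.

Lemma target_cell k p : (k < n)%N -> allowed p -> in_rect (cell k) p ->
  in_rect (cell k) (target p).
Proof.
have [_ t1 _] := r1; have [_ t2 _] := r2.
move=> kn [a1 a2] /andP[/= p1 p2]; rewrite /in_rect /=.
by rewrite t1 ?t2 //; move: kn; rewrite /ncells; lia.
Qed.

Lemma shrink_region p l : allowed p -> region g x y p -> region g x y (shrink p l).
Proof.
move=> ap [k kn pk]; exists k => //; apply: move_from_rect => //.
exact: target_cell.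
Qed.

(** As a partial function encoded by its graph, the track of a point under the
    contraction can be transported along [grid_quotient]. *)
Definition shrink_track p : R -> X -> Prop := fun l a => allowed p /\ rho (shrink p l) = a.

Lemma shrink_track_invariant : glue_invariant g x y shrink_track.
Proof.
have [_ [glH glV] _ _] := quo.
have [_ t1 f1] := r1; have [_ t2 f2] := r2.
have shrink1 b t l : (b <= g)%N -> N1 (x b) ->
    shrink (x b, t) l = (x b, T2 t + clamp01 l * (t - T2 t)).
  move=> bg Nb; have [_ e] := f1 b bg Nb b bg.
  by rewrite /shrink /move_from /= e subrr mulr0 addr0.
have shrink2 b s l : (b <= g)%N -> N2 (y b) ->
    shrink (s, y b) l = (T1 s + clamp01 l * (s - T1 s), y b).
  move=> bg Nb; have [_ e] := f2 b bg Nb b bg.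
  by rewrite /shrink /move_from /= e subrr mulr0 addr0.
split=> [i t ig ht|j s jg hs]; apply/funext => l; apply/funext => a; apply/propext.
  have i1g : (i.-1 <= g)%N by lia.
  have track : N2 t -> rho (x i.-1, T2 t + clamp01 l * (t - T2 t)) =
      rho (x i.+1, T2 t + clamp01 l * (t - T2 t)).
    by move=> Nt; apply: glH => //; apply: between_convex => //; exact: t2.
  rewrite /shrink_track; split=> -[[/= a1 a2] <-].
    have [N' _] := f1 _ i1g a1 _ ig.
    by split=> //; rewrite !shrink1 // track.
  have [N' _] := f1 _ ig a1 _ i1g.
  by split=> //; rewrite !shrink1 // track.
have jg' : (j <= g)%N by lia.
have jg2 : (minn j.+2 g <= g)%N by lia.
have track : N1 s -> rho (T1 s + clamp01 l * (s - T1 s), y j) =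
    rho (T1 s + clamp01 l * (s - T1 s), y (minn j.+2 g)).
  by move=> Ns; apply: glV => //; apply: between_convex => //; exact: t1.
rewrite /shrink_track; split=> -[[/= a1 a2] <-].
  have [N' _] := f2 _ jg' a2 _ jg2.
  by split=> //; rewrite !shrink2 // track.
have [N' _] := f2 _ jg2 a2 _ jg'.
by split=> //; rewrite !shrink2 // track.
Qed.

Definition representative (a : X) : R * R := sval (cid2 (region_surjective quo a)).
Lemma representative_region a : region g x y (representative a). Proof. by rewrite /representative; case: cid2. Qed.
Lemma rhoK a : rho (representative a) = a. Proof. by rewrite /representative; case: cid2. Qed.

Definition homotopy (z : X * R) : X := rho (shrink (representative z.1) z.2).

Lemma homotopyE p l : region g x y p -> allowed p ->
  allowed (representative (rho p)) /\ homotopy (rho p, l) = rho (shrink p l).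
Proof.
have [_ _ inv _] := quo => rp ap.
have : shrink_track p l (rho (shrink p l)) by [].
by rewrite (inv _ _ shrink_track_invariant p (representative (rho p))) ?rhoK //; exact: representative_region.
Qed.

Lemma allowed_representative p : region g x y p -> allowed (representative (rho p)) -> allowed p.
Proof.
have [_ _ inv _] := quo => rp ap.
have : shrink_track (representative (rho p)) 0 (rho (shrink (representative (rho p)) 0)) by [].
by rewrite (inv _ _ shrink_track_invariant _ p) ?rhoK // => [[]|]; last exact: representative_region.
Qed.

Lemma homotopy1 a : homotopy (a, 1) = a.
Proof.
rewrite /homotopy /shrink /move_from /= clamp01_id ?lexx ?ler01 //.
by rewrite !mul1r ![_ + (_ - _)]addrC !subrK -surjective_pairing rhoK.
Qed.

Lemma allowed_open p : allowed p ->
  \forall p' \near p, allowed p' /\ target p' = target p.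
Proof.
have [lc1 _ _] := r1; have [lc2 _ _] := r2; move=> [a1 a2].
exists ([set s | N1 s /\ T1 s = T1 p.1], [set s | N2 s /\ T2 s = T2 p.2]).
  by split; [exact: lc1|exact: lc2].
by move=> [s t] /= [[h1 h2] [h3 h4]]; split=> //; rewrite /target /= h2 h4.
Qed.

Lemma shrink_continuous p l : allowed p ->
  {for (p, l), continuous (fun z : (R * R) * R => shrink z.1 z.2)}.
Proof.
move=> ap; have near_eq : \forall z \near (p, l),
    move_from (target p) z.1 z.2 = shrink z.1 z.2.
  exists ([set p' | allowed p' /\ target p' = target p], setT).
    by split; [exact: allowed_open|exact: filterT].
  by move=> [p' l'] /= [[_ h] _]; rewrite /shrink h.
have c1 : continuous (fun z : (R * R) * R => z.1.1).
  by move=> z; apply: (continuous_comp (f := fst) (g := fst)); exact: cvg_fst.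
have c2 : continuous (fun z : (R * R) * R => z.1.2).
  by move=> z; apply: (continuous_comp (f := fst) (g := snd)); [exact: cvg_fst|exact: cvg_snd].
have cl : continuous (fun z : (R * R) * R => clamp01 z.2).
  move=> z; apply: (continuous_comp (f := snd) (g := @clamp01 R)); first exact: cvg_snd.
  exact: clamp01_continuous.
have lin (c : R) (f : (R * R) * R -> R) : continuous f ->
    continuous (fun z : (R * R) * R => c + clamp01 z.2 * (f z - c)).
  move=> cf z; apply: cvgD; first exact: cvg_cst.
  by apply: cvgM; [exact: cl|apply: cvgB; [exact: cf|exact: cvg_cst]].
have cm : {for (p, l), continuous (fun z : (R * R) * R => move_from (target p) z.1 z.2)}.
  exact: (cvg_pair (lin _ _ c1 (p, l)) (lin _ _ c2 (p, l))).
move=> A nA; have nA' := cm A nA; apply: filterS2 near_eq nA' => z h.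
by rewrite /= h.
Qed.

Lemma in_rect_compact (A : rect R) : compact [set z | in_rect A z].
Proof.
have -> : [set z | in_rect A z] = `[xl A, xr A]%classic `*` `[yb A, yt A]%classic.
  by apply/seteqP; split=> z; rewrite /in_rect /= !in_itv /= => /andP.
by apply: compact_setX; exact: segment_compact.
Qed.

Lemma region_compact : compact (region g x y).
Proof.
have -> : region g x y = \big[setU/set0]_(k < n) [set z | in_rect (cell k) z].
  by rewrite -(bigcup_mkord n (fun k => [set z | in_rect (cell k) z])).
apply: bigsetU_compact => k _; exact: in_rect_compact.
Qed.

(** A point of the surface may have several preimages in the polygon, and a
    neighbourhood has to be found that works for all of them at once. By
    compactness of the polygon, it suffices to look near each point [p] of it:
    if [rho p = a], the contraction is continuous at [p]; if not, points near
    [p] are not mapped near [a], the surface being Hausdorff. *)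
Lemma homotopy_continuous a l : allowed (representative a) -> {for (a, l), continuous homotopy}.
Proof.
move=> al W nW.
have haus := grid_quotient_hausdorff g2 xle yle quo.
have crho := rho_continuous quo.
have key : \forall z \near (a, l), region g x y `<=`
    (fun p => rho p = z.1 -> W (rho (shrink p z.2))).
  have /compact_near_coveringP/near_covering_withinP cov := region_compact.
  apply: (cov _ (nbhs (a, l)) (fun z p => rho p = z.1 -> W (rho (shrink p z.2)))).
  move=> p rp; have [pa|pa] := pselect (rho p = a).
    have ap : allowed p by apply: allowed_representative; rewrite // pa.
    have cr : {for (p, l), continuous (fun z : (R * R) * R => shrink z.1 z.2)}.
      exact: shrink_continuous.
    (* Preimages of [a]: use the continuity of the contraction in the polygon. *)
    have nW' : nbhs (rho (shrink p l)) W.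
      by have [_ <-] := homotopyE l rp ap; rewrite pa.
    have /subspace_continuousP/(_ _ (shrink_region l ap rp)) := crho.
    move=> /(_ W nW'); rewrite /within /= => nS.
    have [[P Q] /= [Pp Ql] PQ] := cr _ nS.
    exists ([set p' | P p' /\ allowed p'], [set z : X * R | Q z.2]) => /=.
      split; last by exists (setT, Q) => //=; [split=> //; exact: filterT|move=> z []].
      by apply: filterI => //; apply: filterS (allowed_open ap) => p' [].
    move=> [p' z] /= [[Pp' ap'] Qz] rp' _.
    by apply: (PQ (p', z.2)) => //; exact: shrink_region.
  (* Other points: separate their images from [a]. *)
  move: haus; rewrite open_hausdorff => /(_ _ _ (introN eqP pa)).
  case=> -[A B] /= [/set_mem Ap /set_mem Ba] [oA oB /eqP AB].
  have nA : nbhs (rho p) A by exact: open_nbhs_nbhs.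
  have /subspace_continuousP/(_ _ rp A nA) := crho; rewrite /within /= => nP.
  exists ([set p' | region g x y p' -> A (rho p')], [set z : X * R | B z.1]) => /=.
    split=> //; exists (B, setT) => //=; last by move=> z [].
    by split; [exact: open_nbhs_nbhs|exact: filterT].
  move=> [p' z] /= [Ap' Bz] rp' pz.
  have : (A `&` B) z.1 by split=> //; rewrite -pz; exact: Ap'.
  by rewrite AB.
apply: filterS key => z /(_ _ (representative_region z.1)); apply; exact: rhoK.
Qed.

(** The contraction ends on a discrete set of points, so that each of them
    attracts an open set. *)
Lemma homotopy_start_open a c : allowed (representative a) -> homotopy (a, 0) = c ->
  \forall b \near a, allowed (representative b) /\ homotopy (b, 0) = c.
Proof.
move=> aa ac; have start p : shrink p 0 = target p.
  by rewrite /shrink /move_from clamp01_id ?lexx ?ler01 // !mul0r !addr0.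
apply: open_nbhs_nbhs; split=> //.
apply: (open_quotient quo (V := [set p | allowed p /\ rho (target p) = c])).
  rewrite openE => p [ap pc]; apply: filterS (allowed_open ap) => p' [ap' pp'].
  by split=> //; rewrite pp'.
move=> p rp; split=> [[ap pc]|[ap pc]].
  have ap' := allowed_representative rp ap; split=> //.
  by rewrite -pc -start; have [_ ->] := homotopyE 0 rp ap'.
by have [ap' ->] := homotopyE 0 rp ap; rewrite start.
Qed.

End Shrinking.

(** * The sides of the cells generate the homology *)

Section Generation.
Context (R : realType) (g : nat) (x y : nat -> R) (X : topologicalType).
Context (rho : R * R -> X).
Context (g2 : (1 < g)%N).
Context (xle : {mono x : i j / (i <= j)%N >-> i <= j}).
Context (yle : {mono y : i j / (i <= j)%N >-> i <= j}).
Context (quo : grid_quotient g x y rho).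
Local Notation n := (ncells g).
Local Notation cell := (gcell x y).
Context (V : chain_class R X -> Prop).
Context (V0 : V 0).
Context (VB : forall v w, V v -> V w -> V (v - w)).

Section WithRadial.
Context (q : X -> chain_class R X).
Context (qP : forall k p, (k < n)%N -> in_rect (cell k) p ->
  V (seg rho (llcorner x y k) p - q (rho p))).

Lemma seg_radial k p p' : (k < n)%N -> in_rect (cell k) p -> in_rect (cell k) p' ->
  V (seg rho p p' - (q (rho p') - q (rho p))).
Proof.
move=> kn kp kp'; have ck := cell_rect_continuous quo kn.
have ll : in_rect (cell k) (llcorner x y k).
  exact: (corner_in xle yle (llcorner_corner x y k)).
have -> : seg rho p p' - (q (rho p') - q (rho p)) =
    (seg rho (llcorner x y k) p' - q (rho p')) - (seg rho (llcorner x y k) p - q (rho p)).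
  rewrite -(segD ck ll kp kp'); set a := seg _ _ _; set b := seg _ _ _.
  by rewrite !opprB [RHS]addrC -[b + a - _]addrA subrKA addrCA.
by apply: VB; exact: qP.
Qed.

Section WithRounding.
Context (N1 N2 : set R) (T1 T2 : R -> R).
Context (r1 : rounding g x N1 T1).
Context (r2 : rounding g y N2 T2).
Local Notation H := (homotopy quo T1 T2).
Local Notation allowed := (allowed N1 N2).

(** The track of a point under the contraction is a straight segment inside a
    cell. *)
Lemma track_segment (gam : R -> X) s :
  seg (fun z => H (gam z.1, z.2)) (s, 0) (s, 1) =
  seg rho (target T1 T2 (representative quo (gam s))) (representative quo (gam s)).
Proof.
rewrite /seg /polygon_simplex; congr (cls (chain_of _)); apply/funext => t /=.
have /set_mem[t0] := valP t; rewrite big_ord_recl big_ord1 => t1.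
rewrite /affine_simplex !big_ord_recl !big_ord0 /= !(mulr0, mulr1, add0r, addr0).
rewrite -mulrDl t1 mul1r /homotopy /shrink /move_from /=.
have t1' : 0 <= \val t 0 (lift ord0 ord0) <= 1 by rewrite t0 -t1 ler_wpDl.
rewrite clamp01_id //; congr (rho (_, _)); move: t1; set a := \val t 0 ord0;
  set b := \val t 0 _ => t1; have -> : a = 1 - b by lra.
  by ring.
by ring.
Qed.

(** The contraction sweeps a square whose bottom side is constant, whose top
    side is the path, and whose other sides are tracks, of known class by
    [seg_radial]. *)
Lemma homotopic_path (gam : R -> X) c a b : continuous gam -> a <= b ->
  (forall s, a <= s <= b -> allowed (representative quo (gam s)) /\ H (gam s, 0) = c) ->
  V (seg (gam \o fst) (a, 0) (b, 0) - (q (gam b) - q (gam a))).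
Proof.
move=> cgam ab Hs; pose S (z : R * R) := H (gam z.1, z.2).
pose A := Rect a b 0 (1 : R).
have cS : {within [set z | in_rect A z], continuous S}.
  apply/subspace_continuousP => -[s l] /andP[/= hs hl].
  have [al _] := Hs _ hs; apply: cvg_within_filter.
  have cg : {for (s, l), continuous (fun z : R * R => (gam z.1, z.2))}.
    have c1 : {for (s, l), continuous (fun z : R * R => gam z.1)}.
      by apply: (continuous_comp (f := fst) (g := gam)); [exact: cvg_fst|exact: cgam].
    exact: (cvg_pair c1 (@cvg_snd _ _ (nbhs s) (nbhs l) _)).
  exact: (@continuous_comp _ _ _ (fun z : R * R => (gam z.1, z.2)) H (s, l) cg
    (homotopy_continuous g2 xle yle r1 r2 al)).
have [a01 a11] : in_rect A (a, 0) /\ in_rect A (a, 1) by rewrite /in_rect /= !lexx ler01 ab.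
have [b01 b11] : in_rect A (b, 0) /\ in_rect A (b, 1) by rewrite /in_rect /= !lexx ler01 ab.
have bottom : seg S (a, 0) (b, 0) = 0.
  apply: (@seg_const _ _ (Rect a b 0 0)); rewrite /in_rect /= ?lexx ?ab //.
  move=> [s l] /= /andP[hs]; rewrite -eq_le => /eqP <-.
  by rewrite /S /=; have [_ ->] := Hs s hs; have [|_ ->] := Hs a; rewrite ?lexx.
have top : seg S (a, 1) (b, 1) = seg (gam \o fst) (a, 0) (b, 0).
  have := @seg_translate _ _ (Rect a b 0 0) (gam \o fst) S (0, 1) (a, 0) (b, 0).
  rewrite /= !addr0 !add0r; apply; rewrite /in_rect /= ?lexx ?ab //.
  move=> [s l] /= /andP[hs]; rewrite -eq_le => /eqP <-.
  by rewrite addr0 add0r /S /= homotopy1.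
have side s : a <= s <= b -> V (seg S (s, 0) (s, 1) - (q (gam s) - q c)).
  move=> hs; have [al <-] := Hs s hs; rewrite /S track_segment.
  have [k kn pk] := representative_region quo (gam s).
  have := seg_radial kn (target_cell g2 r1 r2 kn al pk) pk; rewrite rhoK.
  congr (V (_ - (_ - q _))); rewrite /homotopy /shrink /move_from /=.
  by rewrite clamp01_id ?lexx ?ler01 // !mul0r !addr0.
have hb : a <= b <= b by rewrite ab lexx.
have ha : a <= a <= b by rewrite ab lexx.
have rectE : seg S (a, 0) (a, 1) + seg S (a, 1) (b, 1) = seg S (b, 0) (b, 1).
  by rewrite (segD cS) // -(segD cS a01 b01 b11) bottom add0r.
have -> : seg (gam \o fst) (a, 0) (b, 0) - (q (gam b) - q (gam a)) =
    (seg S (b, 0) (b, 1) - (q (gam b) - q c)) - (seg S (a, 0) (a, 1) - (q (gam a) - q c)).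
  rewrite -rectE top !opprB; set u := seg S _ _; set v := seg _ _ _.
  set qb := q (gam b); set qa := q (gam a); set qc := q c.
  by rewrite -[u + v + _]addrA [RHS]addrC addrA subrK addrCA subrKA.
by apply: VB; exact: side.
Qed.

End WithRounding.

Lemma path_radial (gam : R -> X) a b : continuous gam -> a <= b ->
  V (seg (gam \o fst) (a, 0) (b, 0) - (q (gam b) - q (gam a))).
Proof.
move=> cgam; move: a b; apply: interval_subdivision.
  move=> a b c ab bc Vab Vbc.
  have cg : {within [set z | in_rect (Rect a c 0 0) z], continuous (gam \o fst)}.
    apply: continuous_subspaceT => z.
    by apply: (continuous_comp (f := fst) (g := gam)); [exact: cvg_fst|exact: cgam].
  rewrite -(segD cg (q := (b, 0))); try by rewrite /in_rect /= ?lexx ?ab ?bc ?(le_trans ab bc).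
  have -> : q (gam c) - q (gam a) = (q (gam c) - q (gam b)) + (q (gam b) - q (gam a)).
    by rewrite subrKA.
  rewrite [X in _ - X]addrC opprD addrACA.
  by rewrite -[X in _ + X]opprK; apply: VB => //; rewrite -sub0r; exact: VB.
move=> s; have [k kn pk] := representative_region quo (gam s).
have /andP[px py] := pk.
have [kg ukg] : (k./2 < g)%N /\ (uphalf k < g)%N by move: kn; rewrite /ncells; lia.
have [N1 [T1 [r1 Nx]]] := rounding_exists xle kg px.
have [N2 [T2 [r2 Ny]]] := rounding_exists yle ukg py.
have al : allowed N1 N2 (representative quo (gam s)) by [].
have := homotopy_start_open g2 r1 r2 al erefl => nU.
have /nbhs_ballP[e e0 eU] := cgam s _ nU.
exists e => // a b sa ab bs; apply: (homotopic_path r1 r2 cgam ab) => t /andP[at_ tb].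
by apply: eU; rewrite /ball /= ltr_norml; apply/andP; split; lra.
Qed.

Let vertex0 : std_simplex R 0.
Proof.
by exists (const_mx 1); apply/mem_set; split=> [i|]; rewrite ?big_ord1 mxE.
Defined.

(** Sending a chain [c] to [cls c - Q (boundary c)], where [Q] extends [q] to
    0-chains, defines a homomorphism with values in [V], since this holds on
    singular edges by [path_radial]; on cycles, the second term vanishes. *)
Lemma chain_radial (c : chain R X 1) : boundary c = 0 -> V (cls c).
Proof.
pose q0 (s : singular R X 0) : zmodule (chain_class R X) := q (s vertex0).
pose Q : chain R X 0 -> zmodule (chain_class R X) := fglift q0.
have QB d e : Q (d - e) = Q d - Q e := lift_is_additive q0 d e.
have Q0 : Q 0 = 0 by rewrite -[X in Q X](subrr 0) QB subrr.
suff VQ (d : chain R X 1) : V (cls d - Q (boundary d)).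
  by move=> c0; have := VQ c; rewrite c0 Q0 subr0.
elim/freeg_subgroup_ind: d => [|d e Vd Ve|s].
- by rewrite !raddf0 Q0 subr0.
- have -> : cls (d - e) - Q (boundary (d - e)) =
      (cls d - Q (boundary d)) - (cls e - Q (boundary e)).
    by rewrite !raddfB /= QB opprD addrACA.
  exact: VB.
pose gam t := s (edge_point t); have cgam : continuous gam.
  move=> t; apply: (continuous_comp (f := @edge_point R) (g := s)).
    exact: edge_point_continuous.
  exact: cts_fun.
have cg : {within [set z | in_rect (Rect 0 1 0 (0 : R)) z], continuous (gam \o fst)}.
  apply: continuous_subspaceT => z.
  by apply: (continuous_comp (f := fst) (g := gam)); [exact: cvg_fst|exact: cgam].
have [i0 i1] : in_rect (Rect 0 1 0 (0 : R)) (0, 0) /\ in_rect (Rect 0 1 0 (0 : R)) (1, 0).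
  by rewrite /in_rect /= !lexx ler01.
have Qpt t : in_rect (Rect 0 1 0 (0 : R)) (t, 0) ->
    Q (polygon_simplex (gam \o fst) [tuple (t, 0)]) = q (gam t).
  move=> it; have ct : continuous ((gam \o fst) \o affine_simplex [tuple (t, 0)]).
    by apply: (polygon_simplex_continuous cg) => -[[|//] ?].
  rewrite /Q /polygon_simplex (chain_ofE ct) fglift1.
  transitivity (q (gam (affine_simplex [tuple (t, 0)] vertex0).1)); first by [].
  by rewrite /affine_simplex /= big_ord1 mxE mul1r.
rewrite singular1_segment (boundary_segment cg) // QB !Qpt //.
by apply: path_radial; rewrite ?ler01.
Qed.

End WithRadial.

Context (Vh : forall k, (k < n)%N -> V (cls (hedge x y rho k))).
Context (Vv : forall k, (k < n)%N -> V (cls (vedge x y rho k))).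

(** Stated for an arbitrary subgroup [V], so that it applies to the span of
    the [alpha_i] and the [gamma_j]. *)
Lemma edges_generate (c : chain R X 1) : boundary c = 0 -> V (cls c).
Proof.
have [q qP] := radial_class g2 xle yle quo V0 VB Vh Vv.
exact: chain_radial qP c.
Qed.

End Generation.

(** * The symplectic basis *)

(** For [gamma], the term [E m] will be 0. *)
Lemma alternating_telescope (W : zmodType) (E : nat -> W) j m : (j <= m)%N ->
  \sum_(k < m | (j <= k)%N) (E k + E k.+1) *~ (-1) ^+ (k - j) =
  E j - E m *~ (-1) ^+ (m - j).
Proof.
elim: m => [|m IHm]; first by rewrite leqn0 => /eqP ->; rewrite big_ord0 expr0 subrr.
rewrite big_mkcond big_ord_recr /= -big_mkcond leq_eqVlt => /orP[/eqP ->|jm].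
  rewrite ltnn addr0 subnn expr0 subrr.
  by rewrite big_pred0 // => k; have := ltn_ord k; lia.
move: jm; rewrite ltnS => jm; rewrite jm (IHm jm) subSn // exprS mulN1r mulrNz opprK.
by rewrite mulrzDl addrA subrK.
Qed.

Section SymplecticStaircase.
Context (R : realType) (g : nat) (P : nat -> rect R).
Context (X : topologicalType) (rho : R * R -> X).
Context (g2 : (1 < g)%N).
Context (stP : staircase g P).
Context (glue : gluing_map g P rho).
Local Notation n := (ncells g).
Local Notation x := (grid_x g P).
Local Notation y := (grid_y g P).
Local Notation hedge := (hedge x y rho).
Local Notation vedge := (vedge x y rho).
Local Notation H1 := (H1 R X).

Let xle : {mono x : i j / (i <= j)%N >-> i <= j}.
Proof. exact/increasing_lt/(grid_x_lt g2 stP). Qed.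
Let yle : {mono y : i j / (i <= j)%N >-> i <= j}.
Proof. exact/increasing_lt/(grid_y_lt g2 stP). Qed.
Let quo : grid_quotient g x y rho.
Proof. exact: gluing_grid_quotient. Qed.

Lemma fundamental_cycleE : fundamental_cycle g P rho = grid_cycle g x y rho.
Proof. by apply: eq_bigr => k _; rewrite (cell_grid g2 stP (ltn_ord k)). Qed.

Definition row_class i := cls (hedge i.*2).
(** The value 0 outside the range is the boundary term of the telescoping sum
    for [gamma]. *)
Definition col_class j := if (j < g)%N then cls (vedge j.*2) else 0.

(** By [edges_across] both cells of a column have the same class of horizontal
    sides. *)
Lemma cls_hedge k : (k < n)%N -> cls (hedge k) = row_class k./2.
Proof.
move=> kn; rewrite /row_class; have [kodd|keven] := boolP (odd k); last first.
  by congr (cls (hedge _)); lia.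
have [<- _] := edges_across g2 xle yle quo kn.
by rewrite /above kodd; congr (cls (hedge _)); lia.
Qed.

Lemma cls_vedge k : (k < n)%N -> cls (vedge k) = col_class (uphalf k).
Proof.
move=> kn; rewrite /col_class ifT; last by move: kn; rewrite /ncells; lia.
have [kodd|keven] := boolP (odd k); last first.
  by congr (cls (vedge _)); lia.
have [_ <-] := edges_across g2 xle yle quo kn.
by rewrite /right_of kodd; congr (cls (vedge _)); lia.
Qed.

Lemma class_alpha (i : 'I_g) :
  class_of_H1 (alpha P rho i) = \sum_(k < n | uphalf k == i) cls (hedge k).
Proof.
have yi : y i <= (y i + y i.+1) / 2 <= y i.+1.
  by have /andP[/ltW h1 /ltW h2] := midpoint_itv yle i; rewrite h1 h2.
rewrite -(row_chain_shift g2 xle yle quo (ltn_ord i) yi) -class_of_hclass; last first.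
  by rewrite unfold_in (row_chain_cycle g2 xle quo (ltn_ord i) yi).
congr (class_of_H1 (hclass _)).
apply: eq_big => k; first by rewrite (row_ofE g2 stP (ltn_ord k)).
by rewrite (row_ofE g2 stP (ltn_ord k)) (cell_grid g2 stP (ltn_ord k)) => /eqP <-.
Qed.

Lemma class_beta (j : 'I_g) :
  class_of_H1 (beta P rho j) = \sum_(k < n | k./2 == j) cls (vedge k).
Proof.
have xj : x j <= (x j + x j.+1) / 2 <= x j.+1.
  by have /andP[/ltW h1 /ltW h2] := midpoint_itv xle j; rewrite h1 h2.
rewrite -(col_chain_shift g2 xle yle quo (ltn_ord j) xj) -class_of_hclass; last first.
  by rewrite unfold_in (col_chain_cycle g2 yle quo (ltn_ord j) xj).
congr (class_of_H1 (hclass _)).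
apply: eq_big => k; first by rewrite (col_ofE g2 stP (ltn_ord k)).
by rewrite (col_ofE g2 stP (ltn_ord k)) (cell_grid g2 stP (ltn_ord k)) => /eqP <-.
Qed.

Lemma class_alpha_row (i : 'I_g) :
  class_of_H1 (alpha P rho i) = (if (0 < i)%N then row_class i.-1 else 0) + row_class i.
Proof.
rewrite class_alpha (sum_row (fun k => cls (hedge k)) g2 (ltn_ord i)); congr (_ + _).
have ig := ltn_ord i; case: ifP => i0 //; rewrite cls_hedge; last by rewrite /ncells; lia.
by congr row_class; lia.
Qed.

Lemma class_beta_col (j : 'I_g) : class_of_H1 (beta P rho j) = col_class j + col_class j.+1.
Proof.
rewrite class_beta (sum_col (fun k => cls (vedge k)) g2 (ltn_ord j)).
have jg := ltn_ord j; rewrite /col_class jg; congr (_ + _); case: ifP => j1g //.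
rewrite cls_vedge; last by rewrite /ncells; lia.
by rewrite (_ : uphalf j.*2.+1 = j.+1) /col_class ?j1g //; lia.
Qed.

Definition gamma (j : 'I_g) : H1 :=
  \sum_(k < g | (j <= k)%N) beta P rho k *~ (-1) ^+ (k - j).

Lemma class_gamma j : class_of_H1 (gamma j) = col_class j.
Proof.
rewrite /gamma raddf_sum /=.
rewrite (eq_bigr (fun k : 'I_g => (col_class k + col_class k.+1) *~ (-1) ^+ (k - j))).
  rewrite alternating_telescope; last exact: ltnW.
  by rewrite {2}/col_class ltnn mul0rz subr0.
by move=> k _; rewrite raddfMz /= class_beta_col.
Qed.

Lemma corner_point k a b : (k < n)%N -> a \in [:: x k./2; x k./2.+1] ->
  b \in [:: y (uphalf k); y (uphalf k).+1] -> rho (a, b) = rho (x 0%N, y 0%N).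
Proof. by move=> kn ka kb; apply: (grid_corner g2 xle yle quo kn). Qed.

(** All corners being the same point, the correction term of
    [circle_function_cocycle] vanishes on the sides. *)
Lemma edge_cocycle (f : R * R -> R) : continuous f -> glue_invariant g x y (@fractional R \o f) ->
  exists2 phi : cochain R X 1, cocycle1 phi & forall k, (k < n)%N ->
    (ceval phi (hedge k))%:~R =
      f (x k./2.+1, y (uphalf k)) - f (x k./2, y (uphalf k)) :> R /\
    (ceval phi (vedge k))%:~R =
      f (x k./2, y (uphalf k).+1) - f (x k./2, y (uphalf k)) :> R.
Proof.
move=> cf fg; have [phi [w [phiZ phiE]]] := circle_function_cocycle quo cf fg.
exists phi => // k kn.
have kr z : in_rect (gcell x y k) z -> region g x y z by exact: cell_region.
by split; rewrite (phiE _ _ _ kr) ?(corner_point kn) ?subrr ?subr0 //;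
  rewrite ?inE ?eqxx ?orbT //; apply: cell_corner => //; rewrite !inE eqxx ?orbT.
Qed.

(** These are the values on the sides of the cells of a cocycle that is
    Poincare dual to [gamma j]: on a horizontal side, the coefficient in
    [gamma j] of the [beta] of its column. *)
Definition dual_to_gamma (j : nat) (psi : cochain R X 1) :=
  forall k, (k < n)%N -> ceval psi (vedge k) = 0 /\
    ceval psi (hedge k) = if (j <= k./2)%N then (-1) ^+ (k./2 - j) else 0.

(** Likewise for a cocycle dual to [alpha i]; the sign comes from the
    orientation of the surface. *)
Definition dual_to_alpha (i : nat) (chi : cochain R X 1) :=
  forall k, (k < n)%N -> ceval chi (hedge k) = 0 /\
    ceval chi (vedge k) = - (uphalf k == i)%:R.

Lemma gamma_cocycle (j : 'I_g) : exists2 psi : cochain R X 1, cocycle1 psi &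
  dual_to_gamma j psi.
Proof.
pose f (z : R * R) := alternating_ramp x g j z.1.
have cf : continuous f.
  move=> z; apply: (continuous_comp (f := fst) (g := alternating_ramp x g j)).
    exact: cvg_fst.
  exact: alternating_ramp_continuous.
have [|psi psiZ psiE] := edge_cocycle cf.
  split=> [i t ig _|i s ig _] //=; apply: int_frac.
  by apply: rpredB; exact: alternating_ramp_int.
exists psi => // k kn; have [e1 e2] := psiE k kn.
have kg : (k./2 < g)%N by move: kn; rewrite /ncells; lia.
split; apply: (@intr_inj R); first by rewrite e2 subrr.
rewrite e1 (alternating_ramp_step xle) //; case: ifP => //.
by rewrite rmorphXn rmorphN1.
Qed.

Lemma alpha_cocycle (i : 'I_g) : exists2 chi : cochain R X 1, cocycle1 chi &
  dual_to_alpha i chi.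
Proof.
pose f (z : R * R) := - ramp y i z.2.
have cf : continuous f.
  move=> z; apply: cvgN; apply: (continuous_comp (f := snd) (g := ramp y i)).
    exact: cvg_snd.
  exact: ramp_continuous.
have [|chi chiZ chiE] := edge_cocycle cf.
  split=> [k t kg _|k s kg _] //=; apply: int_frac.
  by rewrite /f /= !(ramp_grid yle) rpredB ?rpredN ?natr_int.
exists chi => // k kn; have [e1 e2] := chiE k kn.
split; apply: (@intr_inj R); first by rewrite e1 subrr.
rewrite e2 /f /= !(ramp_grid yle) rmorphN /=.
rewrite ltnS leq_eqVlt [nat_of_ord i == _]eq_sym.
case: eqP => [->|_] /=; first by rewrite ltnn oppr0 subr0.
by rewrite subrr mulr0z oppr0.
Qed.

(** The cap product replaces the horizontal sides on which the cocycle is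
    supported by the vertical sides of the same cells, which add up to [beta]
    in each column. *)
Lemma cls_cap_gamma (j : 'I_g) psi : dual_to_gamma j psi ->
  cls (cap (fundamental_cycle g P rho) psi) = class_of_H1 (gamma j).
Proof.
move=> psiE; rewrite fundamental_cycleE (cap_grid_cycle g2 xle yle quo).
have halfg (k : 'I_n) : (k./2 < g)%N by have := ltn_ord k; rewrite [X in (_ < X)%N]/ncells; lia.
rewrite (partition_big (fun k : 'I_n => Ordinal (halfg k)) xpredT) //=.
rewrite /gamma raddf_sum [RHS]big_mkcond /=; apply: eq_bigr => l _.
rewrite (eq_bigl (fun k : 'I_n => k./2 == l)) => [|k]; last by rewrite -(inj_eq val_inj).
case: ifP => jl.
  rewrite raddfMz /= class_beta mulrz_suml; apply: eq_bigr => k /eqP kl.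
  by have [-> ->] := psiE k (ltn_ord k); rewrite mulr0z subr0 kl jl.
rewrite big1 // => k /eqP kl.
by have [-> ->] := psiE k (ltn_ord k); rewrite kl jl !mulr0z subr0.
Qed.

Lemma cls_cap_alpha (i : 'I_g) chi : dual_to_alpha i chi ->
  cls (cap (fundamental_cycle g P rho) chi) = class_of_H1 (alpha P rho i).
Proof.
move=> chiE; rewrite fundamental_cycleE (cap_grid_cycle g2 xle yle quo).
rewrite class_alpha [RHS]big_mkcond; apply: eq_bigr => k _.
have [-> ->] := chiE k (ltn_ord k); rewrite mulr0z sub0r mulrNz opprK.
by case: ifP => _; rewrite ?mulr1z ?mulr0z.
Qed.

Lemma eval_class_sum phi (I : finType) (e : I -> chain_class R X) (c : I -> int) :
  cocycle1 phi -> eval_class phi (\sum_i e i *~ c i) = \sum_i eval_class phi (e i) * c i.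
Proof.
move=> phiZ; have [r rE] : exists r : I -> chain R X 1, forall i, cls (r i) = e i.
  by exists (fun i => sval (cid (cls_surj (e i)))) => i; case: cid.
rewrite (eq_bigr (fun i => cls (r i *~ c i))) => [|i _]; last by rewrite raddfMz /= rE.
rewrite -raddf_sum eval_cls // raddf_sum; apply: eq_bigr => i _ /=.
by rewrite raddfMz /= -rE eval_cls // -mulrzr intz.
Qed.

Lemma eval_edges phi (I : finType) (Q : pred I) (e : I -> chain R X 1) : cocycle1 phi ->
  eval_class phi (\sum_(k | Q k) cls (e k)) = \sum_(k | Q k) ceval phi (e k).
Proof. by move=> phiZ; rewrite -raddf_sum eval_cls // raddf_sum. Qed.

Lemma gamma_on_alpha (i j : 'I_g) psi : cocycle1 psi ->
  dual_to_gamma j psi ->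
  eval_class psi (class_of_H1 (alpha P rho i)) = (i == j)%:R.
Proof.
move=> psiZ psiE; rewrite class_alpha eval_edges //.
rewrite (sum_row (fun k => ceval psi (hedge k)) g2 (ltn_ord i)).
have ig := ltn_ord i; have n2 : (i.*2 < n)%N by rewrite /ncells; lia.
have n1 : (i.*2.-1 < n)%N by rewrite /ncells; lia.
have [_ ->] := psiE _ n2; have [_ ->] := psiE _ n1.
rewrite doubleK (_ : i.*2.-1./2 = i.-1); last by lia.
rewrite -(inj_eq val_inj) /=; case: (ltngtP i j) => ij.
- have -> : (j <= i.-1)%N = false by lia.
  by case: ifP.
- have -> : (j <= i.-1)%N by lia.
  rewrite ifT; last by lia.
  by rewrite -[X in _ + _ ^+ (X - _)](@prednK i) ?subSn ?exprS ?mulN1r ?subrr //; lia.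
- rewrite -ij subnn expr0; case: ifP => // i0.
  by rewrite (_ : (i <= i.-1)%N = false) //; lia.
Qed.

Lemma gamma_on_gamma (i j : 'I_g) psi : cocycle1 psi ->
  dual_to_gamma j psi ->
  eval_class psi (class_of_H1 (gamma i)) = 0.
Proof.
move=> psiZ psiE; rewrite class_gamma /col_class ltn_ord eval_cls //.
have ig := ltn_ord i; have n2 : (i.*2 < n)%N by rewrite /ncells; lia.
by have [-> _] := psiE _ n2.
Qed.

Lemma alpha_on_alpha (i j : 'I_g) chi : cocycle1 chi ->
  dual_to_alpha j chi ->
  eval_class chi (class_of_H1 (alpha P rho i)) = 0.
Proof.
move=> chiZ chiE; rewrite class_alpha eval_edges // big1 // => k _.
by have [-> _] := chiE k (ltn_ord k).
Qed.

Lemma alpha_on_gamma (i j : 'I_g) chi : cocycle1 chi ->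
  dual_to_alpha j chi ->
  eval_class chi (class_of_H1 (gamma i)) = - (i == j)%:R.
Proof.
move=> chiZ chiE; rewrite class_gamma /col_class ltn_ord eval_cls //.
have ig := ltn_ord i; have n2 : (i.*2 < n)%N by rewrite /ncells; lia.
have [_ ->] := chiE _ n2; congr (- (_ %:R)).
by rewrite -(inj_eq val_inj) /= (_ : uphalf i.*2 = i) //; lia.
Qed.

Definition basis_element (s : 'I_g + 'I_g) : H1 :=
  match s with inl j => alpha P rho j | inr j => gamma j end.

(** Generation: the sides of the cells are combinations of the [alpha_i] and
    [gamma_j], by induction along the rows and by [class_gamma]. Uniqueness:
    the dual cocycles read off the coordinates. *)
Lemma basis_element_is_basis : is_basis basis_element.
Proof.
pose e s := class_of_H1 (basis_element s).
pose V (w : chain_class R X) := exists c : {ffun 'I_g + 'I_g -> int}, w = \sum_s e s *~ c s.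
have V0 : V 0 by exists 0; rewrite big1 // => s _; rewrite ffunE mulr0z.
have VB v w : V v -> V w -> V (v - w).
  move=> [c ->] [d ->]; exists (c - d); rewrite -sumrB; apply: eq_bigr => s _.
  by rewrite !ffunE mulrzBr.
have Ve s : V (e s).
  exists [ffun s' => (s' == s)%:R]; rewrite (bigD1 s) //= ffunE eqxx mulr1z.
  by rewrite big1 ?addr0 // => s' /negPf s's; rewrite ffunE s's mulr0z.
have Vrow i : (i < g)%N -> V (row_class i).
  elim: i => [|i IHi] ig.
    have := Ve (inl (Ordinal ig)).
    by rewrite /e class_alpha_row /= add0r.
  have := VB _ _ (Ve (inl (Ordinal ig))) (IHi (ltnW ig)).
  by rewrite /e class_alpha_row /= addrC addKr.
have Vcol j : (j < g)%N -> V (col_class j).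
  by move=> jg; have := Ve (inr (Ordinal jg)); rewrite /e class_gamma.
have generate c : boundary c = 0 -> V (cls c).
  apply: (edges_generate g2 xle yle quo V0 VB) => k kn.
    by rewrite cls_hedge //; apply: Vrow; move: kn; rewrite /ncells; lia.
  by rewrite cls_vedge //; apply: Vcol; move: kn; rewrite /ncells; lia.
have coord_alpha (c : {ffun 'I_g + 'I_g -> int}) (j : 'I_g) psi : cocycle1 psi ->
    dual_to_gamma j psi ->
    eval_class psi (\sum_s e s *~ c s) = c (inl j).
  move=> psiZ psiE; rewrite eval_class_sum // (bigD1 (inl j)) //=.
  rewrite (gamma_on_alpha j psiZ psiE) eqxx mul1r big1 ?addr0 // => -[i|i] ij.
    have ij' : (i == j) = false by apply: contraNF ij => /eqP ->.
    by rewrite /e (gamma_on_alpha i psiZ psiE) ij' mul0r.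
  by rewrite /e (gamma_on_gamma i psiZ psiE) mul0r.
have coord_gamma (c : {ffun 'I_g + 'I_g -> int}) (j : 'I_g) chi : cocycle1 chi ->
    dual_to_alpha j chi ->
    eval_class chi (\sum_s e s *~ c s) = - c (inr j).
  move=> chiZ chiE; rewrite eval_class_sum // (bigD1 (inr j)) //=.
  rewrite (alpha_on_gamma j chiZ chiE) eqxx mulN1r big1 ?addr0 // => -[i|i] ij.
    by rewrite /e (alpha_on_alpha i chiZ chiE) mul0r.
  have ij' : (i == j) = false by apply: contraNF ij => /eqP ->.
  by rewrite /e (alpha_on_gamma i chiZ chiE) ij' oppr0 mul0r.
have classE (c : {ffun 'I_g + 'I_g -> int}) :
    class_of_H1 (\sum_s basis_element s *~ c s) = \sum_s e s *~ c s.
  by rewrite raddf_sum; apply: eq_bigr => s _; rewrite raddfMz.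
move=> h; have [z Zz <-] := H1_cycle h.
have [|c zc] := generate z; first by apply/eqP.
exists c; split.
  by apply: class_of_H1_inj; rewrite class_of_hclass // classE.
move=> d hd; have : \sum_s e s *~ c s = \sum_s e s *~ d s.
  by rewrite -zc -class_of_hclass // hd classE.
move=> cd; apply/ffunP => -[j|j].
  have [psi psiZ psiE] := gamma_cocycle j.
  by rewrite -(coord_alpha c j psi) // cd (coord_alpha d j psi).
have [chi chiZ chiE] := alpha_cocycle j.
by apply: oppr_inj; rewrite -(coord_gamma c j chi) // cd (coord_gamma d j chi).
Qed.

Lemma staircase_symplectic :
  symplectic_basis (intersection (fundamental_cycle g P rho)) (alpha P rho) gamma.
Proof.
split; first exact: basis_element_is_basis.
have mu0 : boundary (fundamental_cycle g P rho) = 0.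
  by rewrite fundamental_cycleE (grid_cycle_boundary g2 xle yle quo).
move=> j k; have [psi psiZ psiE] := gamma_cocycle k.
have [chi chiZ chiE] := alpha_cocycle k.
have [psi' psi'Z psi'E] := gamma_cocycle j.
have [chi' chi'Z chi'E] := alpha_cocycle j.
split.
- rewrite (intersectionE mu0 chi'Z chiZ (cls_cap_alpha chi'E) (cls_cap_alpha chiE)).
  exact: alpha_on_alpha chiE.
- rewrite (intersectionE mu0 psi'Z psiZ (cls_cap_gamma psi'E) (cls_cap_gamma psiE)).
  exact: gamma_on_gamma psiE.
- rewrite (intersectionE mu0 chi'Z psiZ (cls_cap_alpha chi'E) (cls_cap_gamma psiE)).
  exact: gamma_on_alpha psiE.
Qed.

End SymplecticStaircase.

Theorem proposition3p1 (R : realType) (g : nat) (a : 'I_g.-1 -> R)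
    (P : nat -> rect R) (rho : R * R -> curve a) :
  (2 <= g)%N ->
  (forall i, 1 < a i) ->
  (forall i j : 'I_g.-1, (i < j)%N -> a i < a j) ->
  staircase g P ->
  curve_model P rho ->
  exists gamma : 'I_g -> H1 R (curve a),
    symplectic_basis (intersection (fundamental_cycle g P rho))
      (alpha P rho) gamma /\
    forall j : 'I_g,
      gamma j = \sum_(k < g | (j <= k)%N) beta P rho k *~ (-1) ^+ (k - j).
Proof.
move=> g2 _ _ stP [glue _]; exists (gamma P rho); split => //.
exact: staircase_symplectic.
Qed.
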